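(* Let $\psi\in AM(\mathscr{C}_{A_1\times A_2})$ be such that $P(\log\psi)=0$ and $\psi$ is the restriction to $\mathscr{C}_{A_1\times A_2}$ of its Gibbs measure $\mu_\psi$. For $q\in\mathbb{R}$ let $$\beta_\psi(q)=-\frac{P\big(q(1-s)\log I_{\psi,1}+s\log I_{\psi,q}\big)}{\log r_1}=-\frac{1}{\log r_1}\lim_{n\to\infty}\frac1n\log\sum_{w_1\in A_1^n}I_{\psi,1}([w_1])^{q(1-s)}I_{\psi,q}([w_1])^s,\qquad s=\frac{\log r_1}{\log r_2},$$ and for $\alpha\ge 0$ let $$E_{\mu_\psi}(\alpha)=\Big\{(x,y)\in\operatorname{supp}(\psi):\ \lim_{n\to\infty}\frac{\log_{r_2}\mu_\psi\big(B_n(x,y)\big)}{-n}=\alpha\Big\},\qquad \beta_\psi^*(\alpha)=\inf_{q\in\mathbb{R}}\big(\alpha q-\beta_\psi(q)\big),$$ where $B_n(x,y)$ is the closed ball of radius $r_2^{-n}$ centred at $(x,y)$ in $(\mathbb{A}_1\times\mathbb{A}_2,d)$. Then: (i) The concave function $\beta_\psi$ is differentiable and non-decreasing on $\mathbb{R}$. (ii) For every $\alpha\in\mathbb{R}_+$, $\dim E_{\mu_\psi}(\alpha)=\beta_\psi^*(\alpha)$ if $\beta_\psi^*(\alpha)>0$, and $E_{\mu_\psi}(\alpha)=\emptyset$ if $\beta_\psi^*(\alpha)<0$.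
   Context: **Symbolic spaces.** $2\le r_1\le r_2$ are integers; for $i\in\{1,2\}$, $A_i=\{0,\dots,r_i-1\}$ and $\mathbb{A}_i=A_i^{\mathbb{N}^*}$ is the one-sided symbolic space, with shift $\sigma_i$. The symbolic space over $A_1\times A_2$ is identified with $\mathbb{A}_1\times\mathbb{A}_2$, with shift $\sigma=(\sigma_1,\sigma_2)$. For a finite word $w$, $[w]$ is the cylinder of infinite words with prefix $w$; $|w|$ is the length of $w$; $x|n$ is the prefix of length $n$ of $x$. $\mathscr{C}_A$ denotes the set of cylinders over a finite alphabet $A$ (including that of the empty word), with concatenation $[w]\cdot[w']=[w\cdot w']$; elements of $\mathscr{C}_{A_1\times A_2}$ are the sets $[w_1]\times[w_2]$ with $w_1\in A_1^n$, $w_2\in A_2^n$, $n\ge 0$. $\mathbb{A}_i$ has the metric $d_i(z,z')=r_i^{-|z\wedge z'|}$, where $z\wedge z'$ is the longest common prefix, and $\mathbb{A}_1\times\mathbb{A}_2$ has the metric $d((x,y),(x',y'))=\max(d_1(x,x'),d_2(y,y'))$. $\dim$ is the Hausdorff dimension with respect to $d$. With $g(n)$ the smallest integer $m$ such that $r_1^{-m}\le r_2^{-n}$, one has $B_n(x,y)=[x|g(n)]\times[y|n]$. **Almost-multiplicative functions.** For a finite alphabet $A$ with $\#A\ge 2$, $AM(\mathscr{C}_A)$ is the set of non-zero functions $\psi:\mathscr{C}_A\to\mathbb{R}_+$ for which there is $C>0$ with $C^{-1}\psi([w])\psi([w'])\le\psi([w]\cdot[w'])\le C\psi([w])\psi([w'])$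 for all $[w],[w']\in\mathscr{C}_A$. Its support is $\operatorname{supp}(\psi)=\{z\in A^{\mathbb{N}^*}:\forall n\ge 0,\ \psi([z|n])>0\}$. Its topological pressure is $P(\log\psi)=\lim_{n\to\infty}\frac1n\log\sum_{w\in A^n}\psi([w])$ (the limit exists). **Gibbs measure.** For $\psi\in AM(\mathscr{C}_A)$ there is a unique ergodic $\sigma$-invariant probability measure $\mu_\psi$ on $\operatorname{supp}(\psi)$ (extended by $0$ outside) such that, for some $C>0$, $C^{-1}e^{-nP(\log\psi)}\psi([w])\le\mu_\psi([w])\le Ce^{-nP(\log\psi)}\psi([w])$ for all $n\ge 1$, $w\in A^n$. It is called the Gibbs measure of $\psi$. That $\psi$ is the restriction of its Gibbs measure means $\psi([w])=\mu_\psi([w])$ for all cylinders. **Conventions.** $0^\gamma=0$ for all $\gamma\in\mathbb{R}$. For $\psi\in AM(\mathscr{C}_{A_1\times A_2})$ and $q\in\mathbb{R}$, $I_{\psi,q}:\mathscr{C}_{A_1}\to\mathbb{R}_+$ is $I_{\psi,q}([w_1])=\sum_{w_2\in A_2^{|w_1|}}\psi([w_1]\times[w_2])^q$. *)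

(* Defs.v *)
From HB Require Import structures.
From mathcomp Require Import all_boot all_order all_algebra.
From mathcomp Require Import all_classical all_reals all_analysis.
Import Order.TTheory GRing.Theory Num.Theory.
Import numFieldNormedType.Exports.

Set Implicit Arguments.
Unset Strict Implicit.
Unset Printing Implicit Defensive.

Local Open Scope classical_set_scope.
Local Open Scope ring_scope.

(* MathComp-Analysis measurable types are pointed, hence so are alphabets. *)
#[short(type="alphabetType")]
HB.structure Definition Alphabet := {A of Finite A & Pointed A}.

HB.instance Definition _ (n : nat) := isPointed.Build 'I_n.+1 ord0.

(* The alphabet {0, ..., r - 1}; the successor form makes it pointed, and it
   is 'I_r as soon as r >= 1. *)
Notation letters r := ('I_(r.-1.+1)).

HB.instance Definition _ (A B : alphabetType) := Pointed.on (A * B)%type.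

(* Powers with the convention 0 ^ g = 0 for every real g; the library's powR
   has 0 `^ 0 = 1. *)
Definition rpow {R : realType} (x g : R) : R :=
  if x == 0 then 0 else x `^ g.

Section Symbolic.
Context {R : realType} {A : alphabetType}.

(* Infinite words are indexed from 0, so that [mkseq z n] is the prefix z|n. *)
Definition symb_shift (z : nat -> A) : nat -> A := fun n => z n.+1.

Definition cylinder (w : seq A) : set (nat -> A) :=
  [set z | mkseq z (size w) = w].

Definition cylinders : set (set (nat -> A)) := range cylinder.

(* Functions on cylinders are represented as functions on finite words: w is
   determined by [w] when #A >= 2, and concatenation of cylinders is
   concatenation of words. *)
Definition almost_multiplicative (psi : seq A -> R) : Prop :=
  [/\ forall w, 0 <= psi w,
      exists w, psi w != 0 &
      exists2 C : R, 0 < C &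
        forall w w', C^-1 * psi w * psi w' <= psi (w ++ w')
                     /\ psi (w ++ w') <= C * psi w * psi w'].

Definition supp (psi : seq A -> R) : set (nat -> A) :=
  [set z | forall n, 0 < psi (mkseq z n)].

(* [pressure psi] is P(log psi). *)
Definition pressure (psi : seq A -> R) : R :=
  lim ((fun n : nat => n%:R^-1 * ln (\sum_(w : n.-tuple A) psi w)) @ \oo).

End Symbolic.

Arguments cylinders : clear implicits.

(* The Borel sigma-algebra of the symbolic space. *)
Notation symbolic A := (g_sigma_algebraType (cylinders A)).

Definition is_gibbs {R : realType} {A : alphabetType} (psi : seq A -> R)
    (mu : probability (symbolic A) R) : Prop :=
  [/\ forall B : set (symbolic A), measurable B -> mu (symb_shift @^-1` B) = mu B,
      forall B : set (symbolic A), measurable B -> symb_shift @^-1` B = B ->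
        mu B = 0%E \/ mu B = 1%E,
      mu (~` supp psi) = 0%E &
      exists2 C : R, 0 < C & forall w : seq A, (1 <= size w)%N ->
        ((C^-1 * expR (- (size w)%:R * pressure psi) * psi w)%:E
           <= mu (cylinder w))%E /\
        (mu (cylinder w)
           <= (C * expR (- (size w)%:R * pressure psi) * psi w)%:E)%E].

Section Hausdorff.
Context {R : realType} {T : Type} (d : T -> T -> R).
Local Open Scope ereal_scope.

Definition diam (U : set T) : \bar R :=
  ereal_sup [set (d x y)%:E | x in U & y in U].

(* diam(U) ^ s, with 0 ^ 0 = 1 on nonempty sets and 0 on the empty set, so
   that the 0-dimensional measure is the counting measure. *)
Definition gauge (s : R) (U : set T) : \bar R :=
  if U == set0 then 0 else diam U `^ s.

Definition hausdorff_premeasure (s delta : R) (E : set T) : \bar R :=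
  ereal_inf [set \sum_(0 <= i <oo) gauge s (U i) | U in
    [set U : (set T)^nat |
      E `<=` \bigcup_i U i /\ forall i, diam (U i) <= delta%:E]].

Definition hausdorff_measure (s : R) (E : set T) : \bar R :=
  ereal_sup [set hausdorff_premeasure s delta E |
    delta in [set delta : R | (0 < delta)%R]].

Definition hausdorff_dim (E : set T) : \bar R :=
  ereal_inf [set s%:E | s in
    [set s : R | (0 <= s)%R /\ hausdorff_measure s E = 0]].

End Hausdorff.

(* r ^ - |z /\ z'|: the length of the longest common prefix of two distinct
   infinite words is the first index at which they differ. *)
Definition word_dist {R : realType} {A : alphabetType} (r : nat)
    (z z' : nat -> A) : R :=
  if pselect (exists n, z n != z' n) is left zz'
  then r%:R ^- ex_minn zz' else 0.

Section SelfAffine.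
Context {R : realType} (r1 r2 : nat).

Notation A1 := (letters r1).
Notation A2 := (letters r2).

(* A pair of infinite words (x, y) is identified with the infinite word
   n |-> (x n, y n) over A1 * A2. *)
Definition pair_dist (z z' : nat -> A1 * A2) : R :=
  Num.max (word_dist r1 (fst \o z) (fst \o z'))
          (word_dist r2 (snd \o z) (snd \o z')).

Definition cball (n : nat) (z : nat -> A1 * A2) : set (nat -> A1 * A2) :=
  [set z' | pair_dist z z' <= r2%:R ^- n].

Definition level_set (psi : seq (A1 * A2) -> R)
    (mu : probability (symbolic (A1 * A2)%type) R) (alpha : R) :
    set (nat -> A1 * A2) :=
  [set z | supp psi z /\
    (fun n : nat => ln (fine (mu (cball n z))) / ln r2%:R / - n%:R) @ \oo
      --> alpha].

Definition partial_sum (psi : seq (A1 * A2) -> R) (q : R) (w1 : seq A1) : R :=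
  \sum_(w2 : (size w1).-tuple A2) rpow (psi (zip w1 w2)) q.

Definition beta (psi : seq (A1 * A2) -> R) (q : R) : R :=
  let s := ln r1%:R / ln r2%:R in
  - pressure (fun w1 : seq A1 =>
      rpow (partial_sum psi 1 w1) (q * (1 - s)) * rpow (partial_sum psi q w1) s)
  / ln r1%:R.

End SelfAffine.

Arguments pair_dist {R} r1 r2.
Arguments cball {R} r1 r2.
Arguments beta {R} r1 r2.

(* The concave Legendre transform; it takes values in [-oo, +oo[. *)
Definition legendre {R : realType} (b : R -> R) (alpha : R) : \bar R :=
  ereal_inf [set (alpha * q - b q)%:E | q in [set: R]].

(* Main.v *)
(* Only the values of [mu] on cylinders matter, and all estimates are made on words of a
   fixed finite length; the almost multiplicativity of [psi] costs bounded factors, which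
   disappear after taking logarithms and dividing by the length.

   Write I_q for the fibre sums of psi^q, Z_n(q) for the sum over words of length n of
   I_1^(q(1-s)) I_q^s, and P(q) = lim (1/n) log Z_n(q), so that beta = - P / log r1 and
   log Z_n(q) = n P(q) + O(1).  The weights nu_q(w1,w2) = I_1^(q(1-s)) I_q^s psi^q / I_q
   disintegrate Z_n(q), and the observable F = (1-s) log I_1 + s log psi plays the role of
   the derivative of log nu_q in q.

   Convexity of P is Hoelder's inequality.  If P had slopes a < b at q, then F/n would be
   close to b and close to a with nu_q-probabilities bounded below uniformly in n, whereas
   F/n > b + e has vanishing probability.  Cutting words into k blocks of length m, every
   block is low with a conditional probability bounded below, so F/(km) is close to b with
   probability exponentially small in k: a contradiction.

   Upper bound: along a point of the level set, the weight of the approximate square B_n is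
   at least mu(B_n)^q r2^(n (beta(q) - e)) for infinitely many n, because the bounded
   sequence (1/n) (log I_q - q log I_1)(x|n) cannot keep decreasing along n -> g(n).

   Lower bound: minimising alpha q - beta(q) + d q^2/2 gives q at which the slope of beta is
   nearly alpha.  Differentiability makes F/n concentrate under nu_q, and the pigeonhole
   principle selects a set of words on which log I_1 and the weights are nearly constant.
   Concatenating such words, with parameters that improve slowly, yields a Moran subset of
   the level set whose mass distribution gives the dimension; a cover of it is reduced to
   finitely many balls by Koenig's lemma. *)

(* The two scales n and g(n) of a ball interact through one relation, s g(n) = n + O(1). It makes
   two unknown rates disappear: the rate b of log I_1 cancels in the logarithm of a ball mass, and
   the entropy h of the first coordinate cancels in the mass that the Moran construction gives to a
   ball. So only F has to be prescribed; b and h may be anything. They must, however, be the same at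
   n and at g(n), hence along the whole construction, although the words selected by pigeonhole come
   with rates that depend on the precision. These rates stay in a bounded set, and compactness
   freezes them. The quadratic penalty is there because the infimum of alpha q - beta(q) need not be
   attained: alpha may be a slope reached only as q tends to infinity. Since d q^2 stays bounded, d
   q tends to 0 with d. In the proof of differentiability, the exponent s in I_q^s makes moments
   easy to bound above but not below. Lower bounds on probabilities are therefore obtained by moving
   q by an amount of order 1/n, where the loss is a constant independent of n. *)
Require Import Defs.
From HB Require Import structures.
From mathcomp Require Import all_boot all_order all_algebra.
From mathcomp Require Import all_classical all_reals all_analysis.
From mathcomp Require Import ring lra.
Import Order.TTheory GRing.Theory Num.Theory.
Import numFieldNormedType.Exports.
Set Implicit Arguments.
Unset Strict Implicit.
Unset Printing Implicit Defensive.
Local Open Scope classical_set_scope.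
Local Open Scope ring_scope.

(** * Powers, comparison up to constants, sums over words *)

(* A sealed copy of [rpow]: unification would otherwise unfold it. *)
HB.lock Definition zpow {R : realType} (x g : R) : R := rpow x g.

Section Zpow.
Context {R : realType}.
Implicit Types x y q p C D : R.

Lemma zpow_expR x q : 0 < x -> zpow x q = expR (q * ln x).
Proof. by move=> x0; rewrite unlock /rpow /powR gt_eqF. Qed.

Lemma zpow0l q : zpow 0 q = 0 :> R.
Proof. by rewrite unlock /rpow eqxx. Qed.

Lemma zpow1l q : zpow 1 q = 1 :> R.
Proof. by rewrite zpow_expR ?ltr01// ln1 mulr0 expR0. Qed.

Lemma zpow_ge0 x q : 0 <= zpow x q.
Proof. by rewrite unlock /rpow; case: eqP => // _; exact: powR_ge0. Qed.

Lemma zpow_gt0 x q : 0 < x -> 0 < zpow x q.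
Proof. by move=> x0; rewrite zpow_expR// expR_gt0. Qed.

Lemma zpow1 x : 0 <= x -> zpow x 1 = x.
Proof.
rewrite le_eqVlt => /predU1P[<-|x0]; first by rewrite zpow0l.
by rewrite zpow_expR// mul1r lnK.
Qed.

Lemma ln_zpow x q : 0 < x -> ln (zpow x q) = q * ln x.
Proof. by move=> x0; rewrite zpow_expR// expRK. Qed.

Lemma zpowM x y q : 0 <= x -> 0 <= y -> zpow (x * y) q = zpow x q * zpow y q.
Proof.
rewrite le_eqVlt => /predU1P[<-|x0]; first by rewrite mul0r zpow0l mul0r.
rewrite le_eqVlt => /predU1P[<-|y0]; first by rewrite mulr0 zpow0l mulr0.
by rewrite !zpow_expR ?mulr_gt0// lnM ?posrE// mulrDr expRD.
Qed.

Lemma zpowD x p q : 0 <= x -> zpow x (p + q) = zpow x p * zpow x q.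
Proof.
rewrite le_eqVlt => /predU1P[<-|x0]; first by rewrite !zpow0l mul0r.
by rewrite !zpow_expR// mulrDl expRD.
Qed.

Lemma zpowrM x p q : 0 <= x -> zpow x (p * q) = zpow (zpow x p) q.
Proof.
rewrite le_eqVlt => /predU1P[<-|x0]; first by rewrite !zpow0l.
by rewrite [RHS]zpow_expR ?zpow_gt0// ln_zpow// zpow_expR// mulrA (mulrC p).
Qed.

Lemma zpowN x q : 0 <= x -> zpow x (- q) = (zpow x q)^-1.
Proof.
rewrite le_eqVlt => /predU1P[<-|x0]; first by rewrite !zpow0l invr0.
by rewrite !zpow_expR// mulNr expRN.
Qed.

Lemma zpow_expR_l x q : zpow (expR x) q = expR (q * x).
Proof. by rewrite zpow_expR ?expR_gt0// expRK. Qed.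

Lemma ler_zpow x y q : 0 <= q -> 0 <= x -> x <= y -> zpow x q <= zpow y q.
Proof.
move=> q0; rewrite le_eqVlt => /predU1P[<-|x0 xy]; first by rewrite zpow0l zpow_ge0.
have y0 := lt_le_trans x0 xy.
by rewrite !zpow_expR// ler_expR ler_wpM2l// ler_ln.
Qed.

Lemma zpow_le1_nincr x p q : 0 <= x <= 1 -> p <= q -> zpow x q <= zpow x p.
Proof.
move=> /andP[]; rewrite le_eqVlt => /predU1P[<-|x0 x1 pq]; first by rewrite !zpow0l.
by rewrite !zpow_expR// ler_expR ler_wnM2r// ln_le0.
Qed.

Definition cmp C x y := x <= C * y /\ y <= C * x.

Lemma cmp_refl x : cmp 1 x x.
Proof. by split; rewrite mul1r. Qed.

Lemma cmp_trans C D x y z : 0 <= C -> 0 <= D -> cmp C x y -> cmp D y z -> cmp (C * D) x z.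
Proof.
move=> C0 D0 [xy yx] [yz zy]; split.
  by rewrite -mulrA; apply: (le_trans xy); rewrite ler_wpM2l.
by rewrite (mulrC C) -mulrA; apply: (le_trans zy); rewrite ler_wpM2l.
Qed.

Lemma cmpM C D x y x' y' : 0 <= C -> 0 <= D -> 0 <= x -> 0 <= y -> 0 <= x' -> 0 <= y' ->
  cmp C x y -> cmp D x' y' -> cmp (C * D) (x * x') (y * y').
Proof.
move=> C0 D0 x0 y0 x'0 y'0 [xy yx] [x'y' y'x'].
by split; rewrite mulrACA; apply: ler_pM.
Qed.

Lemma cmp_sum (I : eqType) (s : seq I) (f g : I -> R) C :
  {in s, forall i, cmp C (f i) (g i)} -> cmp C (\sum_(i <- s) f i) (\sum_(i <- s) g i).
Proof.
by move=> fg; split; rewrite mulr_sumr big_seq [leRHS]big_seq; apply: ler_sum => i /fg[].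
Qed.

Lemma cmp_eq0 C x y : 0 <= x -> 0 <= y -> cmp C x y -> (x == 0) = (y == 0).
Proof.
move=> x0 y0 [xy yx]; apply/eqP/eqP => e.
  by apply/eqP; rewrite eq_le y0 andbT (le_trans yx)// e mulr0.
by apply/eqP; rewrite eq_le x0 andbT (le_trans xy)// e mulr0.
Qed.

Lemma cmp_gt0 C x y : 0 <= x -> 0 <= y -> cmp C x y -> (0 < x) = (0 < y).
Proof. by move=> x0 y0 xy; rewrite !lt_def x0 y0 (cmp_eq0 x0 y0 xy). Qed.

Lemma cmp_ln c x y : 0 < x -> 0 < y -> cmp (expR c) x y <-> `|ln x - ln y| <= c.
Proof.
move=> x0 y0; rewrite -[x in cmp _ x _]lnK// -[y in cmp _ _ y]lnK// /cmp -!expRD !ler_expR.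
rewrite ler_norml; split=> [[]|/andP[]]; lra.
Qed.

Lemma cmp_zpow c q x y : 0 <= x -> 0 <= y ->
  cmp (expR c) x y -> cmp (expR (`|q| * c)) (zpow x q) (zpow y q).
Proof.
move=> x0 y0 xy; have := cmp_gt0 x0 y0 xy.
move: x0; rewrite le_eqVlt => /predU1P[x0|x0].
  rewrite -x0 ltxx lt_def y0 andbT => /esym/negbT; rewrite negbK => /eqP ->.
  by rewrite zpow0l /cmp mulr0.
rewrite x0 => /esym yp; apply/cmp_ln; rewrite ?zpow_gt0// !ln_zpow//.
by rewrite -mulrBr normrM ler_wpM2l//; apply/cmp_ln.
Qed.

(** Convexity of the exponential between [ln x] and [ln y]. Zero is treated apart because
    [zpow 0 p = 0] even for [p = 0]. *)
Lemma youngR p x y : 0 <= p <= 1 -> 0 <= x -> 0 <= y ->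
  zpow x p * zpow y (1 - p) <= p * x + (1 - p) * y.
Proof.
move=> /andP[p0 p1]; rewrite le_eqVlt => /predU1P[<-|x0].
  by rewrite zpow0l mul0r mulr0 add0r => y0; rewrite mulr_ge0// subr_ge0.
rewrite le_eqVlt => /predU1P[<-|y0].
  by rewrite zpow0l !mulr0 addr0 mulr_ge0// ltW.
have := @convex_expR R (@Itv01 R p p0 p1) (ln x) (ln y).
rewrite !zpow_expR// -expRD.
rewrite !convRE /= /unstable.onem !lnK ?posrE//.
Qed.

(** Young's inequality for the normalised terms [f i / F] and [g i / G], each family having sum
    1. *)
Lemma hoelder_sum (I : Type) (s : seq I) (f g : I -> R) p :
  0 <= p <= 1 -> (forall i, 0 <= f i) -> (forall i, 0 <= g i) ->
  \sum_(i <- s) zpow (f i) p * zpow (g i) (1 - p) <=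
  zpow (\sum_(i <- s) f i) p * zpow (\sum_(i <- s) g i) (1 - p).
Proof.
move=> p01 f0 g0; set F := \sum_(i <- s) f i; set G := \sum_(i <- s) g i.
have F0 : 0 <= F by exact: sumr_ge0.
have G0 : 0 <= G by exact: sumr_ge0.
have [F00|Fp] := eqVneq F 0.
  rewrite F00 zpow0l mul0r.
  elim: s @F @G F00 F0 G0 => [|i s IH] F G; first by rewrite big_nil.
  rewrite /F /G !big_cons => /eqP; rewrite paddr_eq0//; last exact: sumr_ge0.
  move=> /andP[/eqP -> /eqP Fs] _ _; rewrite zpow0l mul0r add0r.
  by apply: IH => //; exact: sumr_ge0.
have [G00|Gp] := eqVneq G 0.
  rewrite G00 zpow0l mulr0; clear Fp.
  elim: s @F @G G00 F0 G0 => [|i s IH] F G; first by rewrite big_nil.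
  rewrite /F /G !big_cons => /eqP; rewrite paddr_eq0//; last exact: sumr_ge0.
  move=> /andP[/eqP -> /eqP Gs] _ _; rewrite zpow0l mulr0 add0r.
  by apply: IH => //; exact: sumr_ge0.
have {}Fp : 0 < F by rewrite lt_def Fp.
have {}Gp : 0 < G by rewrite lt_def Gp.
apply: (@le_trans _ _ (\sum_(i <- s) (zpow F p * zpow G (1 - p)) *
    (p * (f i / F) + (1 - p) * (g i / G)))).
  apply: ler_sum => i _.
  rewrite -{1}(divfK (lt0r_neq0 Fp) (f i)) -{1}(divfK (lt0r_neq0 Gp) (g i)).
  rewrite (zpowM p (divr_ge0 (f0 i) F0) F0) (zpowM (1 - p) (divr_ge0 (g0 i) G0) G0).
  rewrite mulrACA mulrC ler_wpM2l ?mulr_ge0 ?zpow_ge0//.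
  by apply: youngR => //; rewrite divr_ge0.
rewrite -mulr_sumr ler_piMr ?mulr_ge0 ?zpow_ge0//.
rewrite big_split/= -!mulr_sumr -!mulr_suml -/F -/G !divff ?gt_eqF//; lra.
Qed.

(** Jensen's inequality for the concave power [p], with unnormalised weights [g]. *)
Lemma hoelder_sum_zpow (I : Type) (s : seq I) (f g : I -> R) p : 0 <= p <= 1 ->
  (forall i, 0 <= f i) -> (forall i, 0 <= g i) ->
  \sum_(i <- s) g i * zpow (f i) p <=
  zpow (\sum_(i <- s) g i * f i) p * zpow (\sum_(i <- s) g i) (1 - p).
Proof.
move=> p01 f0 g0.
have -> : \sum_(i <- s) g i * zpow (f i) p =
    \sum_(i <- s) zpow (g i * f i) p * zpow (g i) (1 - p).
  apply: eq_bigr => i _; rewrite zpowM// mulrAC -zpowD// addrC subrK zpow1//.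
by apply: hoelder_sum => // i; rewrite mulr_ge0.
Qed.

(** A ratio [z / (x + y)] in [0, 1] is at most its own [p]-th power, and the ratios of [x] and of
    [y] add up to 1. *)
Lemma zpow_subadd x y p : 0 <= p <= 1 -> 0 <= x -> 0 <= y ->
  zpow (x + y) p <= zpow x p + zpow y p.
Proof.
move=> /andP[p0 p1]; rewrite le_eqVlt => /predU1P[<-|x0].
  by rewrite add0r zpow0l add0r.
rewrite le_eqVlt => /predU1P[<-|y0]; first by rewrite addr0 zpow0l addr0.
have xy : 0 < x + y by rewrite addr_gt0.
have key z : 0 < z -> z <= x + y -> z / (x + y) * zpow (x + y) p <= zpow z p.
  move=> z0 zxy; have zs : 0 <= z / (x + y) by rewrite divr_ge0 ?ltW.
  have -> : zpow z p = zpow (z / (x + y)) p * zpow (x + y) p.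
    by rewrite -(zpowM _ zs (ltW xy)) divfK ?gt_eqF.
  rewrite ler_wpM2r ?zpow_ge0//.
  rewrite -[leLHS](zpow1 zs).
  by apply: zpow_le1_nincr => //; rewrite zs/= ler_pdivrMr// mul1r.
apply: le_trans (lerD (key x x0 _) (key y y0 _)); last 2 first.
- by rewrite lerDl ltW.
- by rewrite lerDr ltW.
by rewrite -mulrDl -mulrDl divff ?gt_eqF// mul1r.
Qed.

End Zpow.

Section Words.
Context {R : realType}.

Fixpoint words (A : finType) n : seq (seq A) :=
  if n is n'.+1 then [seq a :: u | a <- enum A, u <- words A n'] else [:: [::]].

Lemma mem_words (A : finType) n w : (w \in words A n) = (size w == n).
Proof.
elim: n w => [|n IH] [|a w]//=; first by apply/negbTE/allpairsP => -[[]]/= ? ? [].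
rewrite eqSS -IH; apply/allpairsP/idP => [[[b u]/= [_ uw [_ ->]]]//|h].
by exists (a, w); split => //=; rewrite mem_enum.
Qed.

Lemma uniq_words (A : finType) n : uniq (words A n).
Proof.
elim: n => //= n IH; apply: allpairs_uniq => //; first exact: enum_uniq.
by move=> [a u] [b v] _ _ [-> ->].
Qed.

Lemma sum_words0 (A : finType) (f : seq A -> R) : \sum_(w <- words A 0) f w = f [::].
Proof. by rewrite big_seq1. Qed.

Lemma sum_wordsS (A : finType) n (f : seq A -> R) :
  \sum_(w <- words A n.+1) f w = \sum_(a : A) \sum_(u <- words A n) f (a :: u).
Proof. by rewrite big_allpairs_dep big_enum. Qed.

Lemma sum_wordsD (A : finType) n m (f : seq A -> R) :
  \sum_(w <- words A (n + m)) f w =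
  \sum_(u <- words A n) \sum_(v <- words A m) f (u ++ v).
Proof.
elim: n f => [|n IH] f; first by rewrite sum_words0.
by rewrite addSn !sum_wordsS; apply: eq_bigr => a _; rewrite IH.
Qed.

Lemma sum_words_tuple (A : finType) n (f : seq A -> R) :
  \sum_(w : n.-tuple A) f w = \sum_(w <- words A n) f w.
Proof.
rewrite -(big_map (@tval n A) predT f); apply: perm_big; apply: uniq_perm.
- by rewrite map_inj_uniq ?index_enum_uniq//; exact: val_inj.
- exact: uniq_words.
move=> w; rewrite mem_words; apply/mapP/idP => [[t _ ->]|/eqP sw]; first by rewrite size_tuple.
by exists (tcast sw (in_tuple w)); rewrite ?mem_index_enum// val_tcast.
Qed.

Lemma sum_words_pair (A B : finType) n (f : seq (A * B) -> R) :
  \sum_(w <- words (A * B)%type n) f w =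
  \sum_(u <- words A n) \sum_(v <- words B n) f (zip u v).
Proof.
elim: n f => [|n IH] f; first by rewrite !sum_words0.
transitivity (\sum_a \sum_b \sum_(u <- words (A * B)%type n) f ((a, b) :: u)).
  by rewrite sum_wordsS pair_bigA; apply: eq_bigr => -[a b].
rewrite sum_wordsS; apply: eq_bigr => a _; under eq_bigr do rewrite IH.
rewrite exchange_big/=; apply: eq_bigr => u _.
by rewrite sum_wordsS.
Qed.

Lemma size_words (A : finType) n : size (words A n) = (#|A| ^ n)%N.
Proof. by elim: n => //= n IH; rewrite size_allpairs IH -cardE expnS. Qed.

End Words.

(** * Almost multiplicative functions and pressure *)

Section QuasiMultiplicative.
Context {R : realType}.
Implicit Types c d q k P : R.

(* Almost multiplicativity, with constant [expR c]. *)
Definition qm (A : Type) c (f : seq A -> R) :=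
  (forall w, 0 <= f w) /\ forall u v, cmp (expR c) (f u * f v) (f (u ++ v)).

Lemma qm_ge0 (A : Type) c (f : seq A -> R) : qm c f -> forall w, 0 <= f w.
Proof. by case. Qed.

Lemma qm_gt0 (A : Type) c (f : seq A -> R) u v : qm c f ->
  (0 < f (u ++ v)) = (0 < f u) && (0 < f v).
Proof.
move=> [f0 fc]; rewrite -(cmp_gt0 _ _ (fc u v)) ?mulr_ge0//.
apply/idP/andP => [|[? ?]]; last by rewrite mulr_gt0.
by rewrite !lt_def !f0 !andbT mulf_eq0 negb_or => /andP[/andP[]].
Qed.

Lemma qm_zpow (A : Type) c q (f : seq A -> R) : qm c f ->
  qm (`|q| * c) (fun w => zpow (f w) q).
Proof.
move=> [f0 fc]; split=> [w|u v]; first exact: zpow_ge0.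
by rewrite -zpowM//; apply: cmp_zpow => //; rewrite mulr_ge0.
Qed.

Lemma qmM (A : Type) c d (f g : seq A -> R) : qm c f -> qm d g ->
  qm (c + d) (fun w => f w * g w).
Proof.
move=> [f0 fc] [g0 gd]; split=> [w|u v]; first by rewrite mulr_ge0.
by rewrite expRD mulrACA; apply: cmpM; rewrite ?expR_ge0 ?mulr_ge0.
Qed.

Lemma qm_map (A B : Type) (h : A -> B) c (f : seq B -> R) : qm c f ->
  qm c (fun w => f (map h w)).
Proof. by move=> [f0 fc]; split=> // u v; rewrite map_cat. Qed.

Lemma qm_sum (A : finType) c (f : seq A -> R) n m : qm c f ->
  cmp (expR c) ((\sum_(w <- words A n) f w) * \sum_(w <- words A m) f w)
    (\sum_(w <- words A (n + m)) f w).
Proof.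
move=> [f0 fc]; rewrite sum_wordsD mulr_suml.
by apply: cmp_sum => u _; rewrite mulr_sumr; apply: cmp_sum.
Qed.

Definition fiber_sum (A B : finType) (f : seq (A * B) -> R) (u : seq A) : R :=
  \sum_(v <- words B (size u)) f (zip u v).

Lemma qm_fiber_sum (A B : finType) c (f : seq (A * B) -> R) : qm c f ->
  qm c (fiber_sum f).
Proof.
move=> [f0 fc]; split=> [w|u v]; first exact: sumr_ge0.
rewrite /fiber_sum size_cat sum_wordsD mulr_suml; apply: cmp_sum => x.
rewrite mem_words => /eqP sx; rewrite mulr_sumr; apply: cmp_sum => y _.
by rewrite zip_cat.
Qed.

Lemma sum_fiber_sum (A B : finType) (f : seq (A * B) -> R) n :
  \sum_(u <- words A n) fiber_sum f u = \sum_(w <- words (A * B)%type n) f w.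
Proof.
rewrite sum_words_pair big_seq [RHS]big_seq; apply: eq_bigr => u.
by rewrite mem_words /fiber_sum => /eqP ->.
Qed.

(** Comparing [l] at a common multiple of the two indices shows that every [(l n.+1 - k) / n.+1] is
    at most every [(l m.+1 + k) / m.+1]. The supremum of the former is the rate, and the error [k]
    does not grow with [n]. *)
Lemma almost_additive_growth (l : nat -> R) k :
  (forall n m, `|l n + l m - l (n + m)%N| <= k) ->
  exists P, (fun n => n%:R^-1 * l n) @ \oo --> P /\
    forall n, `|l n - n%:R * P| <= k.
Proof.
move=> lk; have k0 : 0 <= k by exact: le_trans (lk 0%N 0%N).
have lM n m : `|n.+1%:R * l m - l (n.+1 * m)%N| <= n.+1%:R * k.
  elim: n => [|n IH]; first by rewrite mul1n !mul1r subrr normr0.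
  rewrite -natr1 !(mulrDl n.+1%:R) !mul1r mulSn addnC.
  have := lk (n.+1 * m)%N m; move: IH; rewrite !ler_norml => /andP[? ?] /andP[? ?].
  apply/andP; split; lra.
have key n m : `|m.+1%:R * l n.+1 - n.+1%:R * l m.+1| <= (n.+1%:R + m.+1%:R) * k.
  have := lM n m.+1; have := lM m n.+1; rewrite mulnC !ler_norml.
  move=> /andP[? ?] /andP[? ?]; apply/andP; split; lra.
pose E := [set (l n.+1 - k) / n.+1%:R | n in [set: nat]].
have Eub m : ubound E ((l m.+1 + k) / m.+1%:R).
  move=> _ [n _ <-]; rewrite ler_pdivrMr// mulrAC ler_pdivlMr//.
  have := key n m; rewrite ler_norml => /andP[? ?]; lra.
have hE : has_sup E.
  by split; [exists ((l 1%N - k) / 1%:R), 0%N|exists ((l 1%N + k) / 1%:R); exact: Eub].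
have lP n : `|l n - n%:R * sup E| <= k.
  case: n => [|n]; first by rewrite mul0r subr0; have := lk 0%N 0%N; rewrite addn0 addrK.
  have : sup E <= (l n.+1 + k) / n.+1%:R by apply: ge_sup; [case: hE|exact: Eub].
  have : (l n.+1 - k) / n.+1%:R <= sup E by apply: ub_le_sup; [case: hE|exists n].
  rewrite ler_pdivrMr// ler_pdivlMr// mulrC ler_norml => ? ?; apply/andP; split; lra.
exists (sup E); split => //.
apply/cvgrPdist_le => e e0; near=> n.
have n0 : 0 < n%:R :> R by rewrite ltr0n; near: n; exact: nbhs_infty_gt.
rewrite -(ler_pM2l n0) -{1}(gtr0_norm n0) -normrM mulrBr mulVKf ?gt_eqF// distrC.
apply: (le_trans (lP n)); rewrite -ler_pdivrMr//; near: n; exact: nbhs_infty_ger.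
Unshelve. all: by end_near. Qed.

Lemma pressureP (A : alphabetType) c (f : seq A -> R) : qm c f ->
  (forall n, 0 < \sum_(w <- words A n) f w) ->
  forall n, `|ln (\sum_(w <- words A n) f w) - n%:R * pressure f| <= c.
Proof.
move=> fc S0; set S := fun n => \sum_(w <- words A n) f w.
have [|P [lP kP]] := @almost_additive_growth (fun n => ln (S n)) c.
  move=> n m /=; rewrite -lnM ?posrE ?S0//; apply/cmp_ln; rewrite ?mulr_gt0 ?S0//.
  exact: qm_sum.
suff -> : pressure f = P by [].
apply: cvg_lim => //; under eq_fun do rewrite sum_words_tuple.
exact: lP.
Qed.

End QuasiMultiplicative.

(** Passes from logarithms of partition sums, compared up to bounded errors, to the pressures. *)
Lemma le_of_linear_bound (R : realType) (x y C : R) :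
  (forall n : nat, n%:R * x <= n%:R * y + C) -> x <= y.
Proof.
move=> h; rewrite leNgt; apply/negP => yx.
have xy0 : 0 < x - y by rewrite subr_gt0.
have := h (Num.trunc (`|C| / (x - y))).+1; set n := (_.+1).
have : `|C| / (x - y) < n%:R by exact: truncnS_gt.
rewrite ltr_pdivrMr// => h1; rewrite leNgt => /negP; apply.
by have := ler_norm C; lra.
Qed.

(** Positivity of [f w] is inherited by its letters and suffixes, so letters can be peeled off one
    by one, each at a bounded cost. Words on which [f] vanishes have to be excluded. *)
Lemma qm_ln_bound (R : realType) (A : finType) (c : R) (f : seq A -> R) : qm c f ->
  exists2 M, 0 <= M & forall w, 0 < f w -> `|ln (f w)| <= M * (size w)%:R + c.
Proof.
move=> fc; have [f0 fm] := fc.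
pose L := \sum_(a : A) `|ln (f [:: a])|.
exists (L + `|c|); first by rewrite addr_ge0// sumr_ge0.
elim=> [|a w IH] fw.
  rewrite mulr0 add0r; have /cmp_ln : cmp (expR c) (f [::] * f [::]) (f [::]) by exact: fm.
  by rewrite lnM ?posrE// addrK; apply => //; rewrite mulr_gt0.
have := fw; rewrite -cat1s (qm_gt0 _ _ fc) => /andP[fa fw'].
have /cmp_ln : cmp (expR c) (f [:: a] * f w) (f (a :: w)) by rewrite -cat1s; exact: fm.
move/(_ (mulr_gt0 fa fw') fw); rewrite lnM ?posrE// => h.
have La : `|ln (f [:: a])| <= L.
  by rewrite /L (bigD1 a)//= lerDl sumr_ge0.
have -> : ln (f (a :: w)) = (ln (f [:: a]) + ln (f w)) - (ln (f [:: a]) + ln (f w) - ln (f (a :: w))).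
  by rewrite opprB addrC subrK.
apply: (le_trans (ler_normB _ _)).
have h2 := ler_normD (ln (f [:: a])) (ln (f w)); have := IH fw'.
have := ler_norm c; rewrite /= -natr1 mulrDr mulr1; lra.
Qed.

(** * Tilted partition sums, their weights and the potential *)

Section Tilt.
Context {R : realType} {A1 A2 : finType}.
Variables (psi : seq (A1 * A2) -> R) (c s : R).
Hypothesis psi_qm : qm c psi.
Hypothesis psi_sum1 : forall n, \sum_(w <- words (A1 * A2)%type n) psi w = 1.
Hypothesis s01 : 0 < s <= 1.

Let s0 : 0 < s. Proof. by case/andP: s01. Qed.
Let s01' : 0 <= s <= 1. Proof. by case/andP: s01 => /ltW ->. Qed.

Definition fiber_pow q := fiber_sum (fun w => zpow (psi w) q).
Definition tilt_base q u := zpow (fiber_pow 1 u) (q * (1 - s)) * zpow (fiber_pow q u) s.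
Definition tilt_part q n := \sum_(u <- words A1 n) tilt_base q u.
Definition tilt q w :=
  tilt_base q (map fst w) * (zpow (psi w) q / fiber_pow q (map fst w)).
(* [potential] is exp F and [tilt q] is nu_q, not normalised. *)
Definition potential w := zpow (fiber_pow 1 (map fst w)) (1 - s) * zpow (psi w) s.

Local Notation I := fiber_pow.
Local Notation Phi := tilt_base.
Local Notation Z := tilt_part.
Local Notation Psi := tilt.
Local Notation G := potential.

Let psi0 w : 0 <= psi w. Proof. exact: qm_ge0 psi_qm w. Qed.

Lemma qm_const_ge0 : 0 <= c.
Proof.
have h := proj2 psi_qm [::] [::]; have := psi_sum1 0%N; rewrite sum_words0 => e.
by move: h; rewrite /= e mulr1 => -[+ _]; rewrite mulr1 -expR0 ler_expR.
Qed.

Lemma psi_le1 w : psi w <= 1.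
Proof.
rewrite -(psi_sum1 (size w)) (bigD1_seq w) ?uniq_words ?mem_words//=.
by rewrite lerDl sumr_ge0.
Qed.

Lemma fiber_powE q u : I q u = \sum_(v <- words A2 (size u)) zpow (psi (zip u v)) q.
Proof. by []. Qed.

Lemma fiber_pow_ge0 q u : 0 <= I q u.
Proof. by apply: sumr_ge0 => v _; exact: zpow_ge0. Qed.
Local Hint Resolve fiber_pow_ge0 : core.

Lemma tilt_base_ge0 q u : 0 <= Phi q u.
Proof. by rewrite mulr_ge0 ?zpow_ge0. Qed.

Lemma tilt_ge0 q w : 0 <= Psi q w.
Proof. by rewrite mulr_ge0 ?tilt_base_ge0// divr_ge0 ?zpow_ge0. Qed.

Lemma fiber_pow1E u : I 1 u = fiber_sum psi u.
Proof. by apply: eq_bigr => v _; rewrite zpow1. Qed.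

Lemma zip_fst_snd (w : seq (A1 * A2)) : zip (map fst w) (map snd w) = w.
Proof. by elim: w => //= -[a b] w ->. Qed.

Lemma map_fst_zip (u : seq A1) (v : seq A2) : size u = size v -> map fst (zip u v) = u.
Proof. by move=> uv; apply: unzip1_zip; rewrite uv. Qed.

Lemma fiber_sum_ge (f : seq (A1 * A2) -> R) w : (forall w, 0 <= f w) ->
  f w <= fiber_sum f (map fst w).
Proof.
move=> f0; rewrite /fiber_sum size_map.
rewrite (bigD1_seq (map snd w)) ?uniq_words ?mem_words ?size_map//=.
by rewrite zip_fst_snd lerDl sumr_ge0.
Qed.

Lemma zpow_le_fiber_pow q w : zpow (psi w) q <= I q (map fst w).
Proof. by apply: (@fiber_sum_ge (fun w => zpow (psi w) q)) => ?; exact: zpow_ge0. Qed.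

Lemma fiber_pow_gt0 q w : 0 < psi w -> 0 < I q (map fst w).
Proof. by move=> w0; apply: lt_le_trans (zpow_le_fiber_pow q w); exact: zpow_gt0. Qed.

Lemma tilt_base_gt0 q w : 0 < psi w -> 0 < Phi q (map fst w).
Proof. by move=> w0; rewrite mulr_gt0 ?zpow_gt0 ?fiber_pow_gt0. Qed.

Lemma tilt_gt0 q w : 0 < psi w -> 0 < Psi q w.
Proof. by move=> w0; rewrite mulr_gt0 ?tilt_base_gt0// divr_gt0 ?zpow_gt0 ?fiber_pow_gt0. Qed.

Lemma potential_gt0 w : 0 < psi w -> 0 < G w.
Proof. by move=> w0; rewrite mulr_gt0 ?zpow_gt0 ?fiber_pow_gt0. Qed.

Lemma tilt_psi0 q w : psi w = 0 -> Psi q w = 0.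
Proof. by move=> w0; rewrite /tilt w0 zpow0l mul0r mulr0. Qed.

Lemma tilt_gt0E q w : (0 < Psi q w) = (0 < psi w).
Proof.
apply/idP/idP; last exact: tilt_gt0.
by have := psi0 w; rewrite le_eqVlt => /predU1P[/esym/(tilt_psi0 q) ->|//]; rewrite ltxx.
Qed.

Lemma fiber_pow1_le1 u : I 1 u <= 1.
Proof.
rewrite fiber_pow1E -(psi_sum1 (size u)) -sum_fiber_sum.
rewrite (bigD1_seq u) ?uniq_words ?mem_words//= lerDl sumr_ge0// => v _.
by rewrite sumr_ge0.
Qed.

Lemma potential_le1 w : 0 < psi w -> G w <= 1.
Proof.
case/andP: s01 => _ s1 w0; rewrite -[1]mulr1; apply: ler_pM; rewrite ?zpow_ge0//.
  rewrite -[leRHS](zpow1l (1 - s)); apply: ler_zpow => //; first by rewrite subr_ge0.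
  exact: fiber_pow1_le1.
by rewrite -[leRHS](zpow1l s); apply: ler_zpow (psi_le1 _); rewrite // ltW.
Qed.

Lemma psi_exists n : exists2 w, size w = n & 0 < psi w.
Proof.
have : \sum_(w <- words (A1 * A2)%type n) psi w != 0 by rewrite psi_sum1 oner_eq0.
rewrite psumr_neq0// => /hasP[w]; rewrite mem_words => /eqP ws /=; by exists w.
Qed.

Lemma tilt_part_gt0 q n : 0 < Z q n.
Proof.
have [w ws w0] := psi_exists n.
rewrite /tilt_part (bigD1_seq (map fst w)) ?uniq_words ?mem_words ?size_map ?ws//=.
by rewrite ltr_wpDr ?tilt_base_gt0// sumr_ge0// => u _; exact: tilt_base_ge0.
Qed.

Lemma fiber_pow_qm q : qm (`|q| * c) (I q).
Proof. by apply: qm_fiber_sum; exact: qm_zpow. Qed.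

Lemma fiber_pow1_qm : qm c (I 1).
Proof. by have := fiber_pow_qm 1; rewrite normr1 mul1r. Qed.

Lemma tilt_base_qm q : qm (`|q| * c) (Phi q).
Proof.
(* The exponents [1 - s] and [s] add up to 1, so the constant is the one of [psi ^ q]. *)
have -> : `|q| * c = `|q * (1 - s)| * c + `|s| * (`|q| * c).
  case/andP: s01 => _ s1.
  by rewrite normrM (ger0_norm (ltW s0)) (@ger0_norm _ (1 - s)) ?subr_ge0//; ring.
by apply: qmM; apply: qm_zpow; [exact: fiber_pow1_qm|exact: fiber_pow_qm].
Qed.

Lemma tilt_qm q : qm (3 * `|q| * c) (Psi q).
Proof.
have -> : 3 * `|q| * c = `|q| * c + (`|q| * c + `|-1| * (`|q| * c)).
  by rewrite normrN1; ring.
have -> : Psi q = fun w => Phi q (map fst w) * (zpow (psi w) q * zpow (I q (map fst w)) (-1)).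
  by apply/funext => w; rewrite /tilt zpowN// zpow1.
apply: qmM; first exact: qm_map (tilt_base_qm q).
apply: qmM; first exact: qm_zpow.
by apply: qm_zpow; exact: qm_map (fiber_pow_qm q).
Qed.

Lemma potential_qm : qm c G.
Proof.
have -> : c = `|1 - s| * c + `|s| * c.
  case/andP: s01 => _ s1.
  by rewrite (ger0_norm (ltW s0)) (@ger0_norm _ (1 - s)) ?subr_ge0//; ring.
apply: qmM; last exact: qm_zpow.
by apply: qm_zpow; exact: qm_map fiber_pow1_qm.
Qed.

Lemma fiber_sum_tilt q u : fiber_sum (Psi q) u = Phi q u.
Proof.
transitivity (\sum_(v <- words A2 (size u)) Phi q u * (zpow (psi (zip u v)) q / I q u)).
  rewrite /fiber_sum big_seq [RHS]big_seq; apply: eq_bigr => v.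
  by rewrite mem_words => /eqP sv; rewrite /tilt map_fst_zip.
rewrite -mulr_sumr -mulr_suml -/(fiber_sum (fun w => zpow (psi w) q) u) -/(I q u).
(* On a fibre with [I q u = 0] the factor [tilt_base] vanishes as well, so the division by 0 does no
   harm. *)
have [e|e] := eqVneq (I q u) 0; last by rewrite divff ?mulr1.
by rewrite /tilt_base e zpow0l !mulr0 mul0r.
Qed.

Lemma sum_tilt q n : \sum_(w <- words (A1 * A2)%type n) Psi q w = Z q n.
Proof. by rewrite -sum_fiber_sum; apply: eq_bigr => u _; exact: fiber_sum_tilt. Qed.

End Tilt.

Section TiltPressure.
Context {R : realType} {A1 A2 : alphabetType}.
Variables (psi : seq (A1 * A2) -> R) (c s : R).
Hypothesis psi_qm : qm c psi.
Hypothesis psi_sum1 : forall n, \sum_(w <- words (A1 * A2)%type n) psi w = 1.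
Hypothesis s01 : 0 < s <= 1.

Let s0 : 0 < s. Proof. by case/andP: s01. Qed.
Let s1 : s <= 1. Proof. by case/andP: s01. Qed.
Let s01' : 0 <= s <= 1. Proof. by rewrite s1 ltW. Qed.
Let psi0 w : 0 <= psi w. Proof. exact: qm_ge0 psi_qm w. Qed.

Local Notation I := (fiber_pow psi).
Local Notation Phi := (tilt_base psi s).
Local Notation Z := (tilt_part psi s).
Local Notation Psi := (tilt psi s).
Local Notation G := (potential psi s).

Definition tilt_pressure q := pressure (tilt_base psi s q).
Local Notation P := tilt_pressure.

Let Z0 q n : 0 < Z q n. Proof. exact: tilt_part_gt0 psi_qm psi_sum1 q n. Qed.
Let I0 q u : 0 <= I q u. Proof. exact: fiber_pow_ge0. Qed.

Lemma ln_tilt_part q n : `|ln (Z q n) - n%:R * P q| <= `|q| * c.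
Proof. by apply: pressureP; [exact: tilt_base_qm|exact: Z0]. Qed.

Lemma tilt_part_le q n : Z q n <= expR (n%:R * P q + `|q| * c).
Proof.
rewrite -[Z q n]lnK ?posrE// ler_expR.
by have := ln_tilt_part q n; rewrite ler_norml => /andP[? ?]; lra.
Qed.

Lemma tilt_part_ge q n : expR (n%:R * P q - `|q| * c) <= Z q n.
Proof.
rewrite -[Z q n]lnK ?posrE// ler_expR.
by have := ln_tilt_part q n; rewrite ler_norml => /andP[? ?]; lra.
Qed.

Lemma fiber_pow_log_convex p q t u : 0 <= t <= 1 ->
  I (t * p + (1 - t) * q) u <= zpow (I p u) t * zpow (I q u) (1 - t).
Proof.
move=> t01; rewrite !fiber_powE; apply: le_trans (hoelder_sum _ t01 _ _); last 2 first.
- by move=> v; exact: zpow_ge0.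
- by move=> v; exact: zpow_ge0.
apply: ler_sum => v _.
rewrite -(zpowrM _ _ (psi0 _)) -(zpowrM _ _ (psi0 _)) -(zpowD _ _ (psi0 _)).
by rewrite (mulrC p) (mulrC q).
Qed.

(** Hoelder's inequality is used twice: inside each fibre for [I], then over the base words. *)
Lemma tilt_part_log_convex p q t n : 0 <= t <= 1 ->
  Z (t * p + (1 - t) * q) n <= zpow (Z p n) t * zpow (Z q n) (1 - t).
Proof.
move=> t01; apply: le_trans (hoelder_sum _ t01 _ _); last 2 first.
- by move=> v; exact: tilt_base_ge0.
- by move=> v; exact: tilt_base_ge0.
apply: ler_sum => u _; rewrite /tilt_base.
set r := t * p + (1 - t) * q.
have e x w : zpow (zpow (I 1 u) (x * (1 - s)) * zpow (I x u) s) w =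
    zpow (I 1 u) (w * x * (1 - s)) * zpow (zpow (I x u) w) s.
  rewrite (zpowM w (zpow_ge0 (I 1 u) _) (zpow_ge0 (I x u) s)).
  rewrite -(zpowrM (x * (1 - s)) w (I0 1 u)) -(zpowrM s w (I0 x u)) -(zpowrM w s (I0 x u)).
  by congr (zpow _ _ * zpow _ _); ring.
rewrite (e p t) (e q (1 - t)) mulrACA -(zpowD _ _ (I0 1 u)).
rewrite -(mulrDl (t * p)) -/r; apply: ler_wpM2l; first exact: zpow_ge0.
rewrite -(zpowM s (zpow_ge0 (I p u) t) (zpow_ge0 (I q u) (1 - t))).
apply: ler_zpow (fiber_pow_log_convex _ _ _ _) => //; exact: ltW.
Qed.

Lemma tilt_pressure_convex p q t : 0 <= t <= 1 ->
  P (t * p + (1 - t) * q) <= t * P p + (1 - t) * P q.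
Proof.
move=> t01; have /andP[t0 t1] := t01; set r := t * p + (1 - t) * q.
apply: (@le_of_linear_bound _ _ _ (t * (`|p| * c) + (1 - t) * (`|q| * c) + `|r| * c)) => n.
have : ln (Z r n) <= t * ln (Z p n) + (1 - t) * ln (Z q n).
  have h := tilt_part_log_convex p q n t01.
  have : ln (Z r n) <= ln (zpow (Z p n) t * zpow (Z q n) (1 - t)).
    by rewrite ler_ln ?posrE ?mulr_gt0 ?zpow_gt0.
  by rewrite lnM ?posrE ?zpow_gt0// !ln_zpow.
have := ln_tilt_part r n; have := ln_tilt_part p n; have := ln_tilt_part q n.
rewrite !ler_norml => /andP[_ hq] /andP[_ hp] /andP[hr _] h.
have {}hp : t * ln (Z p n) <= t * (n%:R * P p + `|p| * c) by apply: ler_wpM2l => //; lra.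
have {}hq : (1 - t) * ln (Z q n) <= (1 - t) * (n%:R * P q + `|q| * c).
  by apply: ler_wpM2l => //; lra.
lra.
Qed.

(** [psi] and its fibre sums take values in [0, 1], so each power in the partition sum decreases
    with the exponent. *)
Lemma tilt_pressure_nincr p q : p <= q -> P q <= P p.
Proof.
move=> pq; apply: (@le_of_linear_bound _ _ _ (`|p| * c + `|q| * c)) => n.
have : ln (Z q n) <= ln (Z p n).
  rewrite ler_ln ?posrE//; apply: ler_sum => u _.
  apply: ler_pM; rewrite ?zpow_ge0//.
    apply: zpow_le1_nincr; first by rewrite I0 (fiber_pow1_le1 psi_qm psi_sum1).
    by rewrite ler_wpM2r// subr_ge0.
  apply: ler_zpow => //; first exact: ltW.
  apply: ler_sum => v _; apply: zpow_le1_nincr => //.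
  by rewrite psi0 (psi_le1 psi_qm psi_sum1).
have := ln_tilt_part p n; have := ln_tilt_part q n.
by rewrite !ler_norml => /andP[hq _] /andP[_ hp]; lra.
Qed.

(* Jensen in the fibre: s <= 1, so the conditional mean of psi^(s d) is at most the
   s-th power of that of psi^d. *)
Lemma tilt_exp_moment q d n :
  \sum_(w <- words (A1 * A2)%type n) Psi q w * zpow (G w) d <= Z (q + d) n.
Proof.
rewrite -sum_fiber_sum; apply: ler_sum => u _.
have [Iq|Iq] := eqVneq (I q u) 0.
  apply: le_trans (tilt_base_ge0 psi s _ _); rewrite /fiber_sum big_seq big1// => v.
  rewrite mem_words => /eqP sv; rewrite /tilt /tilt_base map_fst_zip// Iq.
  by rewrite zpow0l mulr0 !mul0r.
have {}Iq : 0 < I q u by rewrite lt0r Iq I0.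
pose K := zpow (I 1 u) ((q + d) * (1 - s)) * zpow (I q u) s / I q u.
have -> : fiber_sum (fun w => Psi q w * zpow (G w) d) u =
    K * \sum_(v <- words A2 (size u)) zpow (psi (zip u v)) q * zpow (zpow (psi (zip u v)) d) s.
  rewrite mulr_sumr /fiber_sum big_seq [RHS]big_seq; apply: eq_bigr => v.
  rewrite mem_words => /eqP sv; rewrite /tilt /tilt_base /potential map_fst_zip//.
  rewrite zpowM ?zpow_ge0// -!zpowrM// /K (mulrDl q d) zpowD// (mulrC (1 - s) d) (mulrC s d).
  ring.
apply: (@le_trans _ _ (K * (zpow (I (q + d) u) s * zpow (I q u) (1 - s)))).
  apply: ler_wpM2l; first by rewrite divr_ge0 ?mulr_ge0 ?zpow_ge0.
  rewrite !fiber_powE; apply: le_trans (hoelder_sum_zpow _ s01' _ _) _.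
  - by move=> v; exact: zpow_ge0.
  - by move=> v; exact: zpow_ge0.
  rewrite le_eqVlt; apply/orP; left; apply/eqP; congr (zpow _ _ * _).
  by apply: eq_bigr => v _; rewrite zpowD.
have e : zpow (I q u) s * zpow (I q u) (1 - s) = I q u by rewrite -zpowD// addrC subrK zpow1.
rewrite le_eqVlt; apply/orP; left; apply/eqP; rewrite /tilt_base.
transitivity (zpow (I 1 u) ((q + d) * (1 - s)) * zpow (I (q + d) u) s *
   (zpow (I q u) s * zpow (I q u) (1 - s)) / I q u); first by rewrite /K; ring.
by rewrite e mulfK// gt_eqF.
Qed.

(** [I 1 u] is constant on the fibre, so a bound on [G ^ t] is, after taking the power [1 / s], a
    pointwise bound on [psi ^ t]. It can then be applied under the fibre sum, before the power
    [s]. *)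
Lemma fiber_pow_restrict q t y (Q : pred (seq (A1 * A2))) u :
  (forall w, size w = size u -> 0 < psi w -> Q w -> zpow (G w) t <= expR y) ->
  zpow (I 1 u) (t * (1 - s)) *
    zpow (\sum_(v <- words A2 (size u) | Q (zip u v)) zpow (psi (zip u v)) (q + t)) s <=
  expR y * zpow (\sum_(v <- words A2 (size u) | Q (zip u v)) zpow (psi (zip u v)) q) s.
Proof.
move=> hQ; have sn : s != 0 by rewrite gt_eqF.
have -> : zpow (I 1 u) (t * (1 - s)) = zpow (zpow (I 1 u) (t * (1 - s) / s)) s.
  by rewrite -zpowrM// divfK.
have -> : expR y = zpow (expR (y / s)) s by rewrite zpow_expR_l mulrC divfK.
rewrite -!zpowM ?zpow_ge0 ?expR_ge0 ?sumr_ge0// => [|v _|v _]; try exact: zpow_ge0.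
apply: ler_zpow; first exact: ltW.
  by rewrite mulr_ge0 ?zpow_ge0 ?sumr_ge0// => v _; exact: zpow_ge0.
rewrite !mulr_sumr big_seq_cond [leRHS]big_seq_cond; apply: ler_sum => v.
rewrite mem_words => /andP[/eqP sv Qv].
have := psi0 (zip u v); rewrite le_eqVlt => /predU1P[<-|pv]; first by rewrite !zpow0l !mulr0.
have zs : size (zip u v) = size u by rewrite size_zip sv minnn.
have Iu : 0 < I 1 u by have := fiber_pow_gt0 1 pv; rewrite map_fst_zip.
have := hQ _ zs pv Qv; rewrite (zpow_expR _ (potential_gt0 s pv)) ler_expR.
have -> : ln (G (zip u v)) = (1 - s) * ln (I 1 u) + s * ln (psi (zip u v)).
  by rewrite /potential map_fst_zip// lnM ?posrE ?zpow_gt0// !ln_zpow.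
move=> h; rewrite !zpow_expR// -!expRD ler_expR.
rewrite (mulrDl q t) addrCA addrC lerD2r -(ler_pM2r s0) divfK// mulrDl.
by rewrite mulrAC divfK//; apply: le_trans h; lra.
Qed.

(** Converse to the moment bound: if [Z (q + t) n] is large, the event [Q] must carry mass. Words
    outside [Q] contribute at most [expR y * Z q n]; those in [Q] are bounded by their [tilt] mass,
    but only to the power [s]. *)
Lemma tilt_part_split q t n y b (Q : pred (seq (A1 * A2))) :
  (forall w, size w = n -> 0 < psi w -> ~~ Q w -> zpow (G w) t <= expR y) ->
  (forall w, size w = n -> 0 < psi w -> zpow (G w) t <= expR b) ->
  Z (q + t) n <= expR y * Z q n +
    expR b * (zpow (\sum_(w <- words (A1 * A2)%type n | Q w) Psi q w) s * zpow (Z q n) (1 - s)).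
Proof.
move=> hy hb.
pose IQ u := \sum_(v <- words A2 (size u) | Q (zip u v)) zpow (psi (zip u v)) q.
have IQ0 u : 0 <= IQ u by apply: sumr_ge0 => v _; exact: zpow_ge0.
have IQle u : IQ u <= I q u.
  rewrite /IQ fiber_powE [leRHS](bigID (fun v => Q (zip u v)))/= lerDl.
  by apply: sumr_ge0 => v _; exact: zpow_ge0.
have step u : size u = n -> Phi (q + t) u <= expR y * Phi q u +
    expR b * (Phi q u * zpow (IQ u / I q u) s).
  move=> su; rewrite /tilt_base (mulrDl q t) zpowD//.
  have -> : I (q + t) u = (\sum_(v <- words A2 (size u) | ~~ Q (zip u v)) zpow (psi (zip u v)) (q + t)) +
      (\sum_(v <- words A2 (size u) | Q (zip u v)) zpow (psi (zip u v)) (q + t)).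
    by rewrite fiber_powE (bigID (fun v => Q (zip u v)))/= addrC.
  set X := \sum_(_ <- _ | ~~ _) _; set Y := \sum_(_ <- _ | _) _.
  have X0 : 0 <= X by apply: sumr_ge0 => v _; exact: zpow_ge0.
  have Y0 : 0 <= Y by apply: sumr_ge0 => v _; exact: zpow_ge0.
  set a := zpow (I 1 u) (q * (1 - s)); set a' := zpow (I 1 u) (t * (1 - s)).
  have a0 : 0 <= a by exact: zpow_ge0.
  have a'0 : 0 <= a' by exact: zpow_ge0.
  have hX : a' * zpow X s <= expR y * zpow (I q u) s.
    apply: (le_trans (@fiber_pow_restrict q t y (predC Q) u _)).
      by move=> w; rewrite su => sw pw Qw; apply: hy.
    rewrite ler_wpM2l ?expR_ge0// ler_zpow ?(ltW s0)//.
      by apply: sumr_ge0 => v _; exact: zpow_ge0.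
    rewrite fiber_powE [leRHS](bigID (fun v => Q (zip u v)))/= lerDr.
    by apply: sumr_ge0 => v _; exact: zpow_ge0.
  have hY : a' * zpow Y s <= expR b * zpow (IQ u) s.
    by apply: fiber_pow_restrict => w; rewrite su => sw pw _; apply: hb.
  have -> : expR b * (a * zpow (I q u) s * zpow (IQ u / I q u) s) = a * (expR b * zpow (IQ u) s).
    have [e|e] := eqVneq (I q u) 0.
      have -> : IQ u = 0 by apply/eqP; rewrite eq_le IQ0 -e IQle.
      by rewrite mul0r zpow0l !mulr0.
    rewrite -mulrA -zpowM ?divr_ge0//; last first.
    by rewrite [I q u * _]mulrC divfK//; ring.
  have -> : expR y * (a * zpow (I q u) s) = a * (expR y * zpow (I q u) s) by ring.
  rewrite -mulrDr -mulrA ler_wpM2l//.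
  apply: le_trans (lerD hX hY); rewrite -mulrDr ler_wpM2l//.
  exact: zpow_subadd.
apply: (@le_trans _ _ (\sum_(u <- words A1 n) (expR y * Phi q u +
    expR b * (Phi q u * zpow (IQ u / I q u) s)))).
  by rewrite /tilt_part big_seq [leRHS]big_seq; apply: ler_sum => u; rewrite mem_words => /eqP /step.
rewrite big_split/= -!mulr_sumr lerD2l ler_wpM2l ?expR_ge0//.
(* [IQ u / I q u] is the conditional mass of [Q] in the fibre over [u]; weighted by [Phi q u] and
   summed, it gives back the [tilt] mass of [Q]. *)
apply: le_trans (hoelder_sum_zpow _ s01' _ _) _.
- by move=> u; rewrite divr_ge0.
- by move=> u; exact: tilt_base_ge0.
rewrite -/(tilt_part psi s q n) le_eqVlt; apply/orP; left; apply/eqP; congr (zpow _ _ * _).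
rewrite [RHS]big_mkcond -sum_fiber_sum big_seq [RHS]big_seq; apply: eq_bigr => u.
rewrite mem_words => /eqP su; rewrite /fiber_sum -big_mkcond /IQ mulr_suml mulr_sumr.
rewrite big_seq_cond [RHS]big_seq_cond; apply: eq_bigr => v.
by rewrite mem_words => /andP[/eqP sv _]; rewrite /tilt map_fst_zip.
Qed.

End TiltPressure.

(** * Differentiability of the pressure *)

Section Kink.
Context {R : realType} {A : finType}.
Variables (Psi G : seq A -> R) (k c a b : R).
Hypothesis Psi_qm : qm k Psi.
Hypothesis G_qm : qm c G.
Local Notation Z n := (\sum_(w <- words A n) Psi w).
Hypothesis Z0 : forall n, 0 < Z n.
Hypothesis G01 : forall w, 0 < Psi w -> 0 < G w <= 1.

Let Psi0 w : 0 <= Psi w. Proof. exact: qm_ge0 Psi_qm w. Qed.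
Let G0 w : 0 <= G w. Proof. exact: qm_ge0 G_qm w. Qed.

(** A condition on a middle block is independent of what precedes and follows it, up to a factor
    that does not depend on the lengths. *)
Lemma sum_middle_cmp (Q : pred (seq A)) u m r :
  cmp (expR (k + k)) (Psi u * (\sum_(x <- words A m | Q x) Psi x) * Z r)
    (\sum_(x <- words A m | Q x) \sum_(v <- words A r) Psi (u ++ x ++ v)).
Proof.
have [_ Pm] := Psi_qm.
rewrite big_mkcond [in X in cmp _ _ X]big_mkcond [X in cmp _ (X * _)]mulr_sumr mulr_suml.
apply: cmp_sum => x _; case: (Q x); last by rewrite mulr0 mul0r /cmp mulr0.
rewrite mulr_sumr; apply: cmp_sum => v _; rewrite expRD.
apply: (@cmp_trans _ _ _ _ (Psi (u ++ x) * Psi v)); rewrite ?expR_ge0//.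
  rewrite -[expR k]mulr1; apply: cmpM; rewrite ?expR_ge0 ?mulr_ge0//.
  exact: cmp_refl.
by rewrite catA.
Qed.

(* Summing [Psi] over the words that extend [u ++ v] would need a consistent family of
   measures; a free tail [v] of length [r] replaces it. *)
Let X (m : nat) j r := \sum_(u <- words A (j * m)) \sum_(v <- words A r)
  Psi (u ++ v) * (zpow (G u) m%:R^-1 * expR (- (j%:R * b))).

(** Factor gained by one more block: the cost of gluing [G], a typical block, the gain from low
    blocks and the loss from high ones. The powers [expR (4 * k)] come from conditioning a block on
    the rest of the word. *)
Let kappa (m : nat) e d p := expR (c / m%:R) *
  (expR e - (1 - expR (a - b)) * (p * expR (- (4 * k))) +
   expR `|b| * (d * expR (4 * k))).

(** With the exponent [1 / m], a block contributes [exp (ln (G x) / m - b)]. This is at most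
    [expR e] on typical blocks, [expR (a - b) < 1] on low ones, and [expR |b|] on all blocks because
    [G x <= 1], so rare high blocks stay affordable. *)
Lemma block_moment_step m j r e d p : (0 < m)%N -> a < b -> 0 <= e -> 0 <= d -> 0 <= p ->
  p * Z m <= \sum_(w <- words A m | G w <= expR (m%:R * a)) Psi w ->
  \sum_(w <- words A m | expR (m%:R * (b + e)) < G w) Psi w <= d * Z m ->
  X m j.+1 r <= kappa m e d p * X m j (m + r).
Proof.
move=> m0 ab e0 d0 p0 hlow hhigh; have [_ Gm] := G_qm.
have mR : 0 < m%:R :> R by rewrite ltr0n.
have mRn : m%:R != 0 :> R by rewrite gt_eqF.
rewrite /X mulSnr sum_wordsD mulr_sumr; apply: ler_sum => u _.
rewrite -mulr_suml sum_wordsD mulrA.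
pose T x := \sum_(v <- words A r) Psi (u ++ x ++ v).
have T0 x : 0 <= T x by exact: sumr_ge0.
set gu := zpow (G u) _; have gu0 : 0 <= gu by exact: zpow_ge0.
apply: (@le_trans _ _ (expR (c / m%:R) * gu * expR (- (j%:R * b)) *
   \sum_(x <- words A m) T x * (zpow (G x) m%:R^-1 * expR (- b)))).
  rewrite mulr_sumr; apply: ler_sum => x _.
  under eq_bigr do rewrite -catA.
  rewrite -mulr_suml -/(T x) -[j.+1%:R]natr1 mulrDl mul1r opprD expRD.
  rewrite [leRHS](_ : _ = T x * (expR (c / m%:R) * (gu * zpow (G x) m%:R^-1) *
     (expR (- (j%:R * b)) * expR (- b)))); last by ring.
  apply: ler_wpM2l => //; rewrite ler_wpM2r ?mulr_ge0 ?expR_ge0//.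
  have /(cmp_zpow (m%:R^-1)) : cmp (expR c) (G u * G x) (G (u ++ x)) by exact: Gm.
  rewrite zpowM// ger0_norm ?invr_ge0// [_^-1 * c]mulrC => h.
  by case: h => //; rewrite mulr_ge0.
have key x : T x * (zpow (G x) m%:R^-1 * expR (- b)) <= expR e * T x
   - (1 - expR (a - b)) * (if G x <= expR (m%:R * a) then T x else 0)
   + expR `|b| * (if expR (m%:R * (b + e)) < G x then T x else 0).
  have [Tx|Tx] := eqVneq (T x) 0.
    by rewrite Tx !if_same mul0r !mulr0 subr0 addr0.
  have Gx : 0 < G x <= 1.
    apply: G01; move: Tx; rewrite psumr_neq0// => /hasP[v _ /=].
    by rewrite !(qm_gt0 _ _ Psi_qm) => /and3P[].
  have /andP[Gx0 Gx1] := Gx.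
  have e1 : 1 <= expR e by rewrite -expR0 ler_expR.
  have ab1 : expR (a - b) <= 1 by rewrite -expR0 ler_expR subr_le0 ltW.
  have gE : zpow (G x) m%:R^-1 * expR (- b) = expR (ln (G x) / m%:R - b).
    by rewrite zpow_expR// -expRD mulrC.
  have hi0 : 0 <= expR `|b| * (if expR (m%:R * (b + e)) < G x then T x else 0).
    by rewrite mulr_ge0 ?expR_ge0//; case: ifP.
  rewrite gE; case: ifPn => hl.
    apply: (@le_trans _ _ (T x * expR (a - b))).
      rewrite ler_wpM2l// ler_expR lerD2r ler_pdivrMr// -ler_expR lnK//.
      by rewrite mulrC.
    have : 0 <= T x * (expR e - 1) by rewrite mulr_ge0// subr_ge0.
    lra.
  rewrite mulr0 subr0; case: ifPn => hh.
    apply: (@le_trans _ _ (expR `|b| * T x)); last first.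
      by rewrite lerDr mulr_ge0 ?expR_ge0.
    rewrite mulrC ler_wpM2r// ler_expR.
    apply: (@le_trans _ _ (- b)); last by rewrite -normrN ler_norm.
    rewrite gerDr; apply: mulr_le0_ge0; first exact: ln_le0.
    by rewrite invr_ge0 ltW.
  rewrite mulr0 addr0 mulrC ler_wpM2r// ler_expR lerBlDl ler_pdivrMr//.
  by rewrite -ler_expR lnK// mulrC leNgt.
set TT := \sum_(x <- words A m) T x.
have TTE : TT = \sum_(x <- words A m | predT x) T x by [].
have [hT1 hT2] := sum_middle_cmp predT u m r; rewrite -TTE in hT1 hT2.
have e4 : expR (4 * k) = expR (k + k) * expR (k + k) by rewrite -expRD; congr expR; ring.
have low : p * expR (- (4 * k)) * TT <= \sum_(x <- words A m | G x <= expR (m%:R * a)) T x.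
  have [h1 _] := sum_middle_cmp (fun x => G x <= expR (m%:R * a)) u m r.
  have h3 : Psi u * (p * Z m) * Z r <=
      Psi u * (\sum_(x <- words A m | G x <= expR (m%:R * a)) Psi x) * Z r.
    by rewrite ler_wpM2r ?(ltW (Z0 r))// ler_wpM2l.
  rewrite expRN mulrAC ler_pdivrMr ?expR_gt0// e4.
  apply: (le_trans (ler_wpM2l p0 hT2)).
  have := ler_wpM2l (expR_ge0 (k + k)) (le_trans h3 h1); lra.
have high : \sum_(x <- words A m | expR (m%:R * (b + e)) < G x) T x <= d * expR (4 * k) * TT.
  have [_ h1] := sum_middle_cmp (fun x => expR (m%:R * (b + e)) < G x) u m r.
  have h3 : Psi u * (\sum_(x <- words A m | expR (m%:R * (b + e)) < G x) Psi x) * Z r <=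
      Psi u * (d * Z m) * Z r.
    by rewrite ler_wpM2r ?(ltW (Z0 r))// ler_wpM2l.
  apply: (le_trans h1); rewrite e4.
  have := ler_wpM2l (expR_ge0 (k + k)) h3.
  have := ler_wpM2l (expR_ge0 (k + k)) (ler_wpM2l d0 hT1); lra.
apply: (@le_trans _ _ (expR (c / m%:R) * gu * expR (- (j%:R * b)) *
   (expR e * TT - (1 - expR (a - b)) * (p * expR (- (4 * k)) * TT) +
    expR `|b| * (d * expR (4 * k) * TT)))).
  apply: ler_wpM2l; first by rewrite !mulr_ge0 ?expR_ge0.
  apply: (le_trans (ler_sum _ (fun x _ => key x))).
  rewrite big_split sumrB/= -!mulr_sumr -/TT -!big_mkcond/=.
  have ab1 : expR (a - b) <= 1 by rewrite -expR0 ler_expR subr_le0 ltW.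
  apply: lerD; last by rewrite ler_wpM2l ?expR_ge0.
  by rewrite lerD2l lerN2 ler_wpM2l ?subr_ge0.
rewrite le_eqVlt; apply/orP; left; apply/eqP; rewrite /kappa /TT /T; ring.
Qed.

(** After [j] blocks the moment is at most [exp (- 2 e j)] times the total mass, while the words
    close to the upper slope alone give at least a constant times [exp (- e j)]. *)
Lemma kink_contradiction : a < b ->
  (exists p m0, 0 < p /\ forall m, (m0 <= m)%N ->
    p * Z m <= \sum_(w <- words A m | G w <= expR (m%:R * a)) Psi w) ->
  (forall e, 0 < e -> exists p m0, 0 < p /\ forall m, (m0 <= m)%N ->
    p * Z m <= \sum_(w <- words A m | expR (m%:R * (b - e)) <= G w) Psi w) ->
  (forall e d, 0 < e -> 0 < d -> exists m0, forall m, (m0 <= m)%N ->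
    \sum_(w <- words A m | expR (m%:R * (b + e)) < G w) Psi w <= d * Z m) ->
  False.
Proof.
move=> ab [p [m1 [p0 hlow]]] hhigh hup.
have ab1 : expR (a - b) < 1 by rewrite -expR0 ltr_expR subr_lt0.
pose D := (1 - expR (a - b)) * (p * expR (- (4 * k))).
have D0 : 0 < D by rewrite !mulr_gt0 ?subr_gt0 ?expR_gt0.
(* [exp (4 e) = 1 + D / 2], so a typical block, after the gain [D] and the loss [D / 2], is worth at
   most [exp (- 3 e)]. The gluing cost [c / m] then uses up one more [e]. *)
pose e := ln (1 + D / 2) / 4.
have e0 : 0 < e by rewrite divr_gt0// ln_gt0// ltrDl divr_gt0.
have e3 : expR e - D / 2 <= expR (- (3 * e)).
  have -> : expR e = expR (4 * e) * expR (- (3 * e)) by rewrite -expRD; congr expR; ring.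
  rewrite [4 * e]mulrC divfK// lnK ?posrE ?addr_gt0 ?divr_gt0//.
  have h1 : expR (- (3 * e)) <= 1 by rewrite -[leRHS]expR0 ler_expR; lra.
  have : 0 <= D / 2 * (1 - expR (- (3 * e))) by rewrite mulr_ge0 ?subr_ge0// ltW// divr_gt0.
  lra.
(* The probability of high blocks for which their term in [kappa] is exactly [D / 2]. *)
pose d := D / 2 * expR (- `|b|) * expR (- (4 * k)).
have d0 : 0 < d by apply: mulr_gt0; [apply: mulr_gt0; [exact: divr_gt0|]|]; exact: expR_gt0.
have [m2 hup'] := hup e d e0 d0.
have [q [m3 [q0 hq]]] := hhigh e e0.
pose m := (maxn (maxn m1 m2) (Num.trunc (`|c| / e)).+1).
have m0 : (0 < m)%N by rewrite /m leq_max orbT.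
have mR : 0 < m%:R :> R by rewrite ltr0n.
have cm : c / m%:R <= e.
  rewrite ler_pdivrMr// mulrC -ler_pdivrMr//; apply: (@le_trans _ _ (`|c| / e)).
    by rewrite ler_wpM2r ?invr_ge0 ?(ltW e0)// ler_norm.
  apply: (@le_trans _ _ (Num.trunc (`|c| / e)).+1%:R); first exact/ltW/truncnS_gt.
  by rewrite ler_nat leq_maxr.
have m1m : (m1 <= m)%N by rewrite /m !leq_max leqnn.
have m2m : (m2 <= m)%N by rewrite /m !leq_max leqnn orbT.
have X_ge0 j r : 0 <= X m j r.
  apply: sumr_ge0 => u _; apply: sumr_ge0 => v _.
  by rewrite !mulr_ge0 ?zpow_ge0 ?expR_ge0.
have stepX j r := @block_moment_step m j r e d p m0 ab (ltW e0) (ltW d0) (ltW p0)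
    (hlow m m1m) (hup' m m2m).
have kap : kappa m e d p <= expR (- (2 * e)).
  rewrite /kappa -/D (_ : expR `|b| * (d * expR (4 * k)) = D / 2); last first.
    rewrite /d !expRN; field; by rewrite !gt_eqF ?expR_gt0.
  apply: (@le_trans _ _ (expR (c / m%:R) * expR (- (3 * e)))).
    rewrite ler_wpM2l ?expR_ge0//; lra.
  by rewrite -expRD ler_expR; lra.
have iterX j r : X m j r <= expR (- (2 * e)) ^+ j * X m 0 (j * m + r)%N.
  elim: j r => [|j IH] r; first by rewrite expr0 mul1r.
  apply: (le_trans (stepX j r)); apply: (@le_trans _ _ (expR (- (2 * e)) * X m j (m + r))).
    by rewrite ler_wpM2r.
  by rewrite exprS -mulrA ler_wpM2l ?expR_ge0// mulSnr -addnA.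
have X0Z n : X m 0 n <= Z n.
  rewrite /X mul0n sum_words0 -mulr_suml; under eq_bigr do rewrite cat0s.
  have /G01/andP[g0 g1] : 0 < Psi [::] by have := Z0 0; rewrite sum_words0.
  rewrite ler_piMr ?(ltW (Z0 n))// mul0r oppr0 expR0 mulr1 -[leRHS](zpow1l m%:R^-1).
  by rewrite ler_zpow ?invr_ge0// ltW.
have lowX j : (m3 <= j * m)%N -> q * expR (- (e * j%:R)) * Z (j * m)%N <= X m j 0.
  move=> /hq hj; rewrite mulrAC.
  apply: (@le_trans _ _ (expR (- (e * j%:R)) *
      \sum_(w <- words A (j * m) | expR ((j * m)%:R * (b - e)) <= G w) Psi w)).
    by rewrite mulrC ler_wpM2l ?expR_ge0.
  rewrite /X mulr_sumr big_mkcond; apply: ler_sum => u _; rewrite sum_words0 cats0.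
  case: ifP => [hu|_]; last by rewrite !mulr_ge0 ?zpow_ge0 ?expR_ge0.
  rewrite mulrC ler_wpM2l//.
  have Gu : 0 < G u by apply: lt_le_trans hu; exact: expR_gt0.
  rewrite zpow_expR// -expRD ler_expR.
  have : (j * m)%:R * (b - e) <= ln (G u) by rewrite -ler_expR lnK.
  rewrite natrM => h; have : j%:R * (b - e) <= m%:R^-1 * ln (G u).
    by rewrite [leRHS]mulrC ler_pdivlMr// mulrAC.
  lra.
(* From this [j] on, the constant [q] exceeds [exp (- e j)]. *)
pose j := maxn m3 (Num.trunc (`|ln q| / e)).+1.
have mj : (m3 <= j * m)%N.
  by apply: (@leq_trans j); [exact: leq_maxl|exact: leq_pmulr].
have := le_trans (lowX j mj) (iterX j 0).
move/le_trans => /(_ (expR (- (2 * e)) ^+ j * Z (j * m)%N)).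
rewrite addn0 ler_wpM2l ?exprn_ge0 ?expR_ge0// => /(_ isT).
rewrite ler_pM2r// -[q]lnK ?posrE// -expRD -expRM_natr ler_expR => h.
have : `|ln q| / e < j%:R.
  apply: (lt_le_trans (truncnS_gt _)); by rewrite ler_nat leq_maxr.
rewrite ltr_pdivrMr// => h2; have := ler_norm (- ln q); rewrite normrN => h3.
lra.
Qed.

End Kink.

(** * One-sided slopes of a convex function *)

Section ConvexDerivative.
Context {R : realType}.
Variables (f : R -> R) (q : R).
Hypothesis f_convex : forall x y t, 0 <= t <= 1 ->
  f (t * x + (1 - t) * y) <= t * f x + (1 - t) * f y.

Lemma convex_slope_nondecr t u : 0 < t -> t <= u -> (f (q + t) - f q) / t <= (f (q + u) - f q) / u.
Proof.
move=> t0 tu; have u0 := lt_le_trans t0 tu.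
have tu01 : 0 <= t / u <= 1.
  apply/andP; split; first by apply: divr_ge0; exact: ltW.
  by rewrite ler_pdivrMr// mul1r.
have := f_convex (q + u) q tu01.
rewrite (_ : t / u * (q + u) + (1 - t / u) * q = q + t); last by field; rewrite gt_eqF.
move=> h; rewrite ler_pdivrMr// mulrAC -mulrA; lra.
Qed.

Lemma convex_slope_left_nincr t u : 0 < t -> t <= u ->
  (f q - f (q - u)) / u <= (f q - f (q - t)) / t.
Proof.
move=> t0 tu; have u0 := lt_le_trans t0 tu.
have tu01 : 0 <= t / u <= 1.
  apply/andP; split; first by apply: divr_ge0; exact: ltW.
  by rewrite ler_pdivrMr// mul1r.
have := f_convex (q - u) q tu01.
rewrite (_ : t / u * (q - u) + (1 - t / u) * q = q - t); last by field; rewrite gt_eqF.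
move=> h; rewrite ler_pdivlMr// mulrAC -mulrA; lra.
Qed.

Lemma convex_slope_left_right t u : 0 < t -> 0 < u ->
  (f q - f (q - t)) / t <= (f (q + u) - f q) / u.
Proof.
move=> t0 u0; have tu : 0 < t + u by rewrite addr_gt0.
have tu01 : 0 <= t / (t + u) <= 1.
  apply/andP; split; first by apply: divr_ge0; exact: ltW.
  by rewrite ler_pdivrMr// mul1r lerDl ltW.
have := f_convex (q + u) (q - t) tu01.
rewrite (_ : t / (t + u) * (q + u) + (1 - t / (t + u)) * (q - t) = q); last first.
  by field; rewrite gt_eqF.
rewrite (_ : 1 - t / (t + u) = u / (t + u)); last by field; rewrite gt_eqF.
rewrite ![_ / (t + u) * _]mulrAC -mulrDl ler_pdivlMr// => h.
rewrite ler_pdivrMr// mulrAC ler_pdivlMr//; lra.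
Qed.

(** The last condition identifies [b] as the right derivative and not merely a lower bound for the
    right slopes; it controls upper deviations of F. *)
Definition no_kink := forall a b : R, a < b ->
  (forall t, 0 < t -> f q + b * t <= f (q + t)) ->
  (forall t, 0 < t -> f q - a * t <= f (q - t)) ->
  (forall e, 0 < e -> exists2 d, 0 < d & f (q + d) <= f q + d * (b + e)) -> False.

(** The infimum of the right slopes and the supremum of the left ones must agree. One test point on
    each side is kept in the conclusion because exponential Chebyshev bounds need no more. *)
Lemma convex_no_kink_slope : no_kink -> exists l : R,
  [/\ forall t, f q + l * t <= f (q + t),
      forall e, 0 < e -> exists2 d, 0 < d & f (q + d) <= f q + d * (l + e) &
      forall e, 0 < e -> exists2 d, 0 < d & f (q - d) <= f q - d * (l - e)].
Proof.
move=> nk.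
pose Er := [set (f (q + t) - f q) / t | t in [set t | 0 < t]].
pose El := [set (f q - f (q - t)) / t | t in [set t | 0 < t]].
have Elr x y : El x -> Er y -> x <= y.
  by move=> [t /= t0 <-] [u /= u0 <-]; exact: convex_slope_left_right.
have Er1 : Er ((f (q + 1) - f q) / 1) by exists 1 => //=.
have El1 : El ((f q - f (q - 1)) / 1) by exists 1 => //=.
have hEr : has_inf Er.
  by split; [eexists; exact: Er1|exists ((f q - f (q - 1)) / 1) => y /(Elr _ _ El1)].
have hEl : has_sup El.
  by split; [eexists; exact: El1|exists ((f (q + 1) - f q) / 1) => y /Elr /(_ Er1)].
have right t : 0 < t -> f q + inf Er * t <= f (q + t).
  move=> t0; rewrite addrC -lerBrDr -ler_pdivlMr//.
  by apply: ge_inf; [case: hEr|exists t].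
have left t : 0 < t -> f q - sup El * t <= f (q - t).
  move=> t0; rewrite lerBlDl -lerBlDr -ler_pdivrMr//.
  by apply: ub_le_sup; [case: hEl|exists t].
have ar e : 0 < e -> exists2 d, 0 < d & f (q + d) <= f q + d * (inf Er + e).
  move=> e0; have [_ [d /= d0 <-] h] := inf_adherent e0 hEr; exists d => //.
  by move/ltW: h; rewrite ler_pdivrMr//; lra.
have al e : 0 < e -> exists2 d, 0 < d & f (q - d) <= f q - d * (sup El - e).
  move=> e0; have [_ [d /= d0 <-] h] := sup_adherent e0 hEl; exists d => //.
  by move/ltW: h; rewrite ler_pdivlMr//; lra.
have ab : sup El = inf Er.
  apply/eqP; rewrite eq_le; apply/andP; split.
    apply: ge_sup; first by case: hEl.
    by move=> x Elx; apply: lb_le_inf; [case: hEr|move=> y /(Elr _ _ Elx)].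
  rewrite leNgt; apply/negP => lt; exact: nk lt right left ar.
exists (inf Er); split => //; last by rewrite -ab.
move=> t; have [t0|t0|<-] := ltgtP 0 t; first exact: right.
  by have := left (- t); rewrite oppr_gt0 t0 opprK ab mulrN opprK; apply.
by rewrite mulr0 !addr0.
Qed.

Lemma is_derive_convex_slope l :
  (forall t, f q + l * t <= f (q + t)) ->
  (forall e, 0 < e -> exists2 d, 0 < d & f (q + d) <= f q + d * (l + e)) ->
  (forall e, 0 < e -> exists2 d, 0 < d & f (q - d) <= f q - d * (l - e)) ->
  is_derive q 1 f l.
Proof.
move=> hl hr hL.
have cv : h^-1 *: (f (h *: (1:R) + q) - f q) @[h --> (0:R)^'] --> l.
  apply/cvgrPdist_le => e e0.
  have [d1 d10 h1] := hr e e0; have [d2 d20 h2] := hL e e0.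
  have d0 : 0 < Num.min d1 d2 by rewrite lt_min d10.
  near=> h; have h0 : h != 0 by near: h; exact: nbhs_dnbhs_neq.
  have hd : `|h| < Num.min d1 d2 by near: h; exact: dnbhs0_lt.
  rewrite /GRing.scale/= mulr1 [h + q]addrC mulrC distrC ler_norml.
  move: hd; rewrite lt_min => /andP[hd1 hd2].
  have [hp|hn|/eqP] := ltgtP 0 h; last by rewrite eq_sym (negbTE h0).
    rewrite gtr0_norm// in hd1.
    have u1 : (f (q + h) - f q) / h <= l + e.
      apply: (le_trans (convex_slope_nondecr hp (ltW hd1))).
      by rewrite ler_pdivrMr//; lra.
    have u2 : l <= (f (q + h) - f q) / h by rewrite ler_pdivlMr//; have := hl h; lra.
    by apply/andP; split; lra.
  rewrite ltr0_norm// in hd2; have hp : 0 < - h by rewrite oppr_gt0.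
  have E : (f (q + h) - f q) / h = (f q - f (q - - h)) / - h.
    by rewrite opprK; field.
  have u1 : l - e <= (f (q + h) - f q) / h.
    rewrite E; apply: (le_trans _ (convex_slope_left_nincr hp (ltW hd2))).
    by rewrite ler_pdivlMr//; lra.
  have u2 : (f (q + h) - f q) / h <= l by rewrite ler_ndivrMr//; have := hl h; lra.
  by apply/andP; split; lra.
apply: DeriveDef; first by apply/cvg_ex; exists l.
exact: cvg_lim cv.
Unshelve. all: by end_near. Qed.

End ConvexDerivative.

(** * The pressure has no kink *)

Section TiltDifferentiable.
Context {R : realType} {A1 A2 : alphabetType}.
Variables (psi : seq (A1 * A2) -> R) (c s : R).
Hypothesis psi_qm : qm c psi.
Hypothesis psi_sum1 : forall n, \sum_(w <- words (A1 * A2)%type n) psi w = 1.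
Hypothesis s01 : 0 < s <= 1.

Let s0 : 0 < s. Proof. by case/andP: s01. Qed.

Local Notation Z := (tilt_part psi s).
Local Notation Psi := (tilt psi s).
Local Notation G := (potential psi s).
Local Notation P := (tilt_pressure psi s).

Let Z0 q n : 0 < Z q n. Proof. exact: tilt_part_gt0 psi_qm psi_sum1 q n. Qed.
Let Psi0 q w : 0 <= Psi q w. Proof. exact: tilt_ge0. Qed.
Let c0 : 0 <= c. Proof. exact: qm_const_ge0 psi_qm psi_sum1. Qed.

(** Exponential Chebyshev inequality, for [d] of either sign. *)
Lemma tilt_tail q d y n (Q : pred (seq (A1 * A2))) :
  (forall w, 0 < psi w -> Q w -> expR y <= zpow (G w) d) ->
  \sum_(w <- words (A1 * A2)%type n | Q w) Psi q w <= expR (- y) * Z (q + d) n.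
Proof.
move=> hQ; rewrite expRN mulrC ler_pdivlMr ?expR_gt0//.
apply: le_trans (tilt_exp_moment psi_qm s01 q d n).
rewrite mulr_suml big_mkcond; apply: ler_sum => w _.
case: ifP => [Qw|_]; last by rewrite mulr_ge0 ?zpow_ge0.
have [pw|pw] := eqVneq (psi w) 0; first by rewrite tilt_psi0// !mul0r.
by apply: ler_wpM2l => //; apply: hQ => //; rewrite lt0r pw (qm_ge0 psi_qm).
Qed.

(* Used with |t| of order 1/n: then the lower bound does not depend on n. *)
Lemma tilt_mass_lower q t y B n (Q : pred (seq (A1 * A2))) : `|t| <= 1 ->
  (forall w, size w = n -> 0 < psi w -> ~~ Q w -> zpow (G w) t <= expR y) ->
  (forall w, size w = n -> 0 < psi w -> zpow (G w) t <= expR B) ->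
  y + (ln 2 + (2 * `|q| + 1) * c) <= n%:R * (P (q + t) - P q) ->
  expR ((y - B) / s) * Z q n <= \sum_(w <- words (A1 * A2)%type n | Q w) Psi q w.
Proof.
move=> t1 hy hb hP; have := tilt_part_split psi_qm s01 q hy hb.
set S := \sum_(_ <- _ | _) _ => hS.
have S0 : 0 <= S by apply: sumr_ge0 => w _.
(* The term [ln 2] makes [Z (q + t) n] twice the bound for the words outside [Q], so at least half
   of it comes from [Q]. The term [(2 |q| + 1) c] pays the pressure errors at [q] and at [q + t], as
   [|t| <= 1]. *)
have h2 : 2 * expR y * Z q n <= Z (q + t) n.
  apply: (le_trans _ (tilt_part_ge psi_qm psi_sum1 s01 (q + t) n)).
  rewrite -[2%:R]lnK ?posrE// -expRD.
  apply: (@le_trans _ _ (expR (ln 2%:R + y) * expR (n%:R * P q + `|q| * c))).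
    by rewrite ler_wpM2l ?expR_ge0// tilt_part_le.
  rewrite -expRD ler_expR.
  have : `|q + t| * c <= (`|q| + 1) * c.
    by rewrite ler_wpM2r//; apply: (le_trans (ler_normD _ _)); rewrite lerD2l.
  lra.
have h3 : expR y * Z q n <= expR B * (zpow S s * zpow (Z q n) (1 - s)).
  by have := le_trans h2 hS; lra.
have h4 : zpow (expR ((y - B) / s) * Z q n) s <= zpow S s.
  rewrite zpowM ?expR_ge0 ?(ltW (Z0 _ _))// zpow_expR_l [s * _]mulrC divfK ?gt_eqF//.
  rewrite expRD expRN mulrAC ler_pdivrMr ?expR_gt0// mulrC.
  have zz : Z q n = zpow (Z q n) s * zpow (Z q n) (1 - s).
    by rewrite -zpowD ?(ltW (Z0 _ _))// addrC subrK zpow1// ltW.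
  have zp : 0 < zpow (Z q n) (1 - s) by rewrite zpow_gt0.
  by rewrite -(ler_pM2r zp); move: h3; rewrite {1}zz; lra.
rewrite leNgt; apply/negP => lt.
have E0 : 0 < expR ((y - B) / s) * Z q n by rewrite mulr_gt0 ?expR_gt0.
move: h4; apply/negP; rewrite -ltNge.
move: S0; rewrite le_eqVlt => /predU1P[<-|S0]; first by rewrite zpow0l zpow_gt0.
by rewrite !zpow_expR// ltr_expR ltr_pM2l// ltr_ln.
Qed.

Lemma tilt_no_kink q : no_kink P q.
Proof.
move=> a0 b ab hb ha hr.
(* The excess that [tilt_mass_lower] requires. With [|t| = tau / n] it has to be [tau] times a gap
   between slopes, which fixes both choices of [tau] below. *)
pose D := ln 2 + (2 * `|q| + 1) * c.
have D0 : 0 < D by rewrite ltr_pwDl ?ln_gt0 ?ltr1n// mulr_ge0// addr_ge0// mulr_ge0.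
have [M M0 lnG] := qm_ln_bound (potential_qm psi_qm s01).
have lnG0 w : 0 < psi w -> ln (G w) <= 0.
  by move=> w0; apply: ln_le0; exact: (potential_le1 psi_qm psi_sum1 s01 w0).
(* Low words are defined with the midpoint rather than [a0], since a positive gap [a - a0] is needed
   to pay for [D]. *)
pose a := (a0 + b) / 2.
have ab' : a < b by rewrite /a; lra.
have a0a : 0 < a - a0 by rewrite /a; lra.
have small (tau : R) n : 0 < tau -> (Num.trunc tau < n)%N ->
    [/\ 0 < n%:R :> R, 0 < tau / n%:R & tau / n%:R <= 1].
  move=> t0 hn; have n0 : 0 < n%:R :> R by rewrite ltr0n; case: n hn.
  split => //; first exact: divr_gt0.
  rewrite ler_pdivrMr// mul1r; apply/ltW; apply: (lt_le_trans (truncnS_gt _)).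
  by rewrite ler_nat.
apply: (@kink_contradiction _ _ (Psi q) G (3 * `|q| * c) c a b).
- exact: tilt_qm.
- exact: potential_qm.
- by move=> n; rewrite sum_tilt.
- move=> w; rewrite (tilt_gt0E s psi_qm) => w0.
  by rewrite potential_gt0//= (potential_le1 psi_qm psi_sum1 s01).
- exact: ab'.
- pose tau := D / (a - a0); have tau0 : 0 < tau by exact: divr_gt0.
  exists (expR ((- (tau * a) - tau * (M + c)) / s)), (Num.trunc tau).+1.
  split; first exact: expR_gt0.
  move=> n hn; have [n0 t0 t1] := small tau n tau0 hn.
  rewrite sum_tilt; apply: (@tilt_mass_lower q (- (tau / n%:R))).
  + by rewrite normrN gtr0_norm.
  + move=> w _ w0; rewrite -ltNge => hw.
    rewrite zpow_expR ?potential_gt0// ler_expR mulNr lerN2.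
    have : n%:R * a <= ln (G w) by rewrite -ler_expR lnK ?posrE ?potential_gt0// ltW.
    move=> hG; rewrite -(mulrA tau) ler_pM2l// [_^-1 * _]mulrC ler_pdivlMr//; lra.
  + move=> w sw w0; rewrite zpow_expR ?potential_gt0// ler_expR mulNr -mulrN -(mulrA tau).
    rewrite ler_pM2l// [_^-1 * _]mulrC ler_pdivrMr//.
    have := lnG w (potential_gt0 s w0); rewrite sw => h.
    apply: (le_trans (ler_norm _)); rewrite normrN; apply: (le_trans h).
    have n1 : 1 <= n%:R :> R by rewrite ler1n; case: (n) hn.
    have := ler_wpM2r c0 n1; lra.
  + have := ha _ t0; rewrite mulrCA => h.
    have : n%:R * (- (a0 * (tau / n%:R))) <= n%:R * (P (q - tau / n%:R) - P q).
      by rewrite ler_pM2l//; lra.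
    apply: le_trans.
    have -> : n%:R * (- (a0 * (tau / n%:R))) = - (tau * a0) by field; rewrite gt_eqF.
    have : tau * (a - a0) = D by rewrite /tau divfK// gt_eqF.
    rewrite /D; lra.
- move=> e e0; pose tau := D / e; have tau0 : 0 < tau by exact: divr_gt0.
  exists (expR ((tau * (b - e) - 0) / s)), (Num.trunc tau).+1.
  split; first exact: expR_gt0.
  move=> n hn; have [n0 t0 t1] := small tau n tau0 hn.
  rewrite sum_tilt; apply: (@tilt_mass_lower q (tau / n%:R)).
  + by rewrite gtr0_norm.
  + move=> w _ w0; rewrite -ltNge => hw.
    rewrite zpow_expR ?potential_gt0// ler_expR.
    have : ln (G w) <= n%:R * (b - e) by rewrite -ler_expR lnK ?posrE ?potential_gt0// ltW.
    move=> hG; rewrite -(mulrA tau) ler_pM2l// [_^-1 * _]mulrC ler_pdivrMr//; lra.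
  + move=> w sw w0; rewrite zpow_expR ?potential_gt0// ler_expR.
    by apply: mulr_ge0_le0; [exact: ltW|exact: lnG0].
  + have := hb _ t0 => h.
    have : n%:R * (b * (tau / n%:R)) <= n%:R * (P (q + tau / n%:R) - P q).
      by rewrite ler_pM2l//; lra.
    apply: le_trans.
    have -> : n%:R * (b * (tau / n%:R)) = tau * b by field; rewrite gt_eqF.
    have : tau * e = D by rewrite /tau divfK// gt_eqF.
    rewrite /D; lra.
(* The right derivative is [b], so some [r] has slope at most [b + e / 2]; the remaining [e / 2] per
   letter gives exponential decay. *)
- move=> e d e0 d0; have [r r0 hr'] := hr (e / 2) (divr_gt0 e0 (ltr0n _ 2)).
  pose C := `|q + r| * c + `|q| * c.
  pose m0 := (Num.trunc (`|C - ln d| / (r * (e / 2)))).+1.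
  have re0 : 0 < r * (e / 2) by rewrite mulr_gt0// divr_gt0.
  exists m0 => m hm; rewrite sum_tilt.
  have mm : `|C - ln d| <= m%:R * (r * (e / 2)).
    rewrite -ler_pdivrMr//; apply/ltW; apply: (lt_le_trans (truncnS_gt _)).
    by rewrite ler_nat.
  apply: (le_trans (@tilt_tail q r (r * (m%:R * (b + e))) m _ _)).
    move=> w w0 hw; rewrite zpow_expR ?potential_gt0// ler_expR ler_pM2l//.
    by rewrite -ler_expR lnK ?posrE ?potential_gt0// ltW.
  apply: (@le_trans _ _ (expR (- (r * (m%:R * (b + e)))) * expR (m%:R * P (q + r) + `|q + r| * c))).
    by rewrite ler_wpM2l ?expR_ge0// tilt_part_le.
  apply: (@le_trans _ _ (d * expR (m%:R * P q - `|q| * c))); last first.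
    by rewrite ler_wpM2l ?(ltW d0)// tilt_part_ge.
  have dE : d = expR (ln d) by rewrite lnK.
  rewrite [X in _ <= X * _]dE -!expRD ler_expR.
  have := ler_wpM2l (ler0n R m) hr'; have := ler_norm (C - ln d).
  move: mm; rewrite /C; lra.
Qed.

Lemma tilt_pressure_derivative (q : R) : exists2 l : R,
  is_derive q 1 P l &
  (forall t, P q + l * t <= P (q + t)) /\
  (forall e, 0 < e -> exists2 d, 0 < d & P (q + d) <= P q + d * (l + e)) /\
  (forall e, 0 < e -> exists2 d, 0 < d & P (q - d) <= P q - d * (l - e)).
Proof.
have cvx := tilt_pressure_convex psi_qm psi_sum1 s01.
have [|l [h1 h2 h3]] := @convex_no_kink_slope _ P q (fun x y t => @cvx x y t).
  exact: tilt_no_kink.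
by exists l => //; exact: is_derive_convex_slope.
Qed.

End TiltDifferentiable.

(** * Balls and their measures *)

Lemma take_mkseq (T : Type) (z : nat -> T) n m : (n <= m)%N -> take n (mkseq z m) = mkseq z n.
Proof. by move=> nm; rewrite /mkseq -map_take take_iota; move/minn_idPl : nm => ->. Qed.

Section PrefixMeasure.
Context {R : realType} {A : alphabetType}.
Variable mu : probability (symbolic A) R.

Lemma cylinder_measurable (w : seq A) : measurable (cylinder w : set (symbolic A)).
Proof. by apply: sub_sigma_algebra; exists w. Qed.

Lemma measure_prefix_in n (ws : seq (seq A)) : uniq ws -> {in ws, forall w, size w = n} ->
  measurable ([set z | mkseq z n \in ws] : set (symbolic A)) /\
  mu [set z | mkseq z n \in ws] = (\sum_(w <- ws) mu (cylinder w))%E.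
Proof.
elim: ws => [|w ws IH] /=.
  move=> _ _; rewrite big_nil.
  have -> : [set z | mkseq z n \in [::]] = set0 :> set (symbolic A) by rewrite -subset0.
  by split; [exact: measurable0|rewrite measure0].
move=> /andP[wws uws] sws; have [] := IH uws.
  by move=> x xws; apply: sws; rewrite in_cons xws orbT.
move=> mws e.
have sw : size w = n by apply: sws; rewrite mem_head.
have -> : [set z | mkseq z n \in w :: ws] = cylinder w `|` [set z | mkseq z n \in ws].
  apply/seteqP; split => z /=; rewrite in_cons /cylinder/= sw.
    by move=> /predU1P[->|]; [left|right].
  by case=> [->|->]; rewrite ?eqxx ?orbT.
have mw := cylinder_measurable w.
split; first exact: measurableU.
have dis : cylinder w `&` [set z | mkseq z n \in ws] = set0.
  rewrite -subset0 => z [/=]; rewrite /cylinder/= sw => ->.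
  by rewrite (negbTE wws).
by rewrite big_cons -e; exact: measureU.
Qed.

Lemma measure_prefix n (Q : pred (seq A)) :
  mu [set z | Q (mkseq z n)] = (\sum_(w <- words A n | Q w) mu (cylinder w))%E.
Proof.
rewrite -big_filter; have sz : {in [seq w <- words A n | Q w], forall w, size w = n}.
  by move=> w; rewrite mem_filter mem_words => /andP[_ /eqP].
have [_ <-] := measure_prefix_in (filter_uniq Q (uniq_words A n)) sz.
congr (mu _); apply/seteqP; split => z /=; rewrite mem_filter mem_words size_mkseq eqxx.
  by move=> ->.
by rewrite andbT.
Qed.

Variable psi : seq A -> R.
Hypothesis psi_mu : forall w, (psi w)%:E = mu (cylinder w).

Lemma measure_prefix_sum n (Q : pred (seq A)) :
  mu [set z | Q (mkseq z n)] = (\sum_(w <- words A n | Q w) psi w)%:E.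
Proof. by rewrite measure_prefix -sumEFin; apply: eq_bigr => w _; rewrite psi_mu. Qed.

Lemma sum_words_measure n : \sum_(w <- words A n) psi w = 1.
Proof.
have := measure_prefix_sum n predT; rewrite [X in mu X](_ : _ = setT); last first.
  by apply/seteqP; split.
by rewrite probability_setT => -[].
Qed.

End PrefixMeasure.

Section WordDistance.
Context {R : realType}.

Lemma eq_mkseqP (A : eqType) (z z' : nat -> A) n :
  reflect (forall i, (i < n)%N -> z i = z' i) (mkseq z n == mkseq z' n).
Proof.
apply: (iffP eqP) => [h i lin|h].
  by have := congr1 (fun s => nth (z 0%N) s i) h; rewrite !nth_mkseq.
by apply/eq_in_map => i; rewrite mem_iota add0n => /andP[_ /h].
Qed.

(** Used with [N = r2 ^ n] for both coordinates: the prefix length is then g(n) for the first and n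
    for the second. *)
Lemma word_dist_le (A : alphabetType) r N (z z' : nat -> A) : (1 < r)%N -> (0 < N)%N ->
  (word_dist r z z' <= (N%:R : R)^-1) = (mkseq z (up_log r N) == mkseq z' (up_log r N)).
Proof.
move=> r1 N0; rewrite /word_dist; case: pselect => [zz'|nzz']; last first.
  rewrite invr_ge0 ler0n; apply/esym/eq_mkseqP => i _; apply/eqP.
  by apply/negPn/negP => h; apply: nzz'; exists i.
case: ex_minnP => j zj jmin.
rewrite -natrX lef_pV2 ?posrE ?ltr0n ?expn_gt0 ?(ltnW r1)// ler_nat.
apply/idP/eq_mkseqP => [h i hi|h].
  apply/eqP; apply/negPn/negP => /jmin ji.
  have := up_log_min r1 h; rewrite leqNgt => /negP; apply; exact: leq_ltn_trans hi.
have : (up_log r N <= j)%N by rewrite leqNgt; apply/negP => /h; apply/eqP.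
by move=> /(leq_pexp2l (ltnW r1)); apply: leq_trans; exact: up_logP.
Qed.

End WordDistance.

Section Balls.
Context {R : realType} (r1 r2 : nat).
Hypothesis r1_ge2 : (2 <= r1)%N.
Hypothesis r1_le_r2 : (r1 <= r2)%N.
Let r2_ge2 : (2 <= r2)%N. Proof. exact: leq_trans r1_le_r2. Qed.
Local Notation A1 := (letters r1).
Local Notation A2 := (letters r2).

(** This is g(n): [r1 ^ - m <= r2 ^ - n] amounts to [r2 ^ n <= r1 ^ m]. *)
Definition ball_len n := up_log r1 (r2 ^ n).
Local Notation g := ball_len.

Lemma ln_r1_gt0 : 0 < ln r1%:R :> R. Proof. by rewrite ln_gt0// ltr1n. Qed.
Lemma ln_r2_gt0 : 0 < ln r2%:R :> R. Proof. by rewrite ln_gt0// ltr1n. Qed.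

Lemma ln_r1_le : ln r1%:R <= ln r2%:R :> R.
Proof. by rewrite ler_ln ?posrE ?ltr0n ?ler_nat// ltnW. Qed.

Lemma ball_len_ge n : (n <= g n)%N.
Proof.
have h := up_logP (r2 ^ n) r1_ge2; rewrite -(@leq_exp2l r2)//.
by apply: (leq_trans h); rewrite -/(g n); case: (g n) => // k; rewrite leq_exp2r.
Qed.

Lemma ball_len_lower n : n%:R * ln r2%:R <= (g n)%:R * ln r1%:R :> R.
Proof.
rewrite !mulr_natl -!lnXn ?ltr0n ?(ltnW r1_ge2) ?(ltnW r2_ge2)//.
rewrite ler_ln ?posrE ?exprn_gt0 ?ltr0n ?(ltnW r1_ge2) ?(ltnW r2_ge2)//.
by rewrite -!natrX ler_nat; exact: up_logP.
Qed.

Lemma ball_len_upper n : (g n)%:R * ln r1%:R <= n%:R * ln r2%:R + ln r1%:R :> R.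
Proof.
case: n => [|n].
  by rewrite /ball_len expn0 up_log1 !mul0r add0r ltW// ln_r1_gt0.
have r2n : (1 < r2 ^ n.+1)%N by rewrite -(exp1n n.+1) ltn_exp2r.
have := up_log_gtn r1_ge2 r2n.
have : (0 < g n.+1)%N by rewrite up_log_gt0 r1_ge2.
rewrite -/(ball_len n.+1); case: (g n.+1) => // k _ /= /ltnW h.
rewrite -[k.+1%:R]natr1 mulrDl mul1r lerD2r !mulr_natl -!lnXn ?ltr0n ?(ltnW r1_ge2) ?(ltnW r2_ge2)//.
rewrite ler_ln ?posrE ?exprn_gt0 ?ltr0n ?(ltnW r1_ge2) ?(ltnW r2_ge2)//.
by rewrite -!natrX ler_nat.
Qed.

Lemma pair_dist_le n (z z' : nat -> A1 * A2) :
  (@pair_dist R r1 r2 z z' <= r2%:R ^- n) =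
  (mkseq (fst \o z) (g n) == mkseq (fst \o z') (g n)) &&
  (mkseq (snd \o z) n == mkseq (snd \o z') n).
Proof.
have r2n : (0 < r2 ^ n)%N by rewrite expn_gt0 ltnW.
by rewrite ge_max -natrX !word_dist_le// up_expnK.
Qed.

(** Membership in a ball is decided by the prefix of length g(n), the longer of the two, so the mass
    of a ball is a finite sum of [psi] over words of that length. *)
Definition in_ball n (z : nat -> A1 * A2) (w : seq (A1 * A2)) :=
  (map fst w == mkseq (fst \o z) (g n)) && (take n (map snd w) == mkseq (snd \o z) n).

Lemma map_mkseq (T U : Type) (h : T -> U) (z : nat -> T) n :
  map h (mkseq z n) = mkseq (h \o z) n.
Proof. by rewrite /mkseq -map_comp. Qed.

Lemma cballE n z : @cball R r1 r2 n z = [set z' | in_ball n z (mkseq z' (g n))].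
Proof.
apply/seteqP; split => z'; rewrite /cball/= pair_dist_le /in_ball !map_mkseq;
  by rewrite take_mkseq ?ball_len_ge// eq_sym [in X in _ && X]eq_sym.
Qed.

Lemma sum_words_fst (A B : finType) (f : seq (A * B) -> R) t m : size t = m ->
  \sum_(x <- words (A * B)%type m | map fst x == t) f x = fiber_sum f t.
Proof.
move=> st; rewrite big_mkcond sum_words_pair (bigD1_seq t) ?uniq_words ?mem_words ?st//=.
rewrite [X in _ + X]big1_seq ?addr0.
  rewrite /fiber_sum st big_seq [RHS]big_seq; apply: eq_bigr => v.
  by rewrite mem_words => /eqP sv; rewrite map_fst_zip ?st// eqxx.
move=> u /andP[ut]; rewrite mem_words => /eqP su; rewrite big_seq big1// => v.
by rewrite mem_words => /eqP sv; rewrite map_fst_zip ?su// (negbTE ut).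
Qed.

Variables (psi : seq (A1 * A2) -> R) (c : R).
Hypothesis psi_qm : qm c psi.
Local Notation I := (fiber_sum psi).

Definition ball_mass n z := \sum_(w <- words (A1 * A2)%type (g n) | in_ball n z w) psi w.

Lemma ball_massE n z : ball_mass n z =
  \sum_(x <- words (A1 * A2)%type (g n - n) | map fst x == drop n (mkseq (fst \o z) (g n)))
    psi (mkseq z n ++ x).
Proof.
have gn := ball_len_ge n.
rewrite /ball_mass -{1}(subnKC gn) big_mkcond sum_wordsD.
rewrite (bigD1_seq (mkseq z n)) ?uniq_words ?mem_words ?size_mkseq//=.
rewrite [X in _ + X]big1_seq ?addr0 => [|u /andP[uz]].
  rewrite [RHS]big_mkcond; apply: eq_bigr => x _; congr (if _ then _ else _).
  rewrite /in_ball !map_cat take_size_cat ?size_map ?size_iota// !map_mkseq ?eqxx ?andbT.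
  rewrite -{1}(cat_take_drop n (mkseq (fst \o z) (g n))) take_mkseq//.
  by rewrite eqseq_cat ?size_mkseq// eqxx.
rewrite mem_words => /eqP su; rewrite big1// => x _; case: ifPn => // /andP[/eqP e1 /eqP e2].
case/eqP: uz; rewrite -(zip_fst_snd u) -(zip_fst_snd (mkseq z n)) !map_mkseq; congr zip.
  have := congr1 (take n) e1; rewrite take_mkseq// => <-.
  by rewrite map_cat take_size_cat// size_map.
by rewrite -e2 map_cat take_size_cat// size_map.
Qed.

(** In the last [g n - n] letters the first coordinate is a prescribed word [t] and the second is
    free: the mass is comparable to [psi (mkseq z n) * I t], and [I t] to the quotient of [I] at the
    two prefixes that [t] separates. *)
Lemma ball_mass_ln n z : supp psi z ->
  0 < ball_mass n z /\ `|ln (ball_mass n z) - (ln (psi (mkseq z n)) + ln (I (mkseq (fst \o z) (g n)))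
     - ln (I (mkseq (fst \o z) n)))| <= 2 * c.
Proof.
move=> sz; have gn := ball_len_ge n; have [psi0 psim] := psi_qm.
have psin : 0 < psi (mkseq z n) by exact: sz.
have Igt k : 0 < I (mkseq (fst \o z) k).
  by rewrite -map_mkseq; apply: lt_le_trans (sz k) (fiber_sum_ge _ psi0).
set t := drop n (mkseq (fst \o z) (g n)).
have st : size t = (g n - n)%N by rewrite size_drop size_mkseq.
have [_ Im] := qm_fiber_sum psi_qm.
have tE : mkseq (fst \o z) n ++ t = mkseq (fst \o z) (g n).
  by rewrite -[RHS](cat_take_drop n) take_mkseq.
have c1 : cmp (expR c) (psi (mkseq z n) * I t) (ball_mass n z).
  rewrite ball_massE -/t -(sum_words_fst _ st) mulr_sumr.
  by rewrite big_mkcond [in X in cmp _ _ X]big_mkcond; apply: cmp_sum => x _; case: ifP => //; rewrite /cmp mulr0.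
have c2 := Im (mkseq (fst \o z) n) t; rewrite tE in c2.
have It : 0 < I t.
  have := Igt (g n); rewrite -tE (qm_gt0 _ _ (qm_fiber_sum psi_qm)) => /andP[] //.
have b0 : 0 < ball_mass n z.
  rewrite -(cmp_gt0 _ _ c1) ?mulr_gt0 ?mulr_ge0 ?(ltW It)//.
  by apply: sumr_ge0.
split; first exact: b0.
move/cmp_ln : c1 => /(_ (mulr_gt0 psin It) b0).
move/cmp_ln : c2 => /(_ (mulr_gt0 (Igt n) It) (Igt (g n))).
rewrite !lnM ?posrE// !ler_norml => /andP[? ?] /andP[? ?].
by apply/andP; split; lra.
Qed.

End Balls.

(** * Upper bound *)

(* Otherwise Y(n)/n would drop by e/2 at each step of the orbit n, g(n), g(g(n)), ... *)
Lemma frequent_no_drop (R : realType) (s M : R) (g : nat -> nat) (Y : nat -> R) :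
  0 < s <= 1 -> (forall n, n%:R <= s * (g n)%:R <= n%:R + 1) ->
  (forall n, (0 < n)%N -> `|Y n| <= M * n%:R) ->
  forall e N, 0 < e -> exists2 n, (N <= n)%N & - (e * n%:R) <= s * Y (g n) - Y n.
Proof.
move=> /andP[s0 s1] hg hY e N0 e0.
pose N := maxn N0 (Num.trunc (2 * `|M| / e)).+1.
have NN0 : (N0 <= N)%N by exact: leq_maxl.
have Npos : (0 < N)%N by rewrite /N leq_max orbT.
have NM : `|M| <= e / 2 * N%:R.
  have : 2 * `|M| / e < N%:R.
    by apply: (lt_le_trans (truncnS_gt _)); rewrite ler_nat leq_maxr.
  rewrite ltr_pdivrMr//; lra.
have [h|h] := pselect (exists2 n, (N <= n)%N & - (e * n%:R) <= s * Y (g n) - Y n).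
  by case: h => n Nn hn; exists n => //; exact: leq_trans Nn.
have {}h n : (N <= n)%N -> s * Y (g n) - Y n < - (e * n%:R).
  by move=> Nn; rewrite ltNge; apply/negP => hn; apply: h; exists n.
have gge n : (n <= g n)%N.
  have /andP[h1 _] := hg n; rewrite -(ler_nat R); apply: (le_trans h1).
  by rewrite ler_piMl.
have step n : (N <= n)%N -> Y (g n) / (g n)%:R <= Y n / n%:R - e / 2.
  move=> Nn; have n0 : (0 < n)%N by exact: leq_trans Nn.
  have nR : 0 < n%:R :> R by rewrite ltr0n.
  have gn0 : (0 < g n)%N by exact: leq_trans (gge n).
  have gR : 0 < (g n)%:R :> R by rewrite ltr0n.
  set y := Y (g n) / (g n)%:R.
  have Yg : Y (g n) = y * (g n)%:R by rewrite /y divfK// gt_eqF.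
  have ym : `|y| <= `|M|.
    rewrite normrM normfV (gtr0_norm gR) ler_pdivrMr//.
    by apply: (le_trans (hY _ gn0)); rewrite ler_wpM2r// ler_norm.
  have := h n Nn; rewrite Yg => h1.
  have /andP[g1 g2] := hg n.
  (* Replacing [s * (g n)] by [n] costs at most [|M|], hence at most half of the assumed drop
     [e * n]. *)
  have h2 : - `|M| <= y * (s * (g n)%:R - n%:R).
    have : `|y * (s * (g n)%:R - n%:R)| <= `|M| * 1.
      rewrite normrM; apply: ler_pM => //; rewrite ger0_norm; lra.
    by rewrite ler_norml mulr1 => /andP[].
  have nM : `|M| <= e / 2 * n%:R.
    by apply: (le_trans NM); rewrite ler_wpM2l ?divr_ge0 ?(ltW e0)// ler_nat.
  rewrite -(ler_pM2r nR) mulrBl divfK ?gt_eqF//; lra.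
have iter_ge k : (N <= iter k g N)%N.
  by elim: k => //= k IH; exact: leq_trans (gge _).
have iter_le k : Y (iter k g N) / (iter k g N)%:R <= Y N / N%:R - k%:R * (e / 2).
  elim: k => [|k IH]; first by rewrite mul0r subr0.
  rewrite iterS; apply: (le_trans (step _ (iter_ge k))).
  by rewrite -[k.+1%:R]natr1 mulrDl mul1r opprD addrA lerD2r.
have bnd n : (N <= n)%N -> `|Y n / n%:R| <= `|M|.
  move=> Nn; have n0 : (0 < n)%N by exact: leq_trans Nn.
  have nR : 0 < n%:R :> R by rewrite ltr0n.
  rewrite normrM normfV (gtr0_norm nR) ler_pdivrMr//.
  by apply: (le_trans (hY _ n0)); rewrite ler_wpM2r// ler_norm.
exfalso; pose k := (Num.trunc (2 * `|M| / (e / 2))).+1.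
have : 2 * `|M| / (e / 2) < k%:R by exact: truncnS_gt.
rewrite ltr_pdivrMr ?divr_gt0// => hk.
have := iter_le k; have := bnd _ (iter_ge k); have := bnd N (leqnn N).
rewrite !ler_norml => /andP[_ ?] /andP[? _]; lra.
Qed.

Section Weights.
Context {R : realType} (r1 r2 : nat).
Hypothesis r1_ge2 : (2 <= r1)%N.
Hypothesis r1_le_r2 : (r1 <= r2)%N.
Local Notation A1 := (letters r1).
Local Notation A2 := (letters r2).
Variables (psi : seq (A1 * A2) -> R) (c : R).
Hypothesis psi_qm : qm c psi.
Hypothesis psi_sum1 : forall n, \sum_(w <- words (A1 * A2)%type n) psi w = 1.

Definition log_ratio : R := ln r1%:R / ln r2%:R.
Local Notation s := log_ratio.
Local Notation g := (ball_len r1 r2).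
Local Notation P := (tilt_pressure psi s).
Local Notation I := (fiber_pow psi).
Local Notation Phi := (tilt_base psi s).

Let l1 : 0 < ln r1%:R :> R. Proof. exact: ln_r1_gt0. Qed.
Let l2 : 0 < ln r2%:R :> R. Proof. exact: ln_r2_gt0 r1_le_r2. Qed.

Lemma log_ratio01 : 0 < s <= 1.
Proof. by rewrite divr_gt0//= ler_pdivrMr// mul1r ln_r1_le. Qed.

Lemma log_ratio_ball_len n : n%:R <= s * (g n)%:R <= n%:R + 1.
Proof.
have h1 : n%:R * ln r2%:R <= (g n)%:R * ln r1%:R :> R by exact: ball_len_lower.
have h2 : (g n)%:R * ln r1%:R <= n%:R * ln r2%:R + ln r1%:R :> R by exact: ball_len_upper.
have h3 : ln r1%:R <= ln r2%:R :> R by exact: ln_r1_le.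
by rewrite /log_ratio mulrAC ler_pdivlMr// ler_pdivrMr//; apply/andP; split; lra.
Qed.

(** The conditional factor sums to at most 1 over [w2] and leaves the normalised [tilt_base] of
    [w1]: the balls of one scale have bounded total weight. *)
Definition ball_weight q n (w1 : seq A1) (w2 : seq A2) : R :=
  zpow (psi (zip (take n w1) w2)) q / I q (take n w1) * Phi q w1 * expR (- ((g n)%:R * P q)).

Lemma ball_weight_ge0 q n w1 w2 : 0 <= ball_weight q n w1 w2.
Proof.
by rewrite !mulr_ge0 ?expR_ge0 ?zpow_ge0 ?tilt_base_ge0// invr_ge0 fiber_pow_ge0.
Qed.

Lemma sum_ball_weight q n :
  \sum_(w1 <- words A1 (g n)) \sum_(w2 <- words A2 n) ball_weight q n w1 w2 <= expR (`|q| * c).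
Proof.
have := tilt_part_le psi_qm psi_sum1 log_ratio01 q (g n).
rewrite addrC expRD -ler_pdivrMr ?expR_gt0// -expRN; apply: le_trans.
rewrite /tilt_part mulr_suml big_seq [leRHS]big_seq; apply: ler_sum => u.
rewrite mem_words => /eqP su; rewrite /ball_weight -mulr_suml.
rewrite ler_wpM2r ?expR_ge0// -mulr_suml -[leRHS]mul1r ler_wpM2r ?tilt_base_ge0//.
rewrite -mulr_suml.
have st : size (take n u) = n by rewrite size_take_min su; apply/minn_idPl; exact: ball_len_ge.
have -> : \sum_(v <- words A2 n) zpow (psi (zip (take n u) v)) q = I q (take n u).
  by rewrite fiber_powE st.
by have [->|h] := eqVneq (I q (take n u)) 0; rewrite ?mul0r// divff.
Qed.

Lemma ball_weight_le q n w1 w2 : size w1 = g n -> size w2 = n ->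
  ball_weight q n w1 w2 <= expR (`|q| * c).
Proof.
move=> s1 s2; apply: le_trans (sum_ball_weight q n).
rewrite (bigD1_seq w1) ?uniq_words ?mem_words ?s1//=.
rewrite (bigD1_seq w2) ?uniq_words ?mem_words ?s2//= -addrA lerDl addr_ge0// sumr_ge0//.
  by move=> v _; exact: ball_weight_ge0.
by move=> u _; rewrite sumr_ge0// => v _; exact: ball_weight_ge0.
Qed.

Definition ball_level (alpha : R) : set (nat -> A1 * A2) :=
  [set z | supp psi z /\
    (fun n : nat => ln (ball_mass psi n z) / ln r2%:R / - n%:R) @ \oo --> alpha].

Lemma ball_level_near alpha z e : ball_level alpha z -> 0 < e ->
  exists N, forall n, (N <= n)%N -> `|ln (ball_mass psi n z) + alpha * n%:R * ln r2%:R| <= e * n%:R.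
Proof.
move=> [_ /cvgrPdist_le h] e0; have := h (e / ln r2%:R) (divr_gt0 e0 l2).
move=> [N _ hN]; exists (maxn N 1); move=> n; rewrite geq_max => /andP[Nn n0].
have nR : 0 < n%:R :> R by rewrite ltr0n.
have := hN n Nn; rewrite /= -(ler_pM2r (mulr_gt0 nR l2)).
rewrite -[X in _ * X <= _ -> _]gtr0_norm ?mulr_gt0// -normrM.
rewrite (_ : (alpha - _) * _ = ln (ball_mass psi n z) + alpha * n%:R * ln r2%:R); last first.
  by field; rewrite !gt_eqF.
by rewrite (_ : e / _ * _ = e * n%:R)//; field; rewrite gt_eqF.
Qed.

(** With [Y n = V n - q * U n], the logarithm of the weight is [q] times that of the ball mass, plus
    [s * Y (g n) - Y n], minus [(g n) * P q], up to a bounded error. The level set fixes the first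
    term and [frequent_no_drop] handles the second. *)
Lemma frequent_ball_weight q alpha z e N : ball_level alpha z -> 0 < e ->
  exists2 n, (N <= n)%N &
    expR (- (n%:R * ((alpha * q + P q / ln r1%:R) * ln r2%:R + e))) <=
    ball_weight q n (mkseq (fst \o z) (g n)) (mkseq (snd \o z) n).
Proof.
move=> lz e0; have sz : supp psi z by case: lz.
have Igt p k : 0 < I p (mkseq (fst \o z) k).
  by rewrite -map_mkseq; apply: fiber_pow_gt0; exact: sz.
pose e1 := e / 3 / (`|q| + 1).
have q1 : 0 < `|q| + 1 by rewrite ltr_wpDl.
have e10 : 0 < e1 by rewrite !divr_gt0.
have qe1 : `|q| * e1 <= e / 3.
  have : (`|q| + 1) * e1 = e / 3 by rewrite /e1 mulrC divfK// gt_eqF.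
  by lra.
have [N1 hN1] := ball_level_near lz e10.
pose U n := ln (I 1 (mkseq (fst \o z) n)).
pose V n := ln (I q (mkseq (fst \o z) n)).
pose L n := ln (psi (mkseq z n)).
have [M1 M10 hU] := qm_ln_bound (fiber_pow_qm psi_qm 1).
have [M2 M20 hV] := qm_ln_bound (fiber_pow_qm psi_qm q).
pose M := M2 + `|q| * c + `|q| * (M1 + c).
have c0 : 0 <= c by exact: qm_const_ge0 psi_qm psi_sum1.
have hY n : (0 < n)%N -> `|V n - q * U n| <= M * n%:R.
  move=> n0; apply: (le_trans (ler_normB _ _)); rewrite normrM.
  have := hU _ (Igt 1 n); have := hV _ (Igt q n); rewrite !size_mkseq normr1 mul1r -/(U n) -/(V n).
  move=> h1 h2; have := ler_wpM2l (normr_ge0 q) h2.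
  have n1 : 1 <= n%:R :> R by rewrite ler1n.
  have := ler_wpM2l c0 n1; have := ler_wpM2l (mulr_ge0 (normr_ge0 q) c0) n1.
  rewrite /M; lra.
pose C := `|q| * (2 * c) + `|P q|.
pose N2 := (Num.trunc (`|C| / (e / 3))).+1.
have e30 : 0 < e / 3 by rewrite divr_gt0.
have [n] := frequent_no_drop log_ratio01 log_ratio_ball_len hY (maxn (maxn N N1) N2) e30.
rewrite !geq_max => /andP[/andP[Nn N1n] N2n] hn; exists n => //.
have Cn : `|C| <= e / 3 * n%:R.
  rewrite mulrC -ler_pdivrMr//; apply/ltW/(lt_le_trans (truncnS_gt _)).
  by rewrite ler_nat.
have tk : take n (mkseq (fst \o z) (g n)) = mkseq (fst \o z) n.
  by rewrite take_mkseq// ball_len_ge.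
have zipE : zip (mkseq (fst \o z) n) (mkseq (snd \o z) n) = mkseq z n.
  by rewrite -!map_mkseq zip_fst_snd.
have pz : 0 < psi (mkseq z n) by exact: sz.
rewrite /ball_weight tk zipE /tilt_base.
have VE : I q (mkseq (fst \o z) n) = expR (V n) by rewrite lnK ?posrE.
rewrite !zpow_expR// VE -expRN -!expRD ler_expR.
rewrite -/(L n) -/(U (g n)) -/(V n) -/(V (g n)).
have [_ ] := ball_mass_ln r1_ge2 r1_le_r2 psi_qm n sz.
rewrite -!(@fiber_pow1E _ _ _ psi c)// -/(L n) -/(U (g n)) -/(U n).
have := hN1 n N1n.
set S := ln (ball_mass psi n z) => hS1 hS2.
have k1 : `|q * (S + alpha * n%:R * ln r2%:R)| <= e / 3 * n%:R.
  rewrite normrM; apply: (le_trans (ler_wpM2l (normr_ge0 q) hS1)).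
  by rewrite mulrA ler_wpM2r.
have k2 : `|q * (S - (L n + U (g n) - U n))| <= `|q| * (2 * c).
  by rewrite normrM ler_wpM2l.
(* Rounding in g(n) makes [(g n) * ln r1] exceed [n * ln r2] by at most [ln r1]. *)
have k3 : (g n)%:R * P q - n%:R * (P q / ln r1%:R * ln r2%:R) <= `|P q|.
  have -> : (g n)%:R * P q - n%:R * (P q / ln r1%:R * ln r2%:R) =
      P q * (((g n)%:R * ln r1%:R - n%:R * ln r2%:R) / ln r1%:R).
    by field; rewrite gt_eqF.
  apply: (le_trans (ler_norm _)); rewrite normrM ler_piMr// ger0_norm.
    by rewrite ler_pdivrMr// mul1r; have := @ball_len_upper R r1 r2 r1_ge2 r1_le_r2 n; lra.
  by rewrite divr_ge0 ?(ltW l1)// subr_ge0; exact: ball_len_lower.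
have := ler_norm C.
move: k1 k2 hn Cn; rewrite !ler_norml /C => /andP[? ?] /andP[? ?] ? ?.
lra.
Qed.

End Weights.

(** * Null Hausdorff measure from covers of geometric cost *)

Section HausdorffUpper.
Context {R : realType} {T : Type} (d : T -> T -> R).
Hypothesis d_ge0 : forall x y, 0 <= d x y.

Lemma gauge_ge0 t U : (0 <= gauge d t U)%E.
Proof. by rewrite /gauge; case: ifP => // _; exact: poweR_ge0. Qed.

Lemma diam_le U (b : R) : (forall x y, U x -> U y -> d x y <= b) -> (diam d U <= b%:E)%E.
Proof. by move=> h; apply: ge_ereal_sup => _ [x Ux [y Uy <-]]; rewrite lee_fin; exact: h. Qed.

Lemma diam_ge U x y : U x -> U y -> ((d x y)%:E <= diam d U)%E.
Proof. by move=> Ux Uy; apply: ereal_sup_ubound; exists x => //; exists y. Qed.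

Lemma gauge_le t U (b : R) : 0 <= t -> 0 <= b ->
  (forall x y, U x -> U y -> d x y <= b) -> (gauge d t U <= (b `^ t)%:E)%E.
Proof.
move=> t0 b0 h; rewrite /gauge; case: ifPn => [_|/set0P[x Ux]]; first by rewrite lee_fin powR_ge0.
have D0 : (0 <= diam d U)%E.
  by apply: le_trans (diam_ge Ux Ux); rewrite lee_fin.
have := diam_le h; move: D0; case: (diam d U) => [r| |]//=; rewrite !lee_fin => r0 rb.
by rewrite ge0_ler_powR.
Qed.

Lemma ge0_nneseries_le (u : nat -> \bar R) (B : \bar R) : (forall i, (0 <= u i)%E) ->
  (forall m, (\sum_(0 <= i < m) u i <= B)%E) -> (\sum_(0 <= i <oo) u i <= B)%E.
Proof.
move=> u0 h; apply: lime_le; first by apply: is_cvg_nneseries.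
by apply: nearW => m; exact: h.
Qed.

Definition enum_pairs (V : nat -> nat -> set T) (i : nat) : set T :=
  if pickle_inv i is Some (n, k) then V n k else set0.

(** A partial sum of the enumerated family involves pairs from some square [M] by [M], where
    summation by rows applies. *)
Lemma sum_enum_pairs (f : set T -> \bar R) (V : nat -> nat -> set T) (b : nat -> R) (B : R) :
  (forall U, (0 <= f U)%E) -> f set0 = 0%E ->
  (forall n M, (\sum_(k < M) f (V n k) <= (b n)%:E)%E) ->
  (forall M, \sum_(n < M) b n <= B) ->
  (\sum_(0 <= i <oo) f (enum_pairs V i) <= B%:E)%E.
Proof.
move=> f0 fs0 hb hB; apply: ge0_nneseries_le => // m.
have [M hM] : exists M, forall i, (i < m)%N -> forall n k,
    pickle_inv i = Some (n, k) -> (n < M)%N /\ (k < M)%N.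
  elim: m => [|m [M IH]]; first by exists 0%N.
  case e: (@pickle_inv (nat * nat)%type m) => [[n k]|].
    exists (maxn M (maxn n.+1 k.+1)) => i; rewrite ltnS leq_eqVlt => /predU1P[->|im] n' k'.
      by rewrite e => -[<- <-]; rewrite !leq_max !ltnSn !orbT.
    by move=> /(IH i im)[h1 h2]; rewrite !leq_max h1 h2.
  exists M => i; rewrite ltnS leq_eqVlt => /predU1P[->|im] n' k'; first by rewrite e.
  exact: IH.
apply: (@le_trans _ _ (\sum_(n < M) \sum_(k < M) f (V n k))%E); last first.
  apply: (@le_trans _ _ (\sum_(n < M) (b n)%:E)%E); first by apply: lee_sum => n _; exact: hb.
  by rewrite sumEFin lee_fin.
rewrite big_mkord.
apply: (@le_trans _ _ (\sum_(i < m) \sum_(n < M) \sum_(k < M)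
    if pickle (nat_of_ord n, nat_of_ord k) == i then f (V n k) else 0)%E).
  apply: lee_sum => i _; rewrite /enum_pairs.
  case e: (pickle_inv (nat_of_ord i)) => [[n k]|]; last first.
    rewrite fs0; apply: sume_ge0 => n _; apply: sume_ge0 => k _; by case: ifP.
  have [nM kM] := hM i (ltn_ord i) n k e.
  have pe : pickle (n, k) = i by have := @pickle_invK (nat * nat)%type i; rewrite e.
  rewrite (bigD1 (Ordinal nM))//= (bigD1 (Ordinal kM))//= pe eqxx -addeA.
  apply: leeDl; apply: adde_ge0; apply: sume_ge0 => n' _; first by case: ifP.
  by apply: sume_ge0 => k' _; case: ifP.
rewrite exchange_big/=; apply: lee_sum => n _.
rewrite exchange_big/=; apply: lee_sum => k _.
rewrite -big_mkcond/=; set p := pickle _.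
have [pm|mp] := ltnP p m.
  by rewrite (big_pred1 (Ordinal pm))// => i; rewrite -val_eqE/= eq_sym.
rewrite big_pred0 ?f0// => i; apply/eqP => pi.
by move: mp; rewrite pi leqNgt ltn_ord.
Qed.

Lemma hausdorff_premeasure_ge0 t e E : (0 <= hausdorff_premeasure d t e E)%E.
Proof.
apply: le_ereal_inf_tmp => _ [U _ <-]; apply: nneseries_ge0 => i _ _; exact: gauge_ge0.
Qed.

(** For every [N] the sets [V n k] with [n >= N] cover [E], at a cost bounded by the tail of a
    geometric series. *)
Lemma hausdorff_measure_eq0 (E : set T) t (V : nat -> nat -> set T) (K rho : R) (rad : nat -> R) :
  0 < t -> 0 <= K -> 0 <= rho < 1 ->
  (forall n k x y, V n k x -> V n k y -> d x y <= rad n) ->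
  (forall n M, (\sum_(k < M) gauge d t (V n k) <= (K * rho ^+ n)%:E)%E) ->
  (forall e, 0 < e -> exists N, forall n, (N <= n)%N -> rad n <= e) ->
  (forall x, E x -> forall N, exists n k, (N <= n)%N /\ V n k x) ->
  hausdorff_measure d t E = 0%E.
Proof.
move=> t0 K0 /andP[rho0 rho1] hrad hsum hrad0 hE.
have rho1' : 0 < 1 - rho by rewrite subr_gt0.
have pre0 e : 0 < e -> hausdorff_premeasure d t e E = 0%E.
  move=> e0; apply/eqP; rewrite eq_le hausdorff_premeasure_ge0 andbT.
  apply/lee_addgt0Pr => eta eta0; rewrite add0e.
  have [N1 hN1] := hrad0 e e0.
  have : (K / (1 - rho)) * rho ^+ n @[n --> \oo] --> (K / (1 - rho)) * 0.
    by apply: cvgMr; apply: cvg_expr; rewrite ger0_norm.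
  rewrite mulr0 => /cvgrPdist_le /(_ eta eta0)[N2 _ hN2].
  pose N := maxn N1 N2.
  pose W n k := if (N <= n)%N then V n k else set0.
  apply: (@le_trans _ _ (\sum_(0 <= i <oo) gauge d t (enum_pairs W i))%E).
    apply: ereal_inf_lbound; exists (enum_pairs W) => //; split.
      move=> x /hE/(_ N)[n [k [Nn Vx]]]; exists (pickle (n, k)) => //.
      by rewrite /enum_pairs pickleK_inv /W Nn.
    move=> i; apply: diam_le => x y; rewrite /enum_pairs.
    case: (pickle_inv i) => [[n k]|//]; rewrite /W; case: ifP => // Nn Vx Vy.
    by apply: (le_trans (hrad _ _ _ _ Vx Vy)); apply: hN1; exact: leq_trans (leq_maxl _ _) Nn.
  apply: (@sum_enum_pairs _ _ (fun n => if (N <= n)%N then K * rho ^+ n else 0)).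
  - exact: gauge_ge0.
  - by rewrite /gauge eqxx.
  - move=> n M; rewrite /W; case: ifP => _; first exact: hsum.
    by rewrite big1// => k _; rewrite /gauge eqxx.
  move=> M; apply: (@le_trans _ _ (K / (1 - rho) * rho ^+ N)); last first.
    have := hN2 N (leq_maxr _ _); rewrite /= sub0r normrN; apply: le_trans; exact: ler_norm.
  suff : (1 - rho) * \sum_(n < M) (if (N <= n)%N then K * rho ^+ n else 0) <=
      K * rho ^+ N - K * rho ^+ (maxn N M).
    have : 0 <= K * rho ^+ maxn N M by rewrite mulr_ge0// exprn_ge0.
    by rewrite mulrAC ler_pdivlMr// mulrC; lra.
  elim: M => [|M IH]; first by rewrite big_ord0 maxn0 mulr0 subrr.
  rewrite big_ord_recr/= mulrDr; case: ifPn => NM.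
    have -> : maxn N M.+1 = M.+1 by apply/maxn_idPr; exact: leqW.
    move: IH; have -> : maxn N M = M by apply/maxn_idPr.
    by rewrite exprS => IH; lra.
  rewrite -ltnNge in NM; have -> : maxn N M.+1 = N by apply/maxn_idPl.
  move: IH; have -> : maxn N M = N by apply/maxn_idPl/ltnW.
  by rewrite mulr0 addr0.
apply/eqP; rewrite eq_le; apply/andP; split.
  by apply: ge_ereal_sup => _ [e /= e0 <-]; rewrite pre0.
by apply: ereal_sup_ubound; exists 1 => //=; exact: pre0.
Qed.

End HausdorffUpper.

(** * Upper bounds for the level sets *)

Section LevelUpper.
Context {R : realType} (r1 r2 : nat).
Hypothesis r1_ge2 : (2 <= r1)%N.
Hypothesis r1_le_r2 : (r1 <= r2)%N.
Local Notation A1 := (letters r1).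
Local Notation A2 := (letters r2).
Variables (psi : seq (A1 * A2) -> R) (c : R).
Hypothesis psi_qm : qm c psi.
Hypothesis psi_sum1 : forall n, \sum_(w <- words (A1 * A2)%type n) psi w = 1.

Local Notation s := (@log_ratio R r1 r2).
Local Notation g := (ball_len r1 r2).
Local Notation P := (tilt_pressure psi s).
Local Notation wt := (ball_weight psi).
Local Notation L := (ln r2%:R : R).

Let l2 : 0 < L. Proof. exact: ln_r2_gt0 r1_le_r2. Qed.

(** The weights along a point of the level set would grow exponentially at infinitely many scales,
    against the uniform bound [ball_weight_le]. *)
Lemma ball_level_empty alpha q : alpha * q + P q / ln r1%:R < 0 -> ball_level psi alpha = set0.
Proof.
move=> neg; rewrite -subset0 => z lz.
set x := alpha * q + P q / ln r1%:R in neg.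
pose e := - x * L / 2.
have e0 : 0 < e by rewrite divr_gt0// mulr_gt0// oppr_gt0.
pose N := (Num.trunc (`|q| * c / e)).+1.
have [n Nn] := frequent_ball_weight r1_ge2 r1_le_r2 psi_qm psi_sum1 q N lz e0.
have := ball_weight_le r1_ge2 r1_le_r2 psi_qm psi_sum1 q (size_mkseq (fst \o z) (g n)) (size_mkseq (snd \o z) n).
move=> h1 /le_trans /(_ h1); rewrite ler_expR -/x.
have : `|q| * c / e < n%:R.
  by apply: (lt_le_trans (truncnS_gt _)); rewrite ler_nat.
rewrite ltr_pdivrMr// /e; lra.
Qed.

Definition ball_set n (p : seq A1 * seq A2) : set (nat -> A1 * A2) :=
  [set z : nat -> A1 * A2 | mkseq (fst \o z) (g n) = p.1 /\ mkseq (snd \o z) n = p.2].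

Definition heavy_balls q t n : seq (seq A1 * seq A2) :=
  [seq p <- [seq (u, v) | u <- words A1 (g n), v <- words A2 n] |
    expR (- (n%:R * (t * L))) <= wt q n p.1 p.2].

(** Markov's inequality for the bounded total weight of a scale. *)
Lemma size_heavy_balls q t n :
  (size (heavy_balls q t n))%:R * expR (- (n%:R * (t * L))) <= expR (`|q| * c).
Proof.
apply: le_trans (sum_ball_weight r1_ge2 r1_le_r2 psi_qm psi_sum1 q n).
have -> : \sum_(u <- words A1 (g n)) \sum_(v <- words A2 n) wt q n u v =
    \sum_(p <- [seq (u, v) | u <- words A1 (g n), v <- words A2 n]) wt q n p.1 p.2.
  by rewrite big_allpairs.
rewrite [leRHS](bigID (fun p => expR (- (n%:R * (t * L))) <= wt q n p.1 p.2))/=.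
apply: ler_wpDr; first by apply: sumr_ge0 => p _; exact: ball_weight_ge0.
rewrite -big_filter -/(heavy_balls q t n) mulr_natl -sum1_size -sumrMnr.
rewrite big_seq [leRHS]big_seq; apply: ler_sum => p.
by rewrite mem_filter mulr1n => /andP[].
Qed.

Lemma sum_const_lt (b : R) sz M :
  \sum_(k < M) (if (k < sz)%N then b else 0) = (minn M sz)%:R * b.
Proof.
elim: M => [|M IH]; first by rewrite big_ord0 min0n mul0r.
rewrite big_ord_recr/= IH; case: ltnP => h.
  by rewrite (minn_idPl h) -[M.+1%:R]natr1 mulrDl mul1r.
by rewrite (minn_idPr (leqW h)) addr0.
Qed.

Lemma pair_dist_ge0 (z z' : nat -> A1 * A2) : 0 <= @pair_dist R r1 r2 z z'.
Proof.
rewrite le_max /word_dist; case: pselect => [e|_]; last by rewrite lexx.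
by rewrite invr_ge0 exprn_ge0.
Qed.

Lemma hausdorff_measure_level alpha q t : alpha * q + P q / ln r1%:R < t -> 0 < t ->
  hausdorff_measure (@pair_dist R r1 r2) t (ball_level psi alpha) = 0%E.
Proof.
set x := alpha * q + _ => xt t0.
(* As [x < t'], heavy balls for [t'] catch every point of the level set at infinitely many scales;
   as [t' < t], their number times [r2 ^ (- n t)] decays geometrically. *)
pose t' := (x + t) / 2.
pose V n k := nth set0 [seq ball_set n p | p <- heavy_balls q t' n] k.
have r2R : 0 < r2%:R :> R by rewrite ltr0n (leq_trans _ r1_le_r2)// ltnW.
apply: (@hausdorff_measure_eq0 _ _ _ _ t V (expR (`|q| * c))
  (expR (- ((t - t') * L))) (fun n => r2%:R ^- n)) => //.
- rewrite expR_ge0/= -[ltRHS]expR0 ltr_expR oppr_lt0 mulr_gt0// /t'; lra.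
- move=> n k z z'; rewrite /V.
  have [kn|kn] := ltnP k (size (heavy_balls q t' n)); last by rewrite nth_default ?size_map.
  rewrite (nth_map ([::], [::]))// => -[e1 e2] [e3 e4].
  by rewrite pair_dist_le// e1 e2 e3 e4 !eqxx.
- move=> n M; set sz := size (heavy_balls q t' n).
  have gV k : (gauge (@pair_dist R r1 r2) t (V n k) <=
      (if (k < sz)%N then expR (- (n%:R * (t * L))) else 0)%:E)%E.
    case: ifPn => kn; last by rewrite /V nth_default ?size_map 1?leqNgt// /gauge eqxx.
    have -> : expR (- (n%:R * (t * L))) = (r2%:R ^- n) `^ t.
      rewrite /powR gt_eqF ?invr_gt0 ?exprn_gt0// lnV ?posrE ?exprn_gt0// lnXn//.
      by congr expR; rewrite -mulr_natl; ring.
    apply: gauge_le; [exact: pair_dist_ge0|exact: ltW|by rewrite invr_ge0 exprn_ge0 ?ltW|].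
    move=> z z'; rewrite /V (nth_map ([::], [::]))// => -[e1 e2] [e3 e4].
    by rewrite pair_dist_le// e1 e2 e3 e4 !eqxx.
  apply: (le_trans (lee_sum _ (fun (k : 'I_M) _ => gV k))).
  rewrite sumEFin lee_fin sum_const_lt.
  apply: (@le_trans _ _ (sz%:R * expR (- (n%:R * (t * L))))).
    by rewrite ler_wpM2r ?expR_ge0// ler_nat geq_minr.
  have := size_heavy_balls q t' n; rewrite -/sz => h.
  have -> : expR (- (n%:R * (t * L))) =
      expR (- (n%:R * (t' * L))) * expR (- ((t - t') * L)) ^+ n.
    by rewrite -expRM_natr -expRD; congr expR; ring.
  by rewrite mulrA ler_wpM2r// exprn_ge0// expR_ge0.
- move=> e e0; pose N := (Num.trunc (e^-1)).+1; exists N => n Nn.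
  rewrite invf_ple ?posrE ?exprn_gt0//; apply: (@le_trans _ _ N%:R).
    exact/ltW/truncnS_gt.
  rewrite -natrX ler_nat; apply: (leq_trans Nn); apply: ltnW; apply: ltn_expl.
  exact: leq_trans r1_le_r2.
- move=> z lz N; have e0 : 0 < (t' - x) * L by rewrite mulr_gt0// /t'; lra.
  have [n Nn hn] := frequent_ball_weight r1_ge2 r1_le_r2 psi_qm psi_sum1 q N lz e0.
  have zin : (mkseq (fst \o z) (g n), mkseq (snd \o z) n) \in heavy_balls q t' n.
    rewrite mem_filter; apply/andP; split => /=.
      apply: le_trans hn; rewrite ler_expR -/x; lra.
    by apply/allpairsP; exists (mkseq (fst \o z) (g n), mkseq (snd \o z) n); rewrite /= !mem_words !size_mkseq.
  exists n, (index (mkseq (fst \o z) (g n), mkseq (snd \o z) n) (heavy_balls q t' n)); split => //.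
  by rewrite /V (nth_map ([::], [::])) ?index_mem// nth_index.
Qed.

End LevelUpper.

(** * Lower bound *)

Lemma is_derive_quadratic_perturbation (R : realType) (P : R -> R) (a b e u p : R) :
  is_derive u 1 P p -> is_derive u 1 (fun v => a * v + P v * b + e * v ^+ 2) (a + p * b + 2 * e * u).
Proof.
move=> dP.
have d1 : is_derive u 1 (a \*: @id R) (a *: 1) by exact: is_deriveZ.
have d2 : is_derive u 1 (b \*: P) (b *: p) by exact: is_deriveZ.
have d3 : is_derive u 1 (e \*: (@id R ^+ 2)) (e *: ((2%:R * u ^+ 1) *: 1)) by apply: is_deriveZ.
have d4 := is_deriveD (is_deriveD d1 d2) d3.
have -> : (fun v => a * v + P v * b + e * v ^+ 2) = (a \*: @id R) + (b \*: P) + (e \*: (@id R ^+ 2)).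
  by apply/funext => v; rewrite /GRing.add/= /GRing.scale/= (mulrC b).
apply: is_derive_eq.
rewrite /GRing.scale/=; ring.
Qed.

(** On the boundary of [[-M, M]] the penalised function exceeds its value at 0, so its minimum is
    interior and critical. Comparing the minimum with the value at 0 bounds [d * q ^ 2]. *)
Lemma penalized_minimizer (R : realType) (P : R -> R) (l alpha x : R) : 0 < l -> 0 <= x ->
  (forall q, derivable P q 1) -> (forall q, x <= alpha * q + P q / l) ->
  forall d, 0 < d -> exists2 q : R, is_derive q 1 P (- (l * (alpha + d * q))) & d / 2 * q ^+ 2 <= P 0 / l.
Proof.
move=> l0 x0 dP hx d d0.
pose h (u : R) := alpha * u + P u / l + d / 2 * u ^+ 2.
have f0 : 0 <= P 0 / l by have := hx 0; rewrite mulr0 add0r; exact: le_trans.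
(* Chosen so that [d / 2 * M = d / 2 + P 0 / l]. As [M >= 1], the penalty at [M] or [- M] alone
   exceeds the value at 0, the rest being at least [x >= 0]. *)
pose M := 1 + 2 * (P 0 / l) / d.
have M1 : 1 <= M by rewrite /M lerDl; apply: divr_ge0; [exact: mulr_ge0|exact: ltW].
have hM u : u ^+ 2 = M ^+ 2 -> h 0 < h u.
  move=> uM; rewrite /h uM mulr0 add0r expr0n/= mulr0 addr0.
  have h1 : M <= M ^+ 2 by rewrite expr2 ler_peMl// (le_trans _ M1).
  have h2 : d / 2 * M = d / 2 + P 0 / l by rewrite /M; field; rewrite !gt_eqF.
  have := hx u; have : d / 2 * M <= d / 2 * M ^+ 2 by rewrite ler_wpM2l// divr_ge0// ltW.
  have : 0 < d / 2 by rewrite divr_gt0.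
  lra.
have dh' (u p : R) : is_derive u 1 P p -> is_derive u 1 h (alpha + p / l + d * u).
  move=> dPu; have := is_derive_quadratic_perturbation alpha l^-1 (d / 2) dPu.
  by rewrite [2 * _]mulrC divfK.
have dh (u : R) : derivable h u 1.
  have dPu : is_derive u 1 P ('D_1 P u) by apply: DeriveDef => //; exact: dP.
  by have [] := dh' u _ dPu.
have Mge0 : 0 <= M by exact: le_trans M1.
have NMM : - M <= M by rewrite (le_trans _ Mge0)// oppr_le0.
have [q qM hq] := EVT_min NMM (derivable_within_continuous (fun u _ => dh u)).
have M0 : 0 \in `[- M, M]%R by rewrite in_itv/= oppr_le0 Mge0.
have hq0 := hq 0 M0.
have qin : q \in `]- M, M[%R.
  move: qM; rewrite !in_itv/= !le_eqVlt => /andP[/predU1P[e|->] /predU1P[e'|->]] //.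
  - by have := hM q; rewrite -e sqrrN => /(_ erefl); rewrite ltNge e hq0.
  - by have := hM q; rewrite -e sqrrN => /(_ erefl); rewrite ltNge e hq0.
  - by have := hM q; rewrite e' => /(_ erefl); rewrite ltNge -e' hq0.
have hmin t : t \in `]- M, M[%R -> h q <= h t.
  by move=> tM; apply: hq; move: tM; rewrite !in_itv/= => /andP[/ltW -> /ltW ->].
have D0 : is_derive q 1 h 0 := derive1_at_min NMM (fun u _ => dh u) qin hmin.
set p := 'D_1 P q.
have isP : is_derive q 1 P p by apply: DeriveDef => //; exact: dP.
have D1 := dh' q p isP.
have pe : alpha + p / l + d * q = 0.
  by have [_ <-] := D0; have [_ <-] := D1.
exists q.
  have -> : - (l * (alpha + d * q)) = p.
    have : l * (alpha + p / l + d * q) = 0 by rewrite pe mulr0.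
    rewrite !mulrDr [l * (p / l)]mulrC divfK ?gt_eqF//; lra.
  exact: isP.
move: hq0; rewrite /h mulr0 add0r expr0n/= mulr0 addr0; have := hx q; lra.
Qed.

Lemma sum_pigeonhole (R : realType) (T : eqType) (ws : seq T) (f : T -> R) (Q : pred T)
    (i : T -> nat) J : (0 < J)%N -> {in ws, forall w, Q w -> (i w < J)%N} ->
  exists2 k, (k < J)%N & \sum_(w <- ws | Q w) f w <= J%:R * \sum_(w <- ws | Q w && (i w == k)) f w.
Proof.
move=> J0 hi; apply: contrapT => h.
have {}h (k : 'I_J) : J%:R * \sum_(w <- ws | Q w && (i w == k)) f w < \sum_(w <- ws | Q w) f w.
  by rewrite ltNge; apply/negP => hk; apply: h; exists k.
have e : \sum_(w <- ws | Q w) f w = \sum_(k < J) \sum_(w <- ws | Q w && (i w == k)) f w.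
  rewrite (exchange_big_dep Q)/=; last by move=> k w _ /andP[].
  rewrite big_seq_cond [RHS]big_seq_cond; apply: eq_bigr => w /andP[ws' Qw].
  by rewrite (big_pred1 (Ordinal (hi w ws' Qw)))// => k; rewrite Qw/= -val_eqE eq_sym.
have : \sum_(k < J) (J%:R * \sum_(w <- ws | Q w && (i w == k)) f w) <
    \sum_(k < J) \sum_(w <- ws | Q w) f w.
  by apply: ltr_sum => //; apply/hasP; exists (Ordinal J0); rewrite ?mem_index_enum.
by rewrite -mulr_sumr -e sumr_const card_ord mulr_natl ltxx.
Qed.

Lemma exists_nat_ge (R : realType) (x : R) : exists N : nat, forall n, (N <= n)%N -> x <= n%:R.
Proof.
exists (Num.trunc x).+1 => n hn; apply/ltW/(lt_le_trans (truncnS_gt _)).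
by rewrite ler_nat.
Qed.

(** * Distributions on blocks with prescribed rates *)

Section MoranTypes.
Context {R : realType} {A1 A2 : alphabetType}.
Variables (psi : seq (A1 * A2) -> R) (c s : R).
Hypothesis psi_qm : qm c psi.
Hypothesis psi_sum1 : forall n, \sum_(w <- words (A1 * A2)%type n) psi w = 1.
Hypothesis s01 : 0 < s <= 1.

Let s0 : 0 < s. Proof. by case/andP: s01. Qed.
Let s1 : s <= 1. Proof. by case/andP: s01. Qed.

Local Notation I := (fiber_pow psi).
Local Notation Phi := (tilt_base psi s).
Local Notation Z := (tilt_part psi s).
Local Notation Psi := (tilt psi s).
Local Notation G := (potential psi s).
Local Notation P := (tilt_pressure psi s).

Let Z0 q n : 0 < Z q n. Proof. exact: tilt_part_gt0 psi_qm psi_sum1 q n. Qed.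
Let Psi0 q w : 0 <= Psi q w. Proof. exact: tilt_ge0. Qed.
Let c0 : 0 <= c. Proof. exact: qm_const_ge0 psi_qm psi_sum1. Qed.

(** Used with a positive and a negative [d], for the deviations of F on either side of its mean. *)
Lemma tilt_deviation q d y e eta : P (q + d) <= P q + y + e -> 0 < e -> 0 < eta ->
  exists N0, forall N, (N0 <= N)%N ->
    \sum_(w <- words (A1 * A2)%type N | (0 < psi w) && (N%:R * (y + 2 * e) <= d * ln (G w))) Psi q w
      <= eta * Z q N.
Proof.
move=> hP e0 eta0; have [N0 hN0] := exists_nat_ge ((`|q + d| * c + `|q| * c - ln eta) / e).
exists N0 => N /hN0; rewrite ler_pdivrMr// => hN.
apply: (le_trans (@tilt_tail _ _ _ _ _ _ psi_qm s01 q d (N%:R * (y + 2 * e)) N _ _)).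
  by move=> w w0 /andP[_ h]; rewrite zpow_expR ?potential_gt0// ler_expR.
apply: (@le_trans _ _ (expR (- (N%:R * (y + 2 * e))) * expR (N%:R * P (q + d) + `|q + d| * c))).
  by rewrite ler_wpM2l ?expR_ge0// tilt_part_le.
apply: (@le_trans _ _ (eta * expR (N%:R * P q - `|q| * c))); last first.
  by rewrite ler_wpM2l ?(ltW eta0)// tilt_part_ge.
have eE : eta = expR (ln eta) by rewrite lnK.
rewrite [X in _ <= X * _]eE -!expRD ler_expR.
have := ler_wpM2l (ler0n R N) hP; lra.
Qed.

Lemma sum_tilt_fst q N (Q : pred (seq A1)) :
  \sum_(w <- words (A1 * A2)%type N | Q (map fst w)) Psi q w = \sum_(u <- words A1 N | Q u) Phi q u.
Proof.
rewrite big_mkcond -sum_fiber_sum [RHS]big_mkcond big_seq [RHS]big_seq.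
apply: eq_bigr => u; rewrite mem_words => /eqP su.
rewrite -(fiber_sum_tilt psi s q u) /fiber_sum; case: ifPn => Qu.
  rewrite big_seq [RHS]big_seq; apply: eq_bigr => v; rewrite mem_words => /eqP sv.
  by rewrite map_fst_zip// Qu.
rewrite big_seq big1// => v; rewrite mem_words => /eqP sv.
by rewrite map_fst_zip// (negbTE Qu).
Qed.

(** There are only [#|A1| ^ N] base words, so the very light ones are negligible together. This
    keeps the entropy [h] bounded, as compactness will require. *)
Lemma tilt_low_base q N :
  \sum_(w <- words (A1 * A2)%type N |
     Phi q (map fst w) <= expR (- (N%:R * (ln #|A1|%:R + 1))) * Z q N) Psi q w <=
  expR (- N%:R) * Z q N.
Proof.
rewrite (sum_tilt_fst q N (fun u => Phi q u <= _)).
have A0 : (0 < #|A1|)%N by apply/card_gt0P; exists point.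
have AR : 0 < #|A1|%:R :> R by rewrite ltr0n.
apply: (@le_trans _ _ (\sum_(u <- words A1 N) expR (- (N%:R * (ln #|A1|%:R + 1))) * Z q N)).
  rewrite big_mkcond; apply: ler_sum => u _; case: ifP => // _.
  by rewrite mulr_ge0 ?expR_ge0 ?(ltW (Z0 _ _)).
rewrite big_const_seq count_predT size_words iter_addr_0 -[_ *+ (_ ^ _)%N]mulr_natl mulrA.
rewrite ler_wpM2r ?(ltW (Z0 _ _))// natrX.
rewrite -[X in X ^+ _]lnK ?posrE// -expRM_natr -expRD ler_expR; lra.
Qed.

(* [h] is the entropy rate of the first coordinate under [m]; [(kap - h) / s], that of the
   second given the first, is forced by F being constant. *)
Definition moran_type (l kap b h e : R) (N : nat) (m : seq (A1 * A2) -> R) :=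
  [/\ (0 < N)%N /\ c <= e * N%:R,
      (forall w, 0 <= m w) /\ \sum_(w <- words (A1 * A2)%type N) m w = 1,
      (forall w, size w = N -> 0 < m w ->
        [/\ 0 < psi w, `|ln (G w) - N%:R * l| <= e * N%:R,
            `|ln (I 1 (map fst w)) + N%:R * b| <= e * N%:R &
            m w <= expR (- (N%:R * (h + (kap - h) / s - e)))]) &
      (forall u, size u = N -> fiber_sum m u <= expR (- (N%:R * (h - e))))].

(** The origin of [kap = P q - q * l] is the identity s log(nu / Z) = q F - log Z - (1 - s) log(Phi
    / Z) for the weight nu of a word. With F near [N l], log Z near [N P q] and log(Phi / Z) near
    [- N h], the weight is [exp (- N (h + (kap - h) / s))] up to errors. *)
Lemma moran_type_exists q l M e :
  (forall u, 0 < I 1 u -> `|ln (I 1 u)| <= M * (size u)%:R + c) ->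
  (forall e, 0 < e -> exists2 d, 0 < d & P (q + d) <= P q + d * (l + e)) ->
  (forall e, 0 < e -> exists2 d, 0 < d & P (q - d) <= P q - d * (l - e)) ->
  0 < e -> exists N m b h, [/\ 0 <= b <= M + c, 0 <= h <= ln #|A1|%:R + 1 &
    moran_type l (P q - q * l) b h e N m].
Proof.
move=> hM hr hl e0.
have A0 : (0 < #|A1|)%N by apply/card_gt0P; exists point.
have lnA0 : 0 <= ln #|A1|%:R :> R by rewrite ln_ge0// ler1n.
pose M1 : R := ln #|A1|%:R + 1.
have M10 : 0 < M1 by rewrite /M1; lra.
(* The error on F is multiplied by [q] and finally divided by [s]; this precision absorbs both. *)
pose e1 := e * s / (4 * (`|q| + 1)).
have q1 : 0 < `|q| + 1 by rewrite ltr_wpDl.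
have e10 : 0 < e1 by rewrite divr_gt0 ?mulr_gt0.
have e1q : `|q| * e1 <= e * s / 4.
  have : e1 * (`|q| + 1) = e * s / 4 by rewrite /e1; field; rewrite gt_eqF.
  lra.
have e1e : e1 <= e.
  rewrite /e1 ler_pdivrMr ?mulr_gt0// ler_pM2l//.
  by have := normr_ge0 q; have := s1; lra.
have [d1 d10 hd1] := hr (e1 / 2) (divr_gt0 e10 (ltr0n _ 2)).
have [d2 d20 hd2] := hl (e1 / 2) (divr_gt0 e10 (ltr0n _ 2)).
have e8 : 0 < 8^-1 :> R by rewrite invr_gt0.
have dev1 : P (q + d1) <= P q + d1 * l + d1 * (e1 / 2) by lra.
have dev2 : P (q + - d2) <= P q + - (d2 * l) + d2 * (e1 / 2) by lra.
have [N1 hN1] := tilt_deviation dev1 (mulr_gt0 d10 (divr_gt0 e10 (ltr0n _ 2))) e8.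
have [N2 hN2] := tilt_deviation dev2 (mulr_gt0 d20 (divr_gt0 e10 (ltr0n _ 2))) e8.
(* Grid of mesh [1 / K] for the rates [bw] and [hw] below; with the bounds on these rates, [J] cells
   suffice in each direction. *)
pose K := (Num.trunc (4 / (e * s))).+1.
have K0 : 0 < K%:R :> R by rewrite ltr0n.
have Ke : K%:R^-1 <= e * s / 4.
  rewrite -[leRHS]invrK lef_pV2 ?posrE ?invr_gt0 ?divr_gt0 ?mulr_gt0//.
  by rewrite invf_div; exact/ltW/truncnS_gt.
pose J := (Num.trunc (K%:R * (M + c + M1))).+1.
have [N3 hN3] := exists_nat_ge (4 * (ln 2 + 2 * ln J%:R) / e + c / e + 4 * (`|q| * c) / (e * s) + 3).
pose N := maxn 1 (maxn N1 (maxn N2 N3)).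
have N10 : (0 < N)%N by rewrite leq_max.
have NR : 0 < N%:R :> R by rewrite ltr0n.
have N1n : (N1 <= N)%N by rewrite /N !leq_max leqnn !orbT.
have N2n : (N2 <= N)%N by rewrite /N !leq_max leqnn !orbT.
have := hN3 N; rewrite !leq_max leqnn !orbT => /(_ isT) hN.
have N3' : 3 <= N%:R :> R.
  have J1 : 0 <= ln J%:R :> R by rewrite ln_ge0// ler1n.
  have t1 : 0 <= 4 * (ln 2 + 2 * ln J%:R) / e.
    by rewrite divr_ge0 ?(ltW e0)// mulr_ge0// addr_ge0 ?mulr_ge0// ln_ge0// ler1n.
  have t2 : 0 <= c / e by rewrite divr_ge0// ltW.
  have t3 : 0 <= 4 * (`|q| * c) / (e * s).
    by rewrite divr_ge0 ?mulr_ge0// ltW.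
  lra.
have NJ : ln (2 * J%:R ^+ 2) <= e * N%:R / 4.
  have t2 : 0 <= c / e by rewrite divr_ge0// ltW.
  have t3 : 0 <= 4 * (`|q| * c) / (e * s) by rewrite divr_ge0 ?mulr_ge0// ltW.
  have : 4 * (ln 2 + 2 * ln J%:R) / e <= N%:R by lra.
  by rewrite ler_pdivrMr// lnM ?posrE ?exprn_gt0 ?ltr0n// lnXn ?ltr0n// -mulr_natl; lra.
have J1 : 0 <= 4 * (ln 2 + 2 * ln J%:R) / e.
  by rewrite divr_ge0 ?(ltW e0)// mulr_ge0// addr_ge0 ?mulr_ge0// ln_ge0// ler1n.
have Nc : c <= e * N%:R.
  have t3 : 0 <= 4 * (`|q| * c) / (e * s) by rewrite divr_ge0 ?mulr_ge0// ltW.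
  have : c / e <= N%:R by lra.
  by rewrite ler_pdivrMr// mulrC.
have Nq : `|q| * c <= e * s * N%:R / 4.
  have t2 : 0 <= c / e by rewrite divr_ge0// ltW.
  have : 4 * (`|q| * c) / (e * s) <= N%:R by lra.
  by rewrite ler_pdivrMr ?mulr_gt0//; lra.
pose bw (w : seq (A1 * A2)) := - ln (I 1 (map fst w)) / N%:R.
pose hw (w : seq (A1 * A2)) := - ln (Phi q (map fst w) / Z q N) / N%:R.
pose good w := [&& 0 < psi w, `|ln (G w) - N%:R * l| <= e1 * N%:R & hw w <= M1].
(* A bad word deviates upwards, deviates downwards or has a light base: at most 1/8, 1/8 and 1/4 of
   the mass. *)
have goodmass : Z q N / 2 <= \sum_(w <- words (A1 * A2)%type N | good w) Psi q w.
  have eN : expR (- N%:R) <= 4^-1 :> R.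
    rewrite expRN lef_pV2 ?posrE ?expR_gt0//.
    by have := expR_ge1Dx (N%:R : R); lra.
  have h1 := hN1 N N1n; have h2 := hN2 N N2n; have h3 := tilt_low_base q N.
  have h3' : expR (- N%:R) * Z q N <= 4^-1 * Z q N by rewrite ler_wpM2r// ltW.
  suff : \sum_(w <- words (A1 * A2)%type N | ~~ good w) Psi q w <= 8^-1 * Z q N + 8^-1 * Z q N + 4^-1 * Z q N.
    have := sum_tilt psi s q N; rewrite (bigID good)/=; lra.
  apply: le_trans (lerD (lerD h1 h2) (le_trans h3 h3')).
  rewrite big_mkcond [X in _ <= X + _ + _]big_mkcond [X in _ <= _ + X + _]big_mkcond.
  rewrite [X in _ <= _ + X]big_mkcond -!big_split/=; apply: ler_sum => w _.
  have [->|w0] := eqVneq (Psi q w) 0; first by rewrite !if_same !addr0.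
  have pw : 0 < psi w by rewrite -(tilt_gt0E s psi_qm q) lt0r w0 Psi0.
  have if_ge0 (B : bool) : 0 <= (if B then Psi q w else 0) by case: B.
  case: ifPn => [|_]; last by rewrite !addr_ge0.
  rewrite /good pw/= negb_and -!ltNge => /orP[|hh].
    rewrite ltr_normr => /orP[hh|hh].
      rewrite ifT; first by rewrite -addrA lerDl addr_ge0.
      rewrite (_ : _ * (_ + _) = d1 * (N%:R * (l + e1))); last by field.
      by rewrite ler_pM2l//; lra.
    rewrite [X in _ + X + _]ifT; first by rewrite addrAC lerDr addr_ge0.
    rewrite (_ : _ * (_ + _) = d2 * (N%:R * (e1 - l))); last by field.
    by rewrite mulNr -mulrN ler_pM2l//; lra.
  rewrite [X in _ <= _ + X]ifT; first by rewrite lerDr addr_ge0.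
  move: hh; rewrite /hw ltr_pdivlMr// => hh.
  have Phi0 : 0 < Phi q (map fst w) by exact: tilt_base_gt0.
  rewrite -ler_pdivrMr//; rewrite -[leLHS]lnK ?posrE ?divr_gt0// ler_expR.
  rewrite -/M1; lra.
have bwP w : size w = N -> 0 < psi w -> 0 <= bw w <= M + c.
  move=> sw pw; rewrite /bw ler_pdivlMr// ler_pdivrMr// mul0r oppr_ge0.
  have I1 := fiber_pow_gt0 1 pw.
  rewrite ln_le0 ?(fiber_pow1_le1 psi_qm psi_sum1)//=.
  have h := hM _ I1; rewrite size_map sw in h.
  have h' : - ln (I 1 (map fst w)) <= `|ln (I 1 (map fst w))| by rewrite -normrN ler_norm.
  apply: (le_trans (le_trans h' h)); rewrite mulrDl lerD2l ler_peMr//; lra.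
have hwP w : 0 < psi w -> size w = N -> 0 <= hw w.
  move=> pw sw; rewrite /hw ler_pdivlMr// mul0r oppr_ge0 ln_le0// ler_pdivrMr// mul1r.
  rewrite /tilt_part (bigD1_seq (map fst w)) ?uniq_words ?mem_words ?size_map ?sw//=.
  by rewrite lerDl sumr_ge0// => u _; exact: tilt_base_ge0.
pose ib w := Num.trunc (K%:R * bw w); pose ih w := Num.trunc (K%:R * hw w).
have ibJ : {in words (A1 * A2)%type N, forall w, good w -> (ib w < J)%N}.
  move=> w; rewrite mem_words => /eqP sw /and3P[pw _ _].
  rewrite ltnS le_truncn// ler_pM2l//; have /andP[_ h] := bwP w sw pw.
  by apply: (le_trans h); rewrite lerDl ltW.
have ihJ k : {in words (A1 * A2)%type N, forall w, good w && (ib w == k) -> (ih w < J)%N}.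
  move=> w; rewrite mem_words => /eqP sw /andP[/and3P[pw _ hM1] _].
  rewrite ltnS le_truncn// ler_pM2l//; have /andP[h0 h] := bwP w sw pw.
  by apply: (le_trans hM1); rewrite lerDr (le_trans h0).
have [k1 _ hk1] := sum_pigeonhole (Psi q) (ltn0Sn _) ibJ.
have [k2 _ hk2] := sum_pigeonhole (Psi q) (ltn0Sn _) (ihJ k1).
pose T w := good w && (ib w == k1) && (ih w == k2).
pose S := \sum_(w <- words (A1 * A2)%type N | T w) Psi q w.
rewrite -/J -/S in hk1 hk2.
have JR : 0 < J%:R :> R by rewrite ltr0n.
have ZS : Z q N <= 2 * J%:R ^+ 2 * S.
  have h1 := le_trans goodmass (le_trans hk1 (ler_wpM2l (ltW JR) hk2)).
  rewrite ler_pdivrMr// in h1; apply: (le_trans h1).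
  by rewrite (_ : J%:R * _ * 2 = 2 * J%:R ^+ 2 * S)//; ring.
have S0 : 0 < S.
  have : 0 < 2 * J%:R ^+ 2 * S by exact: lt_le_trans ZS.
  by rewrite pmulr_rgt0// mulr_gt0// exprn_gt0.
have [w0 sw0 Tw0] : exists2 w, size w = N & T w.
  have : S != 0 by rewrite gt_eqF.
  rewrite psumr_neq0// => /hasP[w]; rewrite mem_words => /eqP sw /andP[Tw _].
  by exists w.
have Tb w : size w = N -> T w -> [/\ 0 < psi w, good w, k1%:R / K%:R <= bw w < k1%:R / K%:R + K%:R^-1 &
    k2%:R / K%:R <= hw w < k2%:R / K%:R + K%:R^-1].
  move=> sw /andP[/andP[gw /eqP ibw] /eqP ihw]; have pw : 0 < psi w by case/and3P: gw.
  have /andP[bw0 _] := bwP w sw pw; have hw0 := hwP w pw sw.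
  split => //.
    rewrite ler_pdivrMr// -[X in _ + X]mul1r -mulrDl ltr_pdivlMr// [bw w * _]mulrC -ibw.
    by rewrite natr1; apply: truncn_itv; rewrite mulr_ge0// ltW.
  rewrite ler_pdivrMr// -[X in _ + X]mul1r -mulrDl ltr_pdivlMr// [hw w * _]mulrC -ihw.
  by rewrite natr1; apply: truncn_itv; rewrite mulr_ge0// ltW.
pose m w := if T w then Psi q w / S else 0.
pose b : R := k1%:R / K%:R; pose h : R := k2%:R / K%:R.
have Ke' : K%:R^-1 <= e / 4.
  apply: (le_trans Ke); rewrite -[leRHS]mulr1 mulrAC ler_wpM2l//.
  by rewrite divr_ge0// ltW.
have J2 : 0 < 2 * J%:R ^+ 2 :> R by rewrite mulr_gt0// exprn_gt0.
have SZ x : 0 <= x -> x / S <= 2 * J%:R ^+ 2 * (x / Z q N).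
  move=> x0; rewrite ler_pdivrMr//.
  rewrite (_ : _ * (x / _) * S = x * (2 * J%:R ^+ 2 * S / Z q N)); last by ring.
  by rewrite ler_peMr// ler_pdivlMr// mul1r.
exists N, m, b, h; split.
- have [pw gw /andP[h1 _] _] := Tb _ sw0 Tw0; have /andP[_ h2] := bwP _ sw0 pw.
  by rewrite divr_ge0//= (le_trans h1).
- have [pw /and3P[_ _ h2] _ /andP[h1 _]] := Tb _ sw0 Tw0.
  by rewrite divr_ge0//= (le_trans h1).
split=> //.
- split=> [w|]; first by rewrite /m; case: ifP => // _; rewrite divr_ge0// ltW.
  by rewrite /m -big_mkcond -mulr_suml divff// gt_eqF.
- move=> w sw; rewrite /m; case: ifPn; last by rewrite ltxx.
  move=> Tw _; have [pw gw /andP[b1 b2] /andP[h1 h2]] := Tb w sw Tw.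
  have /and3P[_ gw2 gw3] := gw.
  have bE : ln (I 1 (map fst w)) = - (N%:R * bw w) by rewrite /bw [N%:R * _]mulrC divfK ?opprK// gt_eqF.
  have Phi0 : 0 < Phi q (map fst w) by exact: tilt_base_gt0.
  have hE : ln (Phi q (map fst w)) - ln (Z q N) = - (N%:R * hw w).
    by rewrite -ln_div ?posrE// /hw [N%:R * _]mulrC divfK ?opprK// gt_eqF.
  split=> //.
  + by apply: (le_trans gw2); rewrite ler_wpM2r.
  + rewrite bE addrC -mulrBr normrM ger0_norm// mulrC ler_wpM2r//.
    rewrite ler_norml; apply/andP; rewrite -/b in b1 b2 *; split; lra.
  have Iq0 := fiber_pow_gt0 q pw; have I10 := fiber_pow_gt0 1 pw.
  apply: (le_trans (SZ _ (Psi0 _ _))).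
  have PZ : 0 < Psi q w / Z q N by rewrite divr_gt0// tilt_gt0.
  rewrite -[leLHS]lnK ?posrE ?(mulr_gt0 J2 PZ)// ler_expR (lnM J2 PZ).
  have P3 : 0 < zpow (psi w) q by exact: zpow_gt0.
  have P2 : 0 < zpow (psi w) q / I q (map fst w) by exact: divr_gt0.
  rewrite (ln_div (tilt_gt0 s q pw) (Z0 q N)) /tilt (lnM Phi0 P2) (ln_div P3 Iq0) (ln_zpow _ pw).
  have PhiE : ln (Phi q (map fst w)) = q * (1 - s) * ln (I 1 (map fst w)) + s * ln (I q (map fst w)).
    by rewrite /tilt_base lnM ?posrE ?zpow_gt0// !ln_zpow.
  have GE : ln (G w) = (1 - s) * ln (I 1 (map fst w)) + s * ln (psi w).
    by rewrite /potential lnM ?posrE ?zpow_gt0// !ln_zpow.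
  (* Multiplying by [s] removes the division in the exponent, so that [ln (I q _)] can be eliminated
     between the formulas for F and for Phi. *)
  rewrite -(ler_pM2l s0).
  have -> : s * - (N%:R * (h + (P q - q * l - h) / s - e)) =
      N%:R * ((1 - s) * h - (P q - q * l) + s * e).
    by field; rewrite gt_eqF.
  have k3 : q * (ln (G w) - N%:R * l) <= e * s / 4 * N%:R.
    apply: (le_trans (ler_norm _)); rewrite normrM.
    apply: (le_trans (ler_wpM2l (normr_ge0 q) gw2)); rewrite mulrA ler_wpM2r//.
  have k4 : - ln (Z q N) <= - (N%:R * P q) + `|q| * c.
    by have := ln_tilt_part psi_qm psi_sum1 s01 q N; rewrite ler_norml => /andP[? ?]; lra.
  have k5 : s * ln (2 * J%:R ^+ 2) <= s * (e * N%:R / 4) by rewrite ler_wpM2l// ltW.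
  have k6 : (1 - s) * (N%:R * hw w) <= (1 - s) * (N%:R * h) + e * s / 4 * N%:R.
    have t1 : N%:R * hw w <= N%:R * (h + K%:R^-1) by rewrite ler_wpM2l// ltW.
    have t2 : 0 <= 1 - s by rewrite subr_ge0.
    have t3 := ler_wpM2l t2 t1.
    have t4 : (1 - s) * (N%:R * K%:R^-1) <= N%:R * (e * s / 4).
      apply: (@le_trans _ _ (N%:R * K%:R^-1)).
        rewrite ler_piMl ?mulr_ge0 ?invr_ge0//; have := s0; lra.
      by rewrite ler_wpM2l.
    lra.
  rewrite GE in k3; rewrite PhiE in hE *.
  have hE' : (1 - s) * (q * (1 - s) * ln (I 1 (map fst w)) + s * ln (I q (map fst w)) - ln (Z q N)) =
      (1 - s) * - (N%:R * hw w) by rewrite hE.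
  lra.
move=> u su; rewrite /fiber_sum.
have [hv|hv] := pselect (exists2 v, size v = N & T (zip u v)); last first.
  rewrite big_seq big1 ?expR_ge0// => v; rewrite mem_words su => /eqP sv.
  by rewrite /m ifF//; apply/negP => Tv; apply: hv; exists v.
have [v sv Tv] := hv.
have szv : size (zip u v) = N by rewrite size_zip su sv minnn.
have [pw gw _ /andP[h1 h2]] := Tb _ szv Tv.
have fz : map fst (zip u v) = u by rewrite map_fst_zip// su sv.
have Phi0 : 0 < Phi q u by rewrite -fz; exact: tilt_base_gt0.
apply: (@le_trans _ _ (Phi q u / S)).
  rewrite -(fiber_sum_tilt psi s q u) /fiber_sum mulr_suml; apply: ler_sum => v' _.
  by rewrite /m; case: ifP => // _; rewrite divr_ge0// ltW.
apply: (le_trans (SZ _ (ltW Phi0))).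
have PZ : 0 < Phi q u / Z q N by rewrite divr_gt0.
rewrite -[leLHS]lnK ?posrE ?(mulr_gt0 J2 PZ)// ler_expR (lnM J2 PZ).
have hE : ln (Phi q u / Z q N) = - (N%:R * hw (zip u v)).
  by rewrite /hw fz [N%:R * _]mulrC divfK ?opprK// gt_eqF.
have : N%:R * h <= N%:R * hw (zip u v) by rewrite ler_wpM2l.
have : 0 <= e * N%:R by rewrite mulr_ge0// ltW.
rewrite hE; lra.
Qed.

End MoranTypes.

Section MoranLimit.
Context {R : realType} {A1 A2 : alphabetType}.
Variables (psi : seq (A1 * A2) -> R) (c s : R).
Hypothesis psi_qm : qm c psi.
Hypothesis psi_sum1 : forall n, \sum_(w <- words (A1 * A2)%type n) psi w = 1.
Hypothesis s01 : 0 < s <= 1.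

Let s0 : 0 < s. Proof. by case/andP: s01. Qed.
Let s1 : s <= 1. Proof. by case/andP: s01. Qed.

Local Notation I := (fiber_pow psi).
Local Notation P := (tilt_pressure psi s).

(** An error [d] on [h] becomes [d / s] in [(kap - h) / s], whence the new precision; lowering [kap]
    only weakens the bound on [m]. *)
Lemma moran_type_weaken l kap b h e l' kap' b' h' d N m : 0 <= d ->
  `|l - l'| <= d -> kap' <= kap -> `|b - b'| <= d -> `|h - h'| <= d ->
  moran_type psi c s l kap b h e N m -> moran_type psi c s l' kap' b' h' (e + d / s) N m.
Proof.
move=> d0 hl hk hb hh [[N0 cN] hm hw hu].
have NR : 0 <= N%:R :> R by exact: ler0n.
have ds : d <= d / s by rewrite ler_pdivlMr// ler_piMr.
have ds0 : 0 <= d / s := le_trans d0 ds.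
have dN : N%:R * d <= N%:R * (d / s) by rewrite ler_wpM2l.
split=> //.
- by split=> //; rewrite mulrDl (le_trans cN)// lerDl mulr_ge0.
- move=> w sw mw; have [w1 w2 w3 w4] := hw w sw mw; split=> //.
  + rewrite (_ : _ - _ = (ln (potential psi s w) - N%:R * l) + N%:R * (l - l')); last by ring.
    apply: (le_trans (ler_normD _ _)); rewrite mulrDl lerD// normrM ger0_norm//.
    by rewrite mulrC; apply: le_trans (ler_wpM2r NR hl) _; rewrite ler_wpM2r.
  + rewrite (_ : _ + _ = (ln (I 1 (map fst w)) + N%:R * b) - N%:R * (b - b')); last by ring.
    apply: (le_trans (ler_normB _ _)); rewrite mulrDl lerD// normrM ger0_norm//.
    by rewrite mulrC; apply: le_trans (ler_wpM2r NR hb) _; rewrite ler_wpM2r.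
  apply: (le_trans w4); rewrite ler_expR lerN2 ler_wpM2l//.
  have e1 : (kap' - h') / s <= (kap - h) / s + (h - h') / s.
    by rewrite -mulrDl ler_wpM2r ?invr_ge0 ?(ltW s0)//; lra.
  have e2 : (h - h') / s - (h - h') <= d / s - d.
    have : 0 <= (d - (h - h')) * (s^-1 - 1).
      apply: mulr_ge0; last by rewrite subr_ge0 invf_ge1.
      by move: hh; rewrite subr_ge0 ler_norml => /andP[].
    lra.
  lra.
move=> u su; apply: (le_trans (hu u su)); rewrite ler_expR lerN2 ler_wpM2l//.
by move: hh; rewrite ler_norml => /andP[? ?]; lra.
Qed.

Lemma moran_type_approx (l1 alpha x : R) : 0 < l1 -> 0 <= x ->
  (forall q, x <= alpha * q + P q / l1) -> 
  exists2 M, 0 <= M & forall e, 0 < e -> exists N m b h, [/\ 0 <= b <= M, 0 <= h <= M &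
    moran_type psi c s (- (l1 * alpha)) (l1 * x) b h e N m].
Proof.
move=> l10 x0 hx.
have [M M0 hM] := qm_ln_bound (fiber_pow1_qm psi_qm).
have c0 : 0 <= c by exact: qm_const_ge0 psi_qm psi_sum1.
have lnA0 : 0 <= ln #|A1|%:R :> R by rewrite ln_ge0// ler1n; apply/card_gt0P; exists point.
exists (M + c + (ln #|A1|%:R + 1)); first by lra.
move=> e e0.
have f0 : 0 <= P 0 / l1 by have := hx 0; rewrite mulr0 add0r; exact: le_trans.
(* With [d = r ^ 2 / D], the bound on [d * q ^ 2] gives [|l1 * (d * q)| <= r], the distance from the
   slope at [q] to the wanted one. *)
pose D := l1 ^+ 2 * (2 * (P 0 / l1)) + 1.
have D0 : 0 < D by rewrite ltr_wpDl//; apply: mulr_ge0; [exact: sqr_ge0|exact: mulr_ge0].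
pose r := s * (e / 2).
have r0 : 0 < r by rewrite mulr_gt0// divr_gt0.
pose d := r ^+ 2 / D; have d0 : 0 < d by rewrite divr_gt0// exprn_gt0.
have dP q : derivable P q 1 by have [l [] ] := tilt_pressure_derivative psi_qm psi_sum1 s01 q.
have [q dq hq] := penalized_minimizer l10 x0 dP hx d0.
have [l dl [_ [hr hl]]] := tilt_pressure_derivative psi_qm psi_sum1 s01 q.
have lE : l = - (l1 * (alpha + d * q)) by have [_ <-] := dl; have [_ <-] := dq.
have [N [m [b [h [hb hh hmt]]]]] := moran_type_exists psi_qm psi_sum1 s01 hM hr hl (divr_gt0 e0 (ltr0n _ 2)).
have hlr : `|l - - (l1 * alpha)| <= r.
  rewrite lE (_ : _ - _ = - (l1 * (d * q))); last by ring.
  rewrite normrN -(ler_pXn2r (n:=2))// ?nnegrE ?(ltW r0)// real_normK ?num_real//.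
  apply: (@le_trans _ _ (d * D)); last by rewrite /d divfK// gt_eqF.
  have h1 : d * q ^+ 2 <= 2 * (P 0 / l1) by lra.
  have h2 := ler_wpM2l (exprn_ge0 2 (ltW l10)) h1.
  have := ler_wpM2l (ltW d0) h2; rewrite /D; lra.
(* [P q - q * l] is [l1 * (alpha * q + P q / l1)] plus [l1 * d * q ^ 2]: the penalty errs on the
   favourable side. *)
have hk : l1 * x <= P q - q * l.
  rewrite lE; have := hx q; rewrite -(ler_pM2l l10) mulrDr [l1 * (P q / l1)]mulrC divfK ?gt_eqF//.
  have : 0 <= l1 * (d * q ^+ 2).
    by apply: mulr_ge0; [exact: ltW|apply: mulr_ge0; [exact: ltW|exact: sqr_ge0]].
  lra.
exists N, m, b, h; split.
- have /andP[-> h2] /= := hb; lra.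
- have /andP[-> h2] /= := hh; lra.
have -> : e = e / 2 + r / s by rewrite /r; field; rewrite gt_eqF.
apply: moran_type_weaken hmt => //; rewrite ?subrr ?normr0 ?(ltW r0)//.
Qed.

(** The rates obtained at precision [1 / (n + 1)] have a cluster point in the square [[0, M] x
    [0, M]], and [moran_type_weaken] moves nearby types to it. *)
Lemma moran_type_limit l kap M :
  (forall e, 0 < e -> exists N m b h, [/\ 0 <= b <= M, 0 <= h <= M &
    moran_type psi c s l kap b h e N m]) ->
  exists b h, 0 <= h /\ forall e, 0 < e -> exists N m, moran_type psi c s l kap b h e N m.
Proof.
move=> H.
have H' n : exists p : R * R, [/\ 0 <= p.1 <= M, 0 <= p.2 <= M &
    exists N m, moran_type psi c s l kap p.1 p.2 (n.+1%:R^-1) N m].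
  have [|N [m [b [h [hb hh hm]]]]] := H (n.+1%:R^-1); first by rewrite invr_gt0.
  by exists (b, h); split=> //=; exists N, m.
have [f hf] := choice H'.
have cpt : compact (`[0, M]%classic `*` `[0, M]%classic : set (R * R)).
  by apply: compact_setX; exact: segment_compact.
have [|[b h] [[_ /=]]] := cpt (f @ \oo) _.
  by exists 0%N => // n _; have [h1 h2 _] := hf n; split; rewrite /= in_itv.
rewrite in_itv/= => /andP[h0 _] clu.
exists b, h; split=> // e e0.
pose r := s * (e / 2); have r0 : 0 < r by rewrite mulr_gt0// divr_gt0.
have [n0 hn0] := exists_nat_ge (2 / e).
have fA : (f @ \oo) [set p | exists2 n, (n0 <= n)%N & p = f n].
  by exists n0 => // n /= hn; exists n.
have nB : nbhs (b, h) (ball (b, h) r) by exact: nbhsx_ballx.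
have [p [[n hn pE] [/= Bb Bh]]] := clu _ _ fA nB.
have [_ _ [N [m hm]]] := hf n; rewrite -pE in hm.
exists N, m.
have e2 : n.+1%:R^-1 <= e / 2.
  rewrite -[leRHS]invrK lef_pV2 ?posrE ?invr_gt0 ?divr_gt0// invf_div.
  by apply: (le_trans (hn0 n hn)); rewrite ler_nat.
have -> : e = e / 2 + r / s by rewrite /r; field; rewrite gt_eqF.
have mono e' e'' b' h' : e' <= e'' -> moran_type psi c s l kap b' h' e' N m -> moran_type psi c s l kap b' h' e'' N m.
  move=> ee [[N0 cN] hm1 hw hu].
  have eN : e' * N%:R <= e'' * N%:R by rewrite ler_wpM2r.
  split=> //; first by split=> //; exact: le_trans eN.
    move=> w sw mw; have [w1 w2 w3 w4] := hw w sw mw; split=> //.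
    - exact: le_trans eN.
    - exact: le_trans eN.
    - by apply: (le_trans w4); rewrite ler_expR lerN2 ler_wpM2l//; lra.
  by move=> u su; apply: (le_trans (hu u su)); rewrite ler_expR lerN2 ler_wpM2l//; lra.
apply: (mono _ _ _ _ _ (moran_type_weaken (ltW r0) _ _ _ _ hm)) => //.
- by rewrite lerD2r.
- by rewrite subrr normr0 ltW.
- by rewrite distrC; exact: ltW.
- by rewrite distrC; exact: ltW.
Qed.

End MoranLimit.

(** * Concatenation of blocks *)

Section Blocks.
Context {R : realType} {A : finType} (len : nat -> nat).

Definition block_start t := (\sum_(i < t) len i)%N.
Definition block t (u : seq A) := take (len t) (drop (block_start t) u).
Local Notation S := block_start.

Lemma block_startS t : S t.+1 = (S t + len t)%N.
Proof. by rewrite /block_start big_ord_recr. Qed.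

Lemma leq_block_start t T : (t <= T)%N -> (S t <= S T)%N.
Proof.
move=> /subnKC <-; elim: (T - t)%N => [|k IH]; first by rewrite addn0.
by rewrite addnS block_startS (leq_trans IH)// leq_addr.
Qed.

Lemma block_cat t T u v : (t < T)%N -> size u = S T -> block t (u ++ v) = block t u.
Proof.
move=> tT su; have h : (S t + len t <= size u)%N by rewrite su -block_startS leq_block_start.
have h1 : (S t <= size u)%N by exact: leq_trans (leq_addr _ _) h.
rewrite /block drop_cat; case: ltnP => h2.
  rewrite take_cat size_drop; case: ltnP => // h3.
  have -> : (len t - (size u - S t) = 0)%N by apply/eqP; rewrite subn_eq0 leq_subRL.
  by rewrite take0 cats0 take_oversize// size_drop.
have e : size u = S t by apply/eqP; rewrite eqn_leq h2 h1.
have l0 : len t = 0%N.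
  by move: h; rewrite e -[X in (_ <= X)%N]addn0 leq_add2l leqn0 => /eqP.
by rewrite l0 !take0.
Qed.

Lemma block_last T u v : size u = S T -> size v = len T -> block T (u ++ v) = v.
Proof. by move=> su sv; rewrite /block drop_size_cat// take_oversize// sv. Qed.

Lemma sum_prod_blocks (f : nat -> seq A -> R) T :
  \sum_(u <- words A (S T)) \prod_(t < T) f t (block t u) =
  \prod_(t < T) \sum_(v <- words A (len t)) f t v.
Proof.
elim: T => [|T IH]; first by rewrite /block_start big_ord0 sum_words0 !big_ord0.
rewrite big_ord_recr/= -IH block_startS sum_wordsD mulr_suml big_seq [RHS]big_seq.
apply: eq_bigr => u; rewrite mem_words => /eqP su; rewrite mulr_sumr.
rewrite big_seq [RHS]big_seq; apply: eq_bigr => v; rewrite mem_words => /eqP sv.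
rewrite big_ord_recr/= block_last//; congr (_ * _).
by apply: eq_bigr => t _; rewrite (block_cat _ (ltn_ord t)).
Qed.

Definition word_block t (z : nat -> A) := block t (mkseq z (S t.+1)).

Lemma mkseqD (z : nat -> A) n m : mkseq z (n + m) = mkseq z n ++ mkseq (fun i => z (n + i)%N) m.
Proof.
rewrite /mkseq iotaD map_cat add0n; congr (_ ++ _).
by rewrite -{1}[n]addn0 iotaDl -map_comp.
Qed.

Lemma word_blockE t z : word_block t z = mkseq (fun i => z (S t + i)%N) (len t).
Proof. by rewrite /word_block block_startS mkseqD block_last// size_mkseq. Qed.

Lemma size_word_block t z : size (word_block t z) = len t.
Proof. by rewrite word_blockE size_mkseq. Qed.

Lemma mkseq_block_startS t z : mkseq z (S t.+1) = mkseq z (S t) ++ word_block t z.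
Proof. by rewrite block_startS mkseqD word_blockE. Qed.

Hypothesis len_gt0 : forall t, (0 < len t)%N.

Lemma leq_block_start_id t : (t <= S t)%N.
Proof.
elim: t => // t IH; rewrite block_startS -addn1; exact: leq_add.
Qed.

Lemma block_locate n : exists T, (S T <= n < S T.+1)%N.
Proof.
elim: n => [|n [T /andP[h1 h2]]].
  by exists 0%N; rewrite block_startS /block_start big_ord0 /= add0n len_gt0.
have [h|h] := ltnP n.+1 (S T.+1); first by exists T; rewrite h (leqW h1).
exists T.+1; rewrite h block_startS; apply: (leq_ltn_trans h2).
by rewrite -[X in (X < _)%N]addn0 ltn_add2l len_gt0.
Qed.

Variable err : nat -> R.
Hypothesis err_ge0 : forall t, 0 <= err t.
Hypothesis err_lim : forall eta, 0 < eta -> exists t0, forall t, (t0 <= t)%N -> err t <= eta.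
Hypothesis len_lim : forall eta : R, 0 < eta ->
  exists t0, forall t, (t0 <= t)%N -> (len t)%:R <= eta * t%:R.

Definition block_error T := \sum_(t < T) err t * (len t)%:R.

Lemma block_errorS T : block_error T.+1 = block_error T + err T * (len T)%:R.
Proof. by rewrite /block_error big_ord_recr. Qed.

Lemma le_block_error t T : (t <= T)%N -> block_error t <= block_error T.
Proof.
move=> /subnKC <-; elim: (T - t)%N => [|k IH]; first by rewrite addn0.
by rewrite addnS block_errorS (le_trans IH)// lerDl mulr_ge0.
Qed.

(** Errors before some [t0] form a constant and later ones are at most [eta / 2] times the length. A
    block containing position [n] has length at most [eta * T], and [T <= S T <= n]. *)
Lemma block_error_small eta : 0 < eta -> exists n0, forall n T, (n0 <= n)%N ->
  (S T <= n < S T.+1)%N -> block_error T <= eta * n%:R /\ (len T)%:R <= eta * n%:R.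
Proof.
move=> eta0; have eta20 : 0 < eta / 2 by rewrite divr_gt0.
have [t0 ht0] := err_lim eta20; have [t1 ht1] := len_lim eta0.
have bound T : block_error T <= block_error t0 + eta / 2 * (S T)%:R.
  have [h|/ltnW/subnKC <-] := leqP T t0.
    by apply: (le_trans (le_block_error h)); rewrite lerDl mulr_ge0// ltW.
  elim: (T - t0)%N => [|k IH]; first by rewrite addn0 lerDl mulr_ge0// ltW.
  rewrite addnS block_errorS block_startS natrD mulrDr addrA lerD//.
  by rewrite ler_wpM2r// ht0// leq_addr.
have [n1 hn1] := exists_nat_ge (block_error t0 / (eta / 2)).
exists (maxn n1 (S t1)) => n T; rewrite geq_max => /andP[/hn1 + n1n] /andP[h1 h2].
rewrite ler_pdivrMr// => h3; have h1R : (S T)%:R <= n%:R :> R by rewrite ler_nat.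
split.
  have := bound T; have : eta / 2 * (S T)%:R <= eta / 2 * n%:R by rewrite ler_wpM2l// ltW.
  lra.
have Tt1 : (t1 <= T)%N.
  rewrite leqNgt; apply/negP => Tt; have := leq_block_start Tt.
  by rewrite leqNgt => /negP; apply; exact: leq_ltn_trans h2.
apply: (le_trans (ht1 T Tt1)); rewrite ler_wpM2l ?(ltW eta0)// ler_nat.
exact: leq_trans (leq_block_start_id T) h1.
Qed.

(** Each block brings its own error and one gluing constant [c], itself at most [err t * len t];
    hence the factor 2. *)
Lemma block_log_start (f : seq A -> R) c lam z : qm c f -> (forall n, 0 < f (mkseq z n)) ->
  (forall t, `|ln (f (word_block t z)) - (len t)%:R * lam| <= err t * (len t)%:R) ->
  (forall t, c <= err t * (len t)%:R) ->
  forall T, `|ln (f (mkseq z (S T))) - (S T)%:R * lam| <= c + 2 * block_error T.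
Proof.
move=> fc fz hb hc; have [f0 fm] := fc; elim=> [|T IH].
  rewrite /block_start /block_error !big_ord0 mul0r subr0 mulr0 addr0.
  have := fm [::] [::]; have f1 : 0 < f [::] := fz 0%N.
  move=> /cmp_ln -/(_ (mulr_gt0 f1 f1) f1); by rewrite lnM ?posrE// addrK.
have := fz (S T.+1); rewrite mkseq_block_startS => h.
have := h; rewrite (qm_gt0 _ _ fc) => /andP[h1 h2].
have := fm (mkseq z (S T)) (word_block T z).
move=> /cmp_ln -/(_ (mulr_gt0 h1 h2) h).
rewrite lnM ?posrE// block_errorS block_startS natrD.
move: IH (hb T) (hc T); rewrite !ler_norml => /andP[? ?] /andP[? ?] ? /andP[? ?].
apply/andP; split; lra.
Qed.

Lemma block_log_limit (f : seq A -> R) c lam eta : qm c f -> 0 <= c -> 0 < eta ->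
  (forall t, c <= err t * (len t)%:R) ->
  exists n0, forall z, (forall n, 0 < f (mkseq z n)) ->
  (forall t, `|ln (f (word_block t z)) - (len t)%:R * lam| <= err t * (len t)%:R) ->
  forall n, (n0 <= n)%N -> `|ln (f (mkseq z n)) - n%:R * lam| <= eta * n%:R.
Proof.
move=> fc c0 eta0 hc; have [f0 fm] := fc; have [M M0 hM] := qm_ln_bound fc.
(* [n] letters are full blocks and a piece of one block, of length at most [e * n]. The piece costs
   [M + |lam|] times that, the block errors twice it, and the three constants [c] once. *)
pose e := eta / (3 + M + `|lam|).
have D0 : 0 < 3 + M + `|lam| by rewrite ltr_pwDl// ltr_pwDl.
have e0 : 0 < e by exact: divr_gt0.
have [n0 hn0] := block_error_small e0; have [n1 hn1] := exists_nat_ge (3 * c / e).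
exists (maxn n0 n1) => z fz hb n; rewrite geq_max => /andP[n0n /hn1].
rewrite ler_pdivrMr// => nc.
have [T hT] := block_locate n; have [h1 h2] := hn0 n T n0n hT.
have /andP[Sn nS] := hT; set r := (n - S T)%N.
have rT : (r <= len T)%N by rewrite leq_subLR -block_startS ltnW.
have := fz n; rewrite -{1}(subnKC Sn) mkseqD -/r; set y := mkseq _ r => fpos.
have := fpos; rewrite (qm_gt0 _ _ fc) => /andP[f1 f2].
have := fm (mkseq z (S T)) y; move=> /cmp_ln -/(_ (mulr_gt0 f1 f2) fpos).
have ny : mkseq z n = mkseq z (S T) ++ y by rewrite -mkseqD subnKC.
rewrite lnM ?posrE// -ny => k1.
have k2 := block_log_start fc fz hb hc T.
have k3 := hM y f2; rewrite size_mkseq in k3.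
have rR : r%:R <= (len T)%:R :> R by rewrite ler_nat.
have nE : n%:R = (S T)%:R + r%:R :> R by rewrite -natrD subnKC.
have k4 : M * r%:R <= M * (e * n%:R) by rewrite ler_wpM2l// (le_trans rR).
have k5 : `|r%:R * lam| <= `|lam| * (e * n%:R).
  by rewrite normrM ger0_norm// mulrC ler_wpM2l// (le_trans rR).
have eE : e * n%:R * (3 + M + `|lam|) = eta * n%:R by rewrite /e; field; rewrite gt_eqF.
have -> : ln (f (mkseq z n)) - n%:R * lam = (ln (f (mkseq z (S T))) - (S T)%:R * lam)
   + ln (f y) - r%:R * lam - (ln (f (mkseq z (S T))) + ln (f y) - ln (f (mkseq z n))).
  by rewrite nE; ring.
apply: (le_trans (ler_normB _ _)).
have t1 := ler_normB (ln (f (mkseq z (S T))) - (S T)%:R * lam + ln (f y)) (r%:R * lam).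
have t2 := ler_normD (ln (f (mkseq z (S T))) - (S T)%:R * lam) (ln (f y)).
lra.
Qed.

End Blocks.

(** * Compactness of the Moran set *)

Section Koenig.
Context {R : realType} {A : alphabetType} (len : nat -> nat) (m : nat -> seq A -> R).
Hypothesis len_gt0 : forall t, (0 < len t)%N.
Local Notation S := (block_start len).

Definition moran_set : set (nat -> A) := [set z | forall t, 0 < m t (word_block len t z)].

Lemma mkseqS (z : nat -> A) n : mkseq z n.+1 = rcons (mkseq z n) (z n).
Proof. by rewrite /mkseq -[n.+1]addn1 iotaD map_cat /= cats1 add0n. Qed.

(* Koenig's lemma on the prefixes of uncovered words of length [S T], T -> oo. *)
Lemma moran_set_finite_subcover (L : nat -> nat) (p : nat -> pred (seq A)) :
  (forall z, moran_set z -> exists i, p i (mkseq z (L i))) ->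
  exists T, forall u, size u = S T -> (forall t, (t < T)%N -> 0 < m t (block len t u)) ->
    exists i, [/\ (i < T)%N, (L i <= S T)%N & p i (take (L i) u)].
Proof.
move=> cover; apply: contrapT => /forallNP noT.
have {noT} H T : exists u, [/\ size u = S T, forall t, (t < T)%N -> 0 < m t (block len t u) &
    forall i, (i < T)%N -> (L i <= S T)%N -> ~~ p i (take (L i) u)].
  apply: contrapT => /forallNP h; apply: (noT T) => u su hu.
  apply: contrapT => /forallNP hi; apply: (h u); split => // i iT LiT.
  by apply/negP => pi; apply: (hi i).
have [U HU] := choice H.
(* [w] is a prefix of infinitely many uncovered words [U T]. Every frequent word has a frequent
   one-letter extension, since the alphabet is finite. *)
pose frequent w := forall T0, exists2 T, (T0 <= T)%N & take (size w) (U T) = w.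
have f0 : frequent [::] by move=> T0; exists T0; rewrite ?take0.
have ext w : exists a, frequent w -> frequent (rcons w a).
  apply: contrapT => /forallNP h.
  have fw : frequent w by apply: contrapT => nf; apply: (h point).
  have {h} h a : exists Ta, forall T, (Ta <= T)%N -> take (size w).+1 (U T) <> rcons w a.
    apply: contrapT => /forallNP hT; apply: (h a) => _ T0; apply: contrapT => h'.
    apply: (hT T0) => T T0T e; apply: h'; exists T => //; by rewrite size_rcons.
  have [Ta hTa] := choice h.
  have [T] := fw (maxn (\max_a Ta a) (size w).+1); rewrite geq_max => /andP[h1 h2] e.
  have sT : (size w < size (U T))%N.
    by have [-> _ _] := HU T; exact: leq_trans h2 (leq_block_start_id len_gt0 T).
  apply: (hTa (nth point (U T) (size w)) T).
    exact: leq_trans (leq_bigmax (nth point (U T) (size w))) h1.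
  by rewrite (take_nth point)// e.
have [f hf] := choice ext.
pose W n := iter n (fun w => rcons w (f w)) [::].
have WP n : frequent (W n) by elim: n => // n IH; exact: hf.
pose z n := f (W n).
have zW n : mkseq z n = W n by elim: n => // n IH; rewrite mkseqS IH.
have zfreq n T0 : exists2 T, (T0 <= T)%N & take n (U T) = mkseq z n.
  by have [T h1 h2] := WP n T0; exists T => //; rewrite zW -h2 -zW size_mkseq.
have [t|i pi] := cover z.
  have [T tT e] := zfreq (S t.+1) t.+1; rewrite /word_block -e.
  have [sU hU _] := HU T.
  rewrite -(@block_cat _ _ t t.+1 _ (drop (S t.+1) (U T)))//; last first.
    by rewrite size_takel// sU leq_block_start.
  by rewrite cat_take_drop; exact: hU.
have [T] := zfreq (L i) (maxn i.+1 (L i)); rewrite geq_max => /andP[h1 h2] e.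
have [_ _ /(_ i h1)] := HU T.
by rewrite e pi => /(_ (leq_trans h2 (leq_block_start_id len_gt0 T))).
Qed.

End Koenig.

(** * Mass distribution principle *)

Section MassDistribution.
Context {R : realType} (r1 r2 : nat).
Hypothesis r1_ge2 : (2 <= r1)%N.
Hypothesis r1_le_r2 : (r1 <= r2)%N.
Local Notation A1 := (letters r1).
Local Notation A2 := (letters r2).
Local Notation L := (ln r2%:R : R).
Local Notation g := (ball_len r1 r2).
Variables (len : nat -> nat) (m : nat -> seq (A1 * A2) -> R).
Hypothesis len_gt0 : forall t, (0 < len t)%N.
Hypothesis m_ge0 : forall t w, 0 <= m t w.
Hypothesis m_sum1 : forall t, \sum_(w <- words (A1 * A2)%type (len t)) m t w = 1.
Local Notation S := (block_start len).

Let l2 : 0 < L. Proof. exact: ln_r2_gt0 r1_le_r2. Qed.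
Let r2_gt0 : 0 < r2%:R :> R. Proof. by rewrite ltr0n (leq_trans _ r1_le_r2)// ltnW. Qed.
Let r2_ge1 : 1 <= r2%:R :> R. Proof. by rewrite ler1n (leq_trans _ r1_le_r2)// ltnW. Qed.

Definition block_mass T u := \prod_(t < T) m t (block len t u).

Lemma block_mass_ge0 T u : 0 <= block_mass T u.
Proof. by apply: prodr_ge0. Qed.

Lemma sum_block_mass T : \sum_(u <- words (A1 * A2)%type (S T)) block_mass T u = 1.
Proof. by rewrite sum_prod_blocks big1. Qed.

Lemma scale_exists (d : R) n0 : 0 < d -> d <= r2%:R ^- n0 ->
  exists2 n, (n0 <= n)%N & r2%:R ^- n.+1 < d <= r2%:R ^- n.
Proof.
move=> d0 dn0.
have ex : exists n, r2%:R ^- n.+1 < d.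
  exists (Num.trunc d^-1); rewrite invf_plt ?posrE ?exprn_gt0//.
  apply: (lt_le_trans (truncnS_gt _)); rewrite -natrX ler_nat ltnW// ltn_expl//.
  exact: leq_trans r1_le_r2.
case: (ex_minnP ex) => n hn nmin; exists n.
  rewrite leqNgt; apply/negP => nn0; move: (lt_le_trans hn dn0); apply/negP; rewrite -leNgt.
  by rewrite lef_pV2 ?posrE ?exprn_gt0// ler_weXn2l.
rewrite hn /=; case: n nmin {hn} => [_|n nmin].
  apply: (le_trans dn0); rewrite lef_pV2 ?posrE ?exprn_gt0// expr0.
  exact: exprn_ege1.
by rewrite leNgt; apply/negP => /nmin; rewrite ltnn.
Qed.

Local Notation pd := (@pair_dist R r1 r2).

Lemma small_ball_exists (t0 e : R) n0 : 0 < t0 -> 0 < e ->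
  exists2 n, (n0 <= n)%N & expR (- (n%:R * (t0 * L))) <= e.
Proof.
move=> t00 e0; have tL : 0 < t0 * L by exact: mulr_gt0.
have [N hN] := exists_nat_ge (- ln e / (t0 * L)).
exists (maxn n0 N); first exact: leq_maxl.
have eE : e = expR (ln e) by rewrite lnK.
rewrite [leRHS]eE ler_expR; have := hN (maxn n0 N) (leq_maxr _ _).
by rewrite ler_pdivrMr//; lra.
Qed.

(** If a smaller exponent gave measure 0, a cheap cover could be enlarged to balls. By compactness
    finitely many of them catch all words of positive mass of some length [S T]; these words have
    mass 1, while the balls have total mass below 1. No measure on infinite words is needed. *)
Lemma hausdorff_dim_ge E (t0 : R) n0 : 0 < t0 -> moran_set len m `<=` E ->
  (forall n z T, (n0 <= n)%N -> (g n <= S T)%N ->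
    \sum_(u <- words (A1 * A2)%type (S T) | in_ball n z (take (g n) u)) block_mass T u
      <= expR (- (n%:R * (t0 * L)))) ->
  (t0%:E <= hausdorff_dim pd E)%E.
Proof.
move=> t00 KE hmass; apply: le_ereal_inf_tmp => _ [t [t_ge0 Ht] <-].
rewrite lee_fin leNgt; apply/negP => tt0.
(* [C = r2 ^ t] is the loss in rounding a diameter up to a power of [1 / r2]. With [eta] below, the
   rounded cover costs at most 1/4. *)
pose C : R := expR (t * L); have C0 : 0 < C by exact: expR_gt0.
pose eta : R := (4 * C)^-1; have eta0 : 0 < eta by rewrite invr_gt0 mulr_gt0.
have r0 : 0 < r2%:R ^- n0 :> R by rewrite invr_gt0 exprn_gt0.
have pre : (hausdorff_premeasure pd t (r2%:R ^- n0) E < eta%:E)%E.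
  apply: le_lt_trans (_ : (0 < eta%:E)%E); last by rewrite lte_fin.
  by rewrite -Ht; apply: ereal_sup_ubound; exists (r2%:R ^- n0).
have /ereal_inf_lt[_ [U [covU diamU] <-] sumU] := pre.
have fin i : gauge pd t (U i) \is a fin_num.
  rewrite ge0_fin_numE ?gauge_ge0//; apply: le_lt_trans (lt_trans sumU (ltry _)).
  have := @nneseries_lim_ge R (fun i => gauge pd t (U i)) xpredT 0 i.+1 (fun n _ _ => gauge_ge0 _ _ _).
  rewrite big_nat_recr//= => /(le_trans _); apply.
  by apply: leeDr; apply: sume_ge0 => k _; exact: gauge_ge0.
(* The slack [2 ^ - (i + 2)] serves the sets that are empty or of diameter 0, which dictate no
   radius; it adds at most 1/2 in all. *)
have H i : exists nz : nat * (nat -> A1 * A2), [/\ (n0 <= nz.1)%N,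
    U i `<=` @cball R r1 r2 nz.1 nz.2 &
    expR (- (nz.1%:R * (t0 * L))) <= C * fine (gauge pd t (U i)) + 2^-1 ^+ i.+2].
  have g0 : 0 <= C * fine (gauge pd t (U i)) by rewrite mulr_ge0 ?(ltW C0)// fine_ge0// gauge_ge0.
  have e0 : 0 < 2^-1 ^+ i.+2 :> R by rewrite exprn_gt0// invr_gt0.
  have [n1 n01 hn1] := small_ball_exists n0 t00 e0.
  have hn1' : expR (- (n1%:R * (t0 * L))) <= C * fine (gauge pd t (U i)) + 2^-1 ^+ i.+2.
    by apply: (le_trans hn1); rewrite lerDr.
  have [U0|/set0P[z Uz]] := eqVneq (U i) set0.
    by exists (n1, point); split=> //; rewrite U0.
  have dle x y : U i x -> U i y -> ((pd x y)%:E <= diam pd (U i))%E by exact: diam_ge.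
  have := diamU i; have D0 : (0 <= diam pd (U i))%E.
    by apply: le_trans (dle _ _ Uz Uz); rewrite lee_fin pair_dist_ge0.
  case De : (diam pd (U i)) D0 => [d| |]//; rewrite !lee_fin => d0 dn0.
  move: d0; rewrite le_eqVlt => /predU1P[d0|d0].
    exists (n1, z); split=> // z' Uz'; rewrite /cball/=.
    have := dle _ _ Uz Uz'; rewrite De -d0 lee_fin => /le_trans; apply.
    by rewrite invr_ge0 exprn_ge0// ltW.
  have [n nn0 /andP[h1 h2]] := scale_exists d0 dn0.
  exists (n, z); split=> //.
    move=> z' Uz'; rewrite /cball/=; have := dle _ _ Uz Uz'.
    by rewrite De lee_fin => /le_trans; apply.
  apply: (@le_trans _ _ (C * fine (gauge pd t (U i)))); last by rewrite lerDl ltW.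
  have -> : gauge pd t (U i) = (d `^ t)%:E.
    rewrite /gauge ifF ?De ?poweR_EFin//; apply/negP => /eqP e.
    by move: Uz; rewrite e.
  rewrite /= /powR gt_eqF// -expRD ler_expR.
  have h3 : - (n.+1%:R * L) <= ln d.
    have <- : ln (r2%:R ^- n.+1) = - (n.+1%:R * L).
      by rewrite lnV ?posrE ?exprn_gt0// lnXn// mulr_natl.
    by rewrite ler_ln ?posrE ?invr_gt0 ?exprn_gt0// ltW.
  have h4 := ler_wpM2l t_ge0 h3.
  have h5 : n%:R * (t * L) <= n%:R * (t0 * L) by rewrite ler_wpM2l// ler_wpM2r ?(ltW l2)// ltW.
  rewrite -natr1 in h4; lra.
have [nz hnz] := choice H.
have cov z : moran_set len m z -> exists i, in_ball (nz i).1 (nz i).2 (mkseq z (g (nz i).1)).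
  move=> /KE/covU[i _ Uz]; exists i; have [_ /(_ z Uz) + _] := hnz i.
  by rewrite cballE.
have [T hT] := @moran_set_finite_subcover _ _ _ _ len_gt0 (fun i => g (nz i).1)
  (fun i => in_ball (nz i).1 (nz i).2) cov.
have : 1 <= \sum_(i < T) (C * fine (gauge pd t (U i)) + 2^-1 ^+ i.+2).
  rewrite -[leLHS](sum_block_mass T).
  apply: (@le_trans _ _ (\sum_(i < T) \sum_(u <- words (A1 * A2)%type (S T) |
      (g (nz i).1 <= S T)%N && in_ball (nz i).1 (nz i).2 (take (g (nz i).1) u)) block_mass T u)).
    under [leRHS]eq_bigr do rewrite big_mkcond.
    rewrite exchange_big/= big_seq [leRHS]big_seq; apply: ler_sum => u.
    rewrite mem_words => /eqP su.
    have if0 i : 0 <= (if (g (nz i).1 <= S T)%N && in_ball (nz i).1 (nz i).2 (take (g (nz i).1) u)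
        then block_mass T u else 0) by case: ifP => // _; exact: block_mass_ge0.
    have [->|M0] := eqVneq (block_mass T u) 0; first by apply: sumr_ge0 => i _; case: ifP.
    have [|i [iT h1 h2]] := hT u su.
      move=> t1 t1T; rewrite lt0r m_ge0 andbT.
      by move: M0; rewrite /block_mass prodf_seq_neq0 => /allP/(_ (Ordinal t1T)); rewrite mem_index_enum; apply.
    rewrite (bigD1 (Ordinal iT))//= h1 h2/= lerDl; apply: sumr_ge0 => j _; exact: if0.
  apply: ler_sum => i _; have [h1 _ h2] := hnz i.
  apply: (le_trans _ h2).
  case: (leqP (g (nz i).1) (S T)) => h; first exact: hmass.
  by rewrite big_pred0 ?expR_ge0.
rewrite big_split/= -mulr_sumr.
have s1 : \sum_(i < T) fine (gauge pd t (U i)) <= eta.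
  rewrite -lee_fin -sumEFin; apply: le_trans (ltW sumU).
  under eq_bigr do rewrite fineK//.
  by rewrite -(big_mkord xpredT (fun i => gauge pd t (U i))); apply: nneseries_lim_ge => n _ _; exact: gauge_ge0.
have s2 : \sum_(i < T) 2^-1 ^+ i.+2 <= 2^-1 :> R.
  have -> : \sum_(i < T) 2^-1 ^+ i.+2 = 2^-1 - 2^-1 ^+ T.+1 :> R.
    elim: (T) => [|k IH]; first by rewrite big_ord0 expr1 subrr.
    by rewrite big_ord_recr/= IH [_ ^+ k.+2]exprS; lra.
  by rewrite lerBlDr lerDl exprn_ge0// invr_ge0.
have s3 : C * \sum_(i < T) fine (gauge pd t (U i)) <= 4^-1.
  apply: (le_trans (ler_wpM2l (ltW C0) s1)).
  by rewrite /eta invfM mulrCA mulfV ?gt_eqF// mulr1.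
lra.
Qed.

End MassDistribution.

(** [tau t] is the largest index whose block is short compared with [t]:
    [(tau t).+1 * N (tau t) <= t] says that block [t] has length at most [t] times the precision
    [1 / (tau t).+1]. *)
Lemma slow_reindex (N : nat -> nat) : exists tau : nat -> nat,
  (forall J, exists t0, forall t, (t0 <= t)%N -> (J <= tau t)%N) /\
  (exists t0, forall t, (t0 <= t)%N -> ((tau t).+1 * N (tau t) <= t)%N).
Proof.
pose tau t := (\max_(j < t.+1 | (j.+1 * N j <= t)%N) j)%N.
exists tau; split=> [J|].
  exists (maxn J (J.+1 * N J)) => t; rewrite geq_max => /andP[Jt NJ].
  by apply: (@leq_bigmax_cond _ (fun j : 'I_t.+1 => (j.+1 * N j <= t)%N) _ (Ordinal (Jt : (J < t.+1)%N))).
(* An empty maximum is 0, so the inequality at index 0 must hold by itself. *)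
exists (N 0%N) => t N0t; rewrite /tau; elim/big_ind: _ => //; first by rewrite mul1n.
by move=> x y hx hy; rewrite /maxn; case: ifP.
Qed.

(** * Local behaviour of the Moran set *)

Section LowerBound.
Context {R : realType} (r1 r2 : nat).
Hypothesis r1_ge2 : (2 <= r1)%N.
Hypothesis r1_le_r2 : (r1 <= r2)%N.
Local Notation A1 := (letters r1).
Local Notation A2 := (letters r2).
Variables (psi : seq (A1 * A2) -> R) (c : R).
Hypothesis psi_qm : qm c psi.
Hypothesis psi_sum1 : forall n, \sum_(w <- words (A1 * A2)%type n) psi w = 1.

Local Notation s := (@log_ratio R r1 r2).
Local Notation g := (ball_len r1 r2).
Local Notation P := (tilt_pressure psi s).
Local Notation I := (fiber_pow psi).
Local Notation G := (potential psi s).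
Local Notation l1 := (ln r1%:R : R).
Local Notation L := (ln r2%:R : R).
Local Notation pd := (@pair_dist R r1 r2).

Let l10 : 0 < l1. Proof. exact: ln_r1_gt0. Qed.
Let l20 : 0 < L. Proof. exact: ln_r2_gt0 r1_le_r2. Qed.
Let s01 : 0 < s <= 1. Proof. exact: log_ratio01. Qed.
Let s0 : 0 < s. Proof. by case/andP: s01. Qed.
Let s1 : s <= 1. Proof. by case/andP: s01. Qed.
Let l1E : l1 = s * L. Proof. by rewrite /log_ratio divfK// gt_eqF. Qed.
Let c0 : 0 <= c. Proof. exact: qm_const_ge0 psi_qm psi_sum1. Qed.

Variables (len : nat -> nat) (m : nat -> seq (A1 * A2) -> R) (err : nat -> R).
Variables (alpha x b h : R).
Hypothesis err_ge0 : forall t, 0 <= err t.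
Hypothesis err_lim : forall eta, 0 < eta -> exists t0, forall t, (t0 <= t)%N -> err t <= eta.
Hypothesis len_lim : forall eta : R, 0 < eta ->
  exists t0, forall t, (t0 <= t)%N -> (len t)%:R <= eta * t%:R.
Hypothesis h_ge0 : 0 <= h.
Hypothesis m_type : forall t,
  moran_type psi c s (- (l1 * alpha)) (l1 * x) b h (err t) (len t) (m t).

Local Notation S := (block_start len).

Let len_gt0 t : (0 < len t)%N. Proof. by have [[]] := m_type t. Qed.
Let len_c t : c <= err t * (len t)%:R. Proof. by have [[]] := m_type t. Qed.
Let m_ge0 t w : 0 <= m t w. Proof. by have [_ [+ _] _ _] := m_type t; apply. Qed.

Lemma moran_set_supp z : moran_set len m z -> forall n, 0 < psi (mkseq z n).
Proof.
move=> zK n.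
have hS T : 0 < psi (mkseq z (S T)).
  elim: T => [|T IH].
    rewrite /block_start big_ord0; have := psi_sum1 0%N; rewrite sum_words0 => ->.
    exact: ltr01.
  rewrite mkseq_block_startS (qm_gt0 _ _ psi_qm) IH/=.
  have [_ _ + _] := m_type T; move=> /(_ _ (size_word_block len T z) (zK T)) [].
  by [].
have nS := leq_block_start_id len_gt0 n.
have := hS n; rewrite -(subnKC nS) mkseqD (qm_gt0 _ _ psi_qm).
by case/andP.
Qed.

(** Multiplied by [s], the logarithm of a ball mass is F at [n], plus [s * ln (I 1)] at [g n], minus
    [ln (I 1)] at [n], up to a constant. With the common rate [- b], the last two terms differ by
    [o(n)] because [s * (g n)] is within 1 of [n], and F alone gives [alpha]. *)
Lemma moran_set_level : moran_set len m `<=` ball_level psi alpha.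
Proof.
move=> z zK; have zs := moran_set_supp zK; split; first exact: zs.
have blockP t : [/\ `|ln (G (word_block len t z)) - (len t)%:R * (- (l1 * alpha))| <= err t * (len t)%:R &
    `|ln (I 1 (map fst (word_block len t z))) - (len t)%:R * (- b)| <= err t * (len t)%:R].
  have [_ _ + _] := m_type t; move=> /(_ _ (size_word_block len t z) (zK t)) [_ h1 h2 _].
  by split=> //; rewrite mulrN opprK.
apply/cvgrPdist_le => e e0.
pose eta := e * L * s / 8.
have eta0 : 0 < eta by rewrite divr_gt0// mulr_gt0// mulr_gt0.
have [n1 hn1] := block_log_limit len_gt0 err_ge0 err_lim len_lim (- (l1 * alpha)) (potential_qm psi_qm s01) c0 eta0 len_c.
have qI : qm c (fun w : seq (A1 * A2) => I 1 (map fst w)).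
  exact: qm_map (fiber_pow1_qm psi_qm).
have [n2 hn2] := block_log_limit len_gt0 err_ge0 err_lim len_lim (- b) qI c0 eta0 len_c.
pose C := 2 * c + `|b| / s + eta / s.
have [n3 hn3] := exists_nat_ge (C / (e * L / 2)).
exists (maxn 1 (maxn n1 (maxn n2 n3))) => // n /=; rewrite !geq_max => /andP[n0 /andP[n1n /andP[n2n /hn3]]].
have eL : 0 < e * L / 2 by rewrite divr_gt0// mulr_gt0.
rewrite ler_pdivrMr// => hC.
have nR : 0 < n%:R :> R by rewrite ltr0n.
have kG := hn1 z (fun n => potential_gt0 s (zs n)) (fun t => proj1 (blockP t)) n n1n.
have kI := hn2 z (fun n => fiber_pow_gt0 1 (zs n)) (fun t => proj2 (blockP t)).
have gn : (n <= g n)%N by exact: ball_len_ge.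
have kIn := kI n n2n; have kIg := kI (g n) (leq_trans n2n gn).
rewrite !map_mkseq in kIn kIg.
have [S0 kS] := ball_mass_ln r1_ge2 r1_le_r2 psi_qm n zs.
rewrite -!(@fiber_pow1E _ _ _ psi c)// in kS.
have GE : ln (G (mkseq z n)) = (1 - s) * ln (I 1 (mkseq (fst \o z) n)) + s * ln (psi (mkseq z n)).
  have I1 : 0 < I 1 (map fst (mkseq z n)) := fiber_pow_gt0 1 (zs n).
  by rewrite /potential lnM ?posrE ?zpow_gt0// !ln_zpow// map_mkseq.
rewrite GE in kG.
have /andP[sg1 sg2] := log_ratio_ball_len (R := R) r1_ge2 r1_le_r2 n.
set lnS := ln (ball_mass _ _ _) in kS *.
suff key : `|s * lnS + alpha * n%:R * l1| <= s * (e * L) * n%:R.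
  have snL : 0 < s * n%:R * L by rewrite mulr_gt0// mulr_gt0.
  rewrite -(ler_pM2r snL) -[X in _ * X <= _]gtr0_norm// -normrM.
  rewrite (_ : (alpha - _) * _ = s * lnS + alpha * n%:R * l1); last first.
    by rewrite l1E; field; rewrite !gt_eqF.
  by rewrite (_ : e * _ = s * (e * L) * n%:R)//; ring.
have k1 : `|s * lnS - s * (ln (psi (mkseq z n)) + ln (I 1 (mkseq (fst \o z) (g n)))
     - ln (I 1 (mkseq (fst \o z) n)))| <= s * (2 * c).
  by rewrite -mulrBr normrM gtr0_norm// ler_pM2l.
have k2 : `|s * ln (I 1 (mkseq (fst \o z) (g n))) + s * (g n)%:R * b| <= eta * (n%:R + 1).
  apply: (@le_trans _ _ (s * (eta * (g n)%:R))); last first.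
    by rewrite mulrCA ler_pM2l.
  by rewrite -mulrA -mulrDr normrM gtr0_norm// ler_pM2l//; move: kIg; rewrite mulrN opprK.
have k3 : `|(s * (g n)%:R - n%:R) * b| <= `|b|.
  by rewrite normrM ler_piMl// ger0_norm; lra.
have CE : s * C = s * (2 * c) + `|b| + eta by rewrite /C; field; rewrite gt_eqF.
have sC : s * C <= s * (n%:R * (e * L / 2)) by rewrite ler_pM2l.
have eE : eta * n%:R = e * L * s * n%:R / 8 by rewrite /eta; ring.
have n1' : 0 <= s * (e * L) * n%:R by apply: mulr_ge0 => //; apply/ltW; rewrite mulr_gt0// mulr_gt0.
rewrite CE in sC.
move: k1 k2 k3 kIn kG; rewrite !ler_norml => /andP[? ?] /andP[? ?] /andP[? ?] /andP[? ?] /andP[? ?].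
apply/andP; split; lra.
Qed.

Lemma ball_block_mass y : 0 < y -> y < x -> exists n0, forall n z T, (n0 <= n)%N -> (g n <= S T)%N ->
  \sum_(u <- words (A1 * A2)%type (S T) | in_ball n z (take (g n) u)) block_mass len m T u
    <= expR (- (n%:R * (y * L))).
Proof.
move=> y0 yx; pose h2 := (l1 * x - h) / s.
(* Collects what multiplies the errors: [|h2|] for the cut block at [n], and [h + 1] for the cut
   block and the block errors at [g n], which is at most [2 n / s]. *)
pose D := `|h2| + 2 * (h + 1) / s + 1.
have D0 : 0 < D.
  by rewrite /D ltr_wpDl// addr_ge0// divr_ge0 ?(ltW s0)// mulr_ge0// addr_ge0.
pose eta := (x - y) * L / D.
have eta0 : 0 < eta by rewrite divr_gt0// mulr_gt0// subr_gt0.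
have [n0 hn0] := block_error_small len_gt0 err_ge0 err_lim len_lim eta0.
exists (maxn 1 n0) => n z T; rewrite geq_max => /andP[n1 n0n] gT.
have gn : (n <= g n)%N by exact: ball_len_ge.
have [T1 hT1] := block_locate len_gt0 n; have [T2 hT2] := block_locate len_gt0 (g n).
have [e1 l1'] := hn0 n T1 n0n hT1; have [e2 l2'] := hn0 (g n) T2 (leq_trans n0n gn) hT2.
have /andP[T1n nT1] := hT1; have /andP[T2n nT2] := hT2.
have mono a a' : (S a < S a'.+1)%N -> (a <= a')%N.
  by move=> lt; rewrite leqNgt; apply/negP => /(leq_block_start len); rewrite leqNgt lt.
have T2T : (T2 <= T)%N by apply: mono; rewrite (leq_ltn_trans (leq_trans T2n gT))// block_startS -[X in (X < _)%N]addn0 ltn_add2l.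
have T12 : (T1 <= T2)%N by apply: mono; exact: leq_ltn_trans (leq_trans T1n gn) nT2.
(* The ball fixes both coordinates of the first [T1] blocks and the first coordinate of
   the next [T2 - T1]. *)
pose zb t := word_block len t z.
pose f t v := if ((t < T1)%N ==> (v == zb t)) && ((t < T2)%N ==> (map fst v == map fst (zb t))) then m t v else 0.
(* [h2] is the entropy rate of the second coordinate given the first: a fully fixed block pays
   [h + h2] per letter, one with only its first coordinate fixed pays [h], a free one nothing. *)
pose gam t := (if (t < T1)%N then - ((len t)%:R * h2) else 0) +
  (if (t < T2)%N then err t * (len t)%:R - (len t)%:R * h else 0).
have step1 : \sum_(u <- words (A1 * A2)%type (S T) | in_ball n z (take (g n) u)) block_mass len m T u <=
    \sum_(u <- words (A1 * A2)%type (S T)) \prod_(t < T) f t (block len t u).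
  rewrite big_mkcond big_seq [leRHS]big_seq; apply: ler_sum => u; rewrite mem_words => /eqP su.
  have f0 : 0 <= \prod_(t < T) f t (block len t u).
    by apply: prodr_ge0 => t _; rewrite /f; case: ifP.
  case: ifPn => // /andP[/eqP b1 /eqP b2].
  rewrite /block_mass le_eqVlt; apply/orP; left; apply/eqP; apply: eq_bigr => t _.
  rewrite /f ifT//.
  have u1 k : (k <= g n)%N -> map fst (take k u) = mkseq (fst \o z) k.
    move=> kg; rewrite -(take_mkseq (fst \o z) kg) -b1 map_take map_take take_takel//.
  have u2 k : (k <= n)%N -> map snd (take k u) = mkseq (snd \o z) k.
    move=> kn; rewrite -(take_mkseq (snd \o z) kn) -b2 map_take map_take !take_takel//.
    by rewrite (leq_trans kn).
  have ub : block len t u = block len t (take (S t.+1) u).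
    rewrite -{1}(cat_take_drop (S t.+1) u) (@block_cat _ len t t.+1)//.
    by rewrite size_takel// su leq_block_start.
  apply/andP; split; apply/implyP => tT.
    have St : (S t.+1 <= n)%N by apply: leq_trans (leq_block_start len tT) T1n.
    rewrite ub -[take _ u]zip_fst_snd u1 ?u2//; last exact: leq_trans gn.
    by rewrite -(map_mkseq fst z) -(map_mkseq snd z) zip_fst_snd; exact: eqxx.
  have St : (S t.+1 <= g n)%N by apply: leq_trans (leq_block_start len tT) T2n.
  rewrite ub /zb /word_block /block !map_take !map_drop.
  by rewrite u1// map_mkseq.
have step2 t : \sum_(v <- words (A1 * A2)%type (len t)) f t v <= expR (gam t).
  have [_ [_ mt1] mt2 mt3] := m_type t.
  have szb : size (zb t) = len t by exact: size_word_block.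
  have fm v : f t v <= m t v by rewrite /f; case: ifP.
  rewrite /gam; have [tT1|tT1] := ltnP t T1.
    have tT2 := leq_trans tT1 T12; rewrite tT2.
    rewrite (bigD1_seq (zb t)) ?uniq_words ?mem_words ?szb//=.
    rewrite [X in _ + X]big1 ?addr0; last first.
      by move=> v /negbTE vz; rewrite /f tT1 vz.
    apply: (le_trans (fm _)).
    have [->|mz] := eqVneq (m t (zb t)) 0; first exact: expR_ge0.
    have [|_ _ _ hm] := mt2 (zb t) szb; first by rewrite lt0r mz m_ge0.
    by apply: (le_trans hm); rewrite ler_expR -/h2; lra.
  rewrite add0r; have [tT2|tT2] := ltnP t T2.
    apply: (@le_trans _ _ (fiber_sum (m t) (map fst (zb t)))).
      rewrite -(@sum_words_fst _ _ _ _ _ (len t)) ?size_map ?szb// [leRHS]big_mkcond.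
      apply: ler_sum => v _; rewrite /f tT2/= ltnNge tT1/=.
      by case: eqP.
    apply: (le_trans (mt3 _ _)); first by rewrite size_map.
    by rewrite ler_expR; lra.
  rewrite expR0 -mt1; apply: ler_sum => v _; exact: fm.
apply: (le_trans step1); rewrite sum_prod_blocks.
apply: (@le_trans _ _ (\prod_(t < T) expR (gam t))).
  by apply: ler_prod => t _; rewrite step2 andbT; apply: sumr_ge0 => v _; rewrite /f; case: ifP.
rewrite -expR_sum ler_expR /gam big_split/= -!big_mkcond/=.
rewrite -(big_ord_widen T (fun t => - ((len t)%:R * h2)) (leq_trans T12 T2T)).
rewrite -(big_ord_widen T (fun t => err t * (len t)%:R - (len t)%:R * h) T2T).
rewrite sumrN sumrB -!mulr_suml -/(block_error len err T2).
have SR k : \sum_(t < k) (len t)%:R = (S k)%:R :> R by rewrite /block_start natr_sum.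
rewrite !SR.
have gR : s * (g n)%:R <= 2 * n%:R.
  have /andP[_ h3] := log_ratio_ball_len (R := R) r1_ge2 r1_le_r2 n.
  have : 1 <= n%:R :> R by rewrite ler1n.
  lra.
have gR' : n%:R / s <= (g n)%:R.
  by rewrite ler_pdivrMr// mulrC; have /andP[] := log_ratio_ball_len (R := R) r1_ge2 r1_le_r2 n.
have gR2 : (g n)%:R <= 2 * n%:R / s by rewrite ler_pdivlMr// mulrC.
have a1 : n%:R - (S T1)%:R <= eta * n%:R.
  apply: le_trans l1'; rewrite lerBlDl -natrD ler_nat -block_startS; exact: ltnW.
have a1' : 0 <= n%:R - (S T1)%:R :> R by rewrite subr_ge0 ler_nat.
have a2 : (g n)%:R - (S T2)%:R <= eta * (g n)%:R.
  apply: le_trans l2'; rewrite lerBlDl -natrD ler_nat -block_startS; exact: ltnW.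
have b1 : (n%:R - (S T1)%:R) * h2 <= eta * n%:R * `|h2|.
  apply: (le_trans (ler_norm _)); rewrite normrM ger0_norm//.
  by rewrite ler_wpM2r.
have b2 : ((g n)%:R - (S T2)%:R) * h <= eta * (g n)%:R * h by rewrite ler_wpM2r.
have b3 : eta * (g n)%:R * (h + 1) <= eta * (2 * n%:R / s) * (h + 1).
  by rewrite ler_wpM2r ?addr_ge0// ler_pM2l.
have b4 : n%:R / s * h <= (g n)%:R * h by rewrite ler_wpM2r.
(* Here [h] cancels: [n] letters at rate [h2] and [n / s] letters at rate [h] give
   [n * (l1 * x) / s], and [l1 = s * L]. *)
have b5 : n%:R * h2 + n%:R / s * h = n%:R * (x * L).
  by rewrite /h2 l1E; field; rewrite gt_eqF.
have b6 : eta * n%:R * (`|h2| + 2 * (h + 1) / s) <= n%:R * ((x - y) * L).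
  have : eta * D = (x - y) * L by rewrite /eta divfK// gt_eqF.
  have : 0 <= eta * n%:R by rewrite mulr_ge0// ltW.
  rewrite /D => h3 <-; lra.
lra.
Qed.

End LowerBound.

(** * Dimension of the level sets *)

Section LevelDimension.
Context {R : realType} (r1 r2 : nat).
Hypothesis r1_ge2 : (2 <= r1)%N.
Hypothesis r1_le_r2 : (r1 <= r2)%N.
Local Notation A1 := (letters r1).
Local Notation A2 := (letters r2).
Variables (psi : seq (A1 * A2) -> R) (c : R).
Hypothesis psi_qm : qm c psi.
Hypothesis psi_sum1 : forall n, \sum_(w <- words (A1 * A2)%type n) psi w = 1.

Local Notation s := (@log_ratio R r1 r2).
Local Notation P := (tilt_pressure psi s).
Local Notation l1 := (ln r1%:R : R).
Local Notation pd := (@pair_dist R r1 r2).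

Lemma ball_level_dim_gt alpha x y : (forall q, x <= alpha * q + P q / l1) -> 0 < y -> y < x ->
  (y%:E <= hausdorff_dim pd (ball_level psi alpha))%E.
Proof.
move=> hx y0 yx; have x0 : 0 <= x by apply: ltW; exact: lt_trans yx.
have l10 : 0 < l1 by exact: ln_r1_gt0.
have s01 : 0 < s <= 1 by exact: log_ratio01.
have [M M0 hM] := moran_type_approx psi_qm psi_sum1 s01 l10 x0 hx.
have [b [h [h0 hbh]]] := moran_type_limit s01 hM.
have H j : exists Nm : nat * (seq (A1 * A2) -> R),
    moran_type psi c s (- (l1 * alpha)) (l1 * x) b h (j.+1%:R^-1) Nm.1 Nm.2.
  have [|N [m hm]] := hbh (j.+1%:R^-1); first by rewrite invr_gt0.
  by exists (N, m).
have [Nm hNm] := choice H.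
have [tau [tau1 [t1 tau2]]] := slow_reindex (fun j => (Nm j).1).
pose len t := (Nm (tau t)).1; pose m t := (Nm (tau t)).2.
pose err t : R := (tau t).+1%:R^-1.
have hm t : moran_type psi c s (- (l1 * alpha)) (l1 * x) b h (err t) (len t) (m t) by exact: hNm.
have err_ge0 t : 0 <= err t by rewrite invr_ge0.
have err_lim (eta : R) : 0 < eta -> exists t0, forall t, (t0 <= t)%N -> err t <= eta.
  move=> eta0; have [J hJ] := exists_nat_ge eta^-1; have [t0 ht0] := tau1 J.
  exists t0 => t /ht0 Jt; rewrite /err invf_ple ?posrE//.
  by apply: hJ; exact: leqW.
have len_lim (eta : R) : 0 < eta -> exists t0, forall t, (t0 <= t)%N -> (len t)%:R <= eta * t%:R.
  move=> eta0; have [t0 ht0] := err_lim eta eta0; exists (maxn t0 t1) => t.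
  rewrite geq_max => /andP[/ht0 h1 /tau2 h2].
  apply: (@le_trans _ _ (err t * t%:R)); last by rewrite ler_wpM2r.
  by rewrite /err mulrC ler_pdivlMr// -natrM ler_nat mulnC.
have [n0 hn0] := ball_block_mass r1_ge2 r1_le_r2 err_ge0 err_lim len_lim h0 hm y0 yx.
apply: (@hausdorff_dim_ge _ _ _ r1_ge2 r1_le_r2 len m _ _ _ _ y n0) => //.
- by move=> t; have [[]] := hm t.
- by move=> t w; have [_ [+ _] _ _] := hm t; apply.
- by move=> t; have [_ [_ +] _ _] := hm t; apply.
- exact: moran_set_level hm.
Qed.

Lemma ball_level_dim_ge alpha x : (forall q, x <= alpha * q + P q / l1) -> 0 < x ->
  (x%:E <= hausdorff_dim pd (ball_level psi alpha))%E.
Proof.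
move=> hx x0; rewrite leNgt; apply/negP => lt.
(* The instance [x / 2] excludes the value [-oo], after which the midpoint between the real
   dimension and [x] gives the contradiction. *)
have h1 := ball_level_dim_gt hx (divr_gt0 x0 (ltr0n _ 2)).
have x2 : x / 2 < x by lra.
move: lt (h1 x2); case De : (hausdorff_dim _ _) => [r| |]//; rewrite lte_fin lee_fin => rx xr.
have := @ball_level_dim_gt alpha x ((r + x) / 2) hx; rewrite De lee_fin; lra.
Qed.

Lemma ball_level_dim_le alpha x : (forall e, 0 < e -> exists q, alpha * q + P q / l1 < x + e) ->
  0 < x -> (hausdorff_dim pd (ball_level psi alpha) <= x%:E)%E.
Proof.
move=> hx x0; apply/lee_addgt0Pr => e e0.
have [q hq] := hx e e0; apply: ereal_inf_lbound; exists (x + e) => //.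
have xe : 0 < x + e by rewrite addr_gt0.
by split; [exact: ltW|exact: (hausdorff_measure_level r1_ge2 r1_le_r2 psi_qm psi_sum1 hq)].
Qed.

Lemma beta_tilt q : beta r1 r2 psi q = - P q / l1.
Proof.
rewrite /beta -/(@log_ratio R r1 r2); congr (- _ / _); rewrite /tilt_pressure; congr pressure.
apply/funext => u; rewrite /tilt_base.
have e p : partial_sum psi p u = fiber_pow psi p u.
  by rewrite /partial_sum fiber_powE -sum_words_tuple; apply: eq_bigr => v _; rewrite unlock.
by rewrite !e [in RHS]unlock.
Qed.

End LevelDimension.

Theorem theorem3p2 (R : realType) (r1 r2 : nat)
    (r1_ge2 : (2 <= r1)%N) (r1_le_r2 : (r1 <= r2)%N)
    (psi : seq (letters r1 * letters r2) -> R)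
    (psiAM : almost_multiplicative psi)
    (psiP : pressure psi = 0)
    (mu : probability (symbolic (letters r1 * letters r2)%type) R)
    (muG : is_gibbs psi mu)
    (psi_mu : forall w, (psi w)%:E = mu (cylinder w)) :
  [/\ convex_function [set: R^o] (fun q => - beta r1 r2 psi q),
      forall q, derivable (beta r1 r2 psi) q 1 &
      forall q q', q <= q' -> beta r1 r2 psi q <= beta r1 r2 psi q'] /\
  forall alpha : R, 0 <= alpha ->
    ((0 < legendre (beta r1 r2 psi) alpha)%E ->
       hausdorff_dim (pair_dist r1 r2) (level_set psi mu alpha)
         = legendre (beta r1 r2 psi) alpha) /\
    ((legendre (beta r1 r2 psi) alpha < 0)%E -> level_set psi mu alpha = set0).
Proof.
have [psi0 _ [C C0 hC]] := psiAM.
have psi_qm : qm (ln C) psi.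
  split=> // u v; rewrite lnK ?posrE//; have [h1 h2] := hC u v; split.
    by rewrite [leRHS]mulrC -ler_pdivrMr// [leLHS]mulrC mulrA.
  by rewrite mulrA.
have psi_sum1 := sum_words_measure psi_mu.
pose s : R := log_ratio r1 r2; have s01 : 0 < s <= 1 by exact: log_ratio01.
have l10 : 0 < ln r1%:R :> R by exact: ln_r1_gt0.
pose P := tilt_pressure psi s.
have betaE : beta r1 r2 psi = fun q => - P q / ln r1%:R by apply/funext => q; exact: beta_tilt.
have levelE alpha : level_set psi mu alpha = ball_level psi alpha.
  have muE n z : fine (mu (cball r1 r2 n z)) = ball_mass psi n z.
    by rewrite cballE// (measure_prefix_sum psi_mu).
  rewrite /level_set /ball_level; apply/seteqP; split => z [sz lz]; split=> //.
    by move: lz; under eq_fun do rewrite muE.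
  by under eq_fun do rewrite muE.
split.
  split.
  - move=> t p q _ _; rewrite betaE.
    have h := @tilt_pressure_convex _ _ _ _ _ _ psi_qm psi_sum1 s01 p q t%:num.
    have t01 : 0 <= t%:num <= 1 by apply/andP; split.
    have ce : conv t p q = t%:num * (p : R) + (1 - t%:num) * (q : R) by [].
    rewrite !convRE ce /unstable.onem !mulNr !opprK !mulrA -mulrDl.
    by rewrite ler_wpM2r ?h// invr_ge0 ltW.
  - move=> q; rewrite betaE; have [l [dP _] _] := tilt_pressure_derivative psi_qm psi_sum1 s01 q.
    have -> : (fun q => - P q / ln r1%:R) = (- (ln r1%:R)^-1) \*: P.
      by apply/funext => v; rewrite /= /GRing.scale/=; ring.
    by apply: derivableZ.
  move=> p q pq; rewrite betaE ler_wpM2r ?invr_ge0 ?(ltW l10)// lerN2.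
  exact: (tilt_pressure_nincr psi_qm psi_sum1).
move=> alpha _; rewrite levelE.
have legE q : alpha * q - beta r1 r2 psi q = alpha * q + P q / ln r1%:R.
  by rewrite betaE mulNr opprK.
split=> [leg0|].
  case legx : (legendre (beta r1 r2 psi) alpha) leg0 => [x| |]//; last first.
    (* The value at [q = 0] is real, so the infimum cannot be [+oo]. *)
    have : (legendre (beta r1 r2 psi) alpha <= (alpha * 0 - beta r1 r2 psi 0)%:E)%E.
      by apply: ereal_inf_lbound; exists 0.
    by rewrite legx.
  rewrite lte_fin => x0; apply/eqP; rewrite eq_le; apply/andP; split.
    apply: (ball_level_dim_le r1_ge2 r1_le_r2 psi_qm psi_sum1) => // e e0.
    have : (legendre (beta r1 r2 psi) alpha < (x + e)%:E)%E by rewrite legx lte_fin ltrDl.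
    by move=> /ereal_inf_lt[_ [q _ <-]]; rewrite lte_fin legE => h; exists q.
  apply: (ball_level_dim_ge r1_ge2 r1_le_r2 psi_qm psi_sum1) => // q.
  rewrite -legE -lee_fin -legx; apply: ereal_inf_lbound; by exists q.
move=> /ereal_inf_lt[_ [q _ <-]]; rewrite lte_fin legE.
exact: (ball_level_empty r1_ge2 r1_le_r2 psi_qm psi_sum1).
Qed.
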